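(* Let $\mathcal N$ be a semifinite factor with faithful normal semifinite trace $\tau$, and let $P,Q\in\mathcal N$ be infinite and co-infinite projections. Suppose $(P-Q)^2\in Li_0^q$ for some $0<q\le 1$. Then $F_0=2P-1$ and $F_1=2Q-1$ are self-adjoint Breuer-Fredholm operators, as is every operator of the path $F_t=F_0+t(F_1-F_0)$, $t\in[0,1]$. Moreover, for every $r\ge 0$, $$sf(\{F_t\})=\frac{1}{C_{r,q}}\int_0^1\tau\Big(\frac{d}{dt}(F_t)\,(1-F_t^2)^{-r}e^{-(1-F_t^2)^{-1/q}}\Big)dt,$$ where $C_{r,q}=\int_{-1}^1(1-u^2)^{-r}e^{-(1-u^2)^{-1/q}}\,du$.
   Context: $\mathcal N$ has separable predual. For $S\in\mathcal N$ and $t>0$, $\mu_t(S)=\inf\{\|SE\| : E\in\mathcal N \text{ a projection},\ \tau(1-E)\le t\}$. $Li_0^q=\{T\in\mathcal N:\mu_t(T)=o((1/\log t)^q)\text{ as }t\to\infty\}$. A projection $P$ is co-infinite if $1-P$ is infinite. The function $x\mapsto x^{-r}e^{-x^{-1/q}}$ on $[0,\infty)$ is defined to be $0$ at $x=0$; it is applied to $1-F_t^2\ge 0$ by functional calculus. $\mathcal K_{\mathcal N}$ is the norm-closed two-sided ideal of $\mathcal N$ generated by the elements of finite trace, $\pi:\mathcal N\to\mathcal N/\mathcal K_{\mathcal N}$ the quotient map; $T\in\mathcal N$ is Breuer-Fredholm if $\pi(T)$ is invertible. Spectral flow: for a norm-continuous path $\{F_t\}_{t\in[a,b]}$ of self-adjoint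 Breuer-Fredholm operators in $\mathcal N$ let $P_t=\chi_{[0,\infty)}(F_t)$. Then $t\mapsto\pi(P_t)$ is continuous; choose a partition $a=t_0<\dots<t_n=b$ such that $\pi(P_t)$ varies by less than $1$ in norm on each subinterval (fine enough), and put $sf(\{F_t\})=\sum_{i=1}^n\operatorname{ind}(P_{t_{i-1}}P_{t_i})$, where for projections with $\|\pi(P)-\pi(Q)\|<1$, $\operatorname{ind}(PQ)$ is the index of $PQ:\operatorname{ran}Q\to\operatorname{ran}P$, i.e. $\tau([\operatorname{ran}Q\cap\ker P])-\tau([\ker Q\cap\operatorname{ran}P])$, $[V]$ being the projection onto $V$. If all $F_t$ lie in $F_a+\mathcal K_{\mathcal N}$, then $\pi(P_t)$ is constant and $sf(\{F_t\})=\operatorname{ind}(P_aP_b)$. *)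

(* Defs.v *)
From HB Require Import structures.
From mathcomp Require Import all_boot all_order all_algebra.
From mathcomp Require Import complex.
From mathcomp Require Import all_classical all_reals all_analysis.

Set Implicit Arguments.
Unset Strict Implicit.
Unset Printing Implicit Defensive.

Import Order.TTheory GRing.Theory Num.Theory.
Import numFieldNormedType.Exports.

Local Open Scope classical_set_scope.
Local Open Scope ring_scope.
Local Open Scope complex_scope.

(* A complex Hilbert space is a complete normed R[i]-module H with a dot
   product ip (linear in the first variable) inducing the norm. Operators are
   plain functions H -> H with the pointwise module structure; composition is
   \o and the identity is idfun. *)

Definition at_infty {R : realType} : filter_on R :=
  FilterType +oo_R _.

Section operators.
Context {R : realType} {H : completeNormedModType R[i]}.
Implicit Types (T S : H -> H) (F : R -> H -> H).

Definition bounded_operator T := linear T /\ continuous T.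

Definition opnorm T : R :=
  sup [set complex.Re `|T x| | x in [set x : H | `|x| <= 1]].

Definition norm_continuous_path (a b : R) F := forall t, t \in `[a, b] ->
  opnorm (F s - F t) @[s --> within `[a, b] (nbhs t)] --> (0 : R).

(* Boundedness is required because opnorm is meaningless (sup of an unbounded
   set) on unbounded operators. *)
Definition norm_derive F (t : R) : H -> H :=
  xget 0 [set D | bounded_operator D /\
    opnorm ((h^-1)%:C *: (F (t + h) - F t) - D) @[h --> (0 : R)^'] --> (0 : R)].

End operators.

Section hilbert.
Context {R : realType} {H : completeNormedModType R[i]}.
Variable ip : {dot H for Num.conj}.
Implicit Types (T S P Q E : H -> H) (N A : set (H -> H)).

Definition adjoint T S := forall x y, ip (T x) y = ip x (S y).

Definition selfadjoint T := bounded_operator T /\ adjoint T T.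

Definition positive_op T := bounded_operator T /\ forall x, 0 <= ip (T x) x.

Definition op_le S T := forall x, ip (S x) x <= ip (T x) x.

Definition projection E := selfadjoint E /\ E \o E = E.

(* [V]; the default value is only taken when V is not a closed subspace. *)
Definition proj_onto (V : set H) : H -> H :=
  xget 0 [set E | projection E /\ range E = V].

(* mu x is the scalar measure A |-> <E(A)x, x>. Multiplicativity of E follows
   from additivity, as the values of E are projections. *)
Definition spectral_measure T (E : set R -> H -> H)
    (mu : H -> {measure set (measurableTypeR R) -> \bar R}) :=
  [/\ forall B : set (measurableTypeR R), measurable B -> projection (E B),
      E setT = idfun,
      forall x (B : set (measurableTypeR R)), measurable B ->
        mu x B = (complex.Re (ip (E B x) x))%:E &
      forall x, (\int[mu x]_l l%:E = (complex.Re (ip (T x) x))%:E)%E].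

(* f(T) for T self-adjoint and f Borel and bounded on the spectrum of T. *)
Definition borel_calculus (f : R -> R) T : H -> H :=
  xget 0 [set S | selfadjoint S /\ exists (E : set R -> H -> H) mu, spectral_measure T E mu /\
    forall x, (\int[mu x]_l (f l)%:E = (complex.Re (ip (S x) x))%:E)%E].

Definition nonneg_spectral_proj T : H -> H :=
  borel_calculus (\1_(`[0, +oo[ : set R)) T.

Definition commutant A : set (H -> H) :=
  [set T | bounded_operator T /\ forall S, A S -> T \o S = S \o T].

Definition von_neumann_algebra N :=
  (forall T, N T -> exists2 S, N S & adjoint T S) /\
  commutant (commutant N) = N.

Definition vn_factor N := von_neumann_algebra N /\
  forall T, N T -> commutant N T -> exists c : R[i], T = c *: idfun.

(* The predual of N: the ultraweakly continuous functionals on N. *)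
Definition in_predual N (phi : (H -> H) -> R[i]) :=
  exists x y : nat -> H,
    [/\ cvgn (series (fun n => complex.Re `|x n| ^+ 2)),
        cvgn (series (fun n => complex.Re `|y n| ^+ 2)) &
        forall T, N T ->
          (series (fun n => ip (T (x n)) (y n) : R[i]^o)) @ \oo --> (phi T : R[i]^o)].

Definition separable_predual N :=
  exists phi : nat -> (H -> H) -> R[i],
    (forall n, in_predual N (phi n)) /\
    forall psi, in_predual N psi -> forall e : R, 0 < e ->
      exists n, forall T, N T -> opnorm T <= 1 -> `|psi T - phi n T| <= e%:C.

Definition mvn_equiv N P Q :=
  exists V W, [/\ N V, N W, adjoint V W, W \o V = P & V \o W = Q].

Definition infinite_proj N P := exists Q,
  [/\ N Q, projection Q, op_le Q P, Q <> P & mvn_equiv N P Q].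

End hilbert.

Section trace.
Context {R : realType} {H : completeNormedModType R[i]}.
Variables (ip : {dot H for Num.conj}) (N : set (H -> H)).
(* Only the values of tau on the positive cone of N are relevant. *)
Variable tau : (H -> H) -> \bar R.
Implicit Types (T S P Q E : H -> H) (F : R -> H -> H).

Definition pos_cone : set (H -> H) := [set T | N T /\ positive_op ip T].

Definition is_trace :=
  [/\ forall T, pos_cone T -> (0 <= tau T)%E,
      forall S T, pos_cone S -> pos_cone T -> tau (S + T) = (tau S + tau T)%E,
      forall (c : R) T, 0 <= c -> pos_cone T ->
        tau (c%:C *: T) = (c%:E * tau T)%E &
      forall T S, N T -> N S -> adjoint ip T S -> tau (S \o T) = tau (T \o S)].

Definition faithful_trace := forall T, pos_cone T -> tau T = 0%E -> T = 0.

Definition is_lub_in (A : set (H -> H)) T :=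
  [/\ pos_cone T, forall S, A S -> op_le ip S T &
      forall U, N U -> selfadjoint ip U ->
        (forall S, A S -> op_le ip S U) -> op_le ip T U].

Definition normal_trace := forall (A : set (H -> H)) T,
  A !=set0 -> A `<=` pos_cone ->
  (forall S U, A S -> A U ->
     exists V, [/\ A V, op_le ip S V & op_le ip U V]) ->
  is_lub_in A T -> tau T = ereal_sup (tau @` A).

Definition semifinite_trace := forall T, pos_cone T -> T <> 0 ->
  exists S, [/\ pos_cone S, S <> 0, op_le ip S T & (tau S < +oo)%E].

Definition fns_trace :=
  [/\ is_trace, faithful_trace, normal_trace & semifinite_trace].

Definition finite_pos : set (H -> H) :=
  [set T | pos_cone T /\ (tau T < +oo)%E].

Definition trace_decomp T (A : H -> H) B C D :=
  [/\ finite_pos A, finite_pos B, finite_pos C, finite_pos D &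
      T = (A - B) + 'i *: (C - D)].

(* The elements of finite trace are the linear span of finite_pos; tau extends
   to it by linearity. *)
Definition finite_trace : set (H -> H) :=
  [set T | exists A B C D, trace_decomp T A B C D].

Definition trace_ext T : R[i] := xget 0 [set c | exists A B C D,
  trace_decomp T A B C D /\
  c = (fine (tau A) - fine (tau B)) +i* (fine (tau C) - fine (tau D))].

Definition sing_value (t : R) S : R :=
  inf [set opnorm (S \o E) | E in
    [set E | [/\ N E, projection ip E & (tau (idfun - E)%R <= t%:E)%E]]].

Definition Li0 (q : R) : set (H -> H) := [set T | N T /\
  (sing_value ^~ T : R -> R^o) =o_at_infty (fun t => (ln t)^-1 `^ q : R^o)].

Definition closed_ideal (J : set (H -> H)) :=
  [/\ J `<=` N, J 0, forall S T, J S -> J T -> J (S + T),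
      forall S T, N S -> J T -> J (S \o T) /\ J (T \o S) &
      forall T, N T ->
        (forall e : R, 0 < e -> exists2 S, J S & opnorm (T - S) < e) -> J T].

Definition compact_ideal : set (H -> H) :=
  [set T | forall J, closed_ideal J -> finite_trace `<=` J -> J T].

Definition quot_opnorm T : R := inf [set opnorm (T - K) | K in compact_ideal].

(* Invertibility of the class of T in the quotient of N by compact_ideal. *)
Definition breuer_fredholm T := N T /\ exists S,
  [/\ N S, compact_ideal ((S \o T) - idfun) & compact_ideal ((T \o S) - idfun)].

(* Finite whenever quot_opnorm (P - Q) < 1; an infinite term makes the value
   infinite, as +oo - +oo = -oo in \bar R. *)
Definition proj_index P Q : \bar R :=
  (tau (proj_onto ip (range Q `&` [set x | P x = 0%R])) -
   tau (proj_onto ip ([set x | Q x = 0%R] `&` range P)))%E.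

Definition fredholm_path (a b : R) F := norm_continuous_path a b F /\
  forall t, t \in `[a, b] -> selfadjoint ip (F t) /\ breuer_fredholm (F t).

(* v is the spectral flow of F: "fine enough" partitions are those with mesh
   less than some positive d. The points are a :: s. *)
Definition is_spectral_flow (a b : R) F (v : R) :=
  fredholm_path a b F /\
  let P t := nonneg_spectral_proj ip (F t) in
  exists2 d : R, 0 < d & forall s : seq R, itv_partition a b s ->
    let p i := nth b (a :: s) i in
    (forall i, (i < size s)%N -> p i.+1 - p i < d) ->
    (forall i, (i < size s)%N -> forall t u,
       t \in `[p i, p i.+1] -> u \in `[p i, p i.+1] ->
       quot_opnorm (P t - P u) < 1) /\
    (\sum_(i < size s) proj_index (P (p i)) (P (p i.+1)) = v%:E)%E.

End trace.

Section integrals.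
Context {R : realType}.

Definition complex_integrable (D : set R) (g : R -> R[i]) :=
  (@lebesgue_measure R).-integrable D (fun t => (complex.Re (g t))%:E) /\
  (@lebesgue_measure R).-integrable D (fun t => (complex.Im (g t))%:E).

Definition complex_integral (D : set R) (g : R -> R[i]) : R[i] :=
  Rintegral (@lebesgue_measure R) D (fun t => complex.Re (g t)) +i*
  Rintegral (@lebesgue_measure R) D (fun t => complex.Im (g t)).

(* Extended by 0 to the negative reals, which do not meet the spectra of the
   operators it is applied to. *)
Definition weight (r q x : R) : R :=
  if 0 < x then x `^ (- r) * expR (- (x `^ (- q^-1))) else 0.

Definition Crq (r q : R) : R :=
  Rintegral (@lebesgue_measure R) `[-1, 1] (fun u => weight r q (1 - u ^+ 2)).

End integrals.

(* Main.v *)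
Require Import Defs.
From HB Require Import structures.
From mathcomp Require Import all_boot all_order all_algebra.
From mathcomp Require Import complex finmap.
From mathcomp Require Import all_classical all_reals all_analysis.
From mathcomp Require Import measurable_realfun.
From mathcomp Require Import ring lra zify.

(* Let A = (P - Q)^2. It commutes with P and Q, and 1 - F_t^2 = 4 t (1 - t) A, so the
   integrand at time t is 2 tau ((Q - P) w(c A)) with c = 4 t (1 - t) and w the weight.
   Put W = w(c A). The hypothesis A in Li_0^q bounds the trace of the spectral projections
   of A by e^n on the slice of values comparable to n^(-q), where W is O(e^(-2 n)); hence
   tau W < oo. From Q (1 - A) = Q P Q, P (1 - A) = P Q P and tau (T^* T) = tau (T T^* ) one
   gets tau (Q W A^n) - tau (P W A^n) independent of n. As n grows, Q A^n and P A^n decrease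
   to the projections V and V' onto ran Q /\ ker P and ran P /\ ker Q, on which W acts as
   w(c). So the integrand is 2 w(4 t (1 - t)) (tau V - tau V'), and the substitution
   u = 2 t - 1 gives C_(r,q) (tau V - tau V').
   For the spectral flow, P_t - P_u is compact because 2 P_t - 1 - F_t = (2 P_t - 1) (1 - |F_t|)
   and 1 - |F_t| is compact together with 1 - F_t^2. A vector which is in the range of one of
   P_t, P_u and in the kernel of the other lies in ker (1 - A), where F_t = (1 - 2 t) F_0; so
   the index of P_t P_u only changes at t = 1/2, and the indices add up to tau V - tau V'. *)

Set Implicit Arguments.
Unset Strict Implicit.
Unset Printing Implicit Defensive.

Import Order.TTheory GRing.Theory Num.Theory.
Import numFieldNormedType.Exports.

Local Open Scope classical_set_scope.
Local Open Scope ring_scope.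
Local Open Scope complex_scope.
Import HBNNSimple.

(** * The ring of bounded operators *)

(** The calculus in the statement is a choice ([xget]) among operators that admit some spectral
    measure, so evaluating it takes both halves of the spectral theorem: such a measure exists, and
    any two agree. The existence half starts from square roots. They give the projection onto the
    negative part of [T - l], hence a spectral family, whose Stieltjes measures are extended to
    Borel sets. Operators are compared throughout by their real quadratic forms, and a constructed
    operator stays in [N] because it lies in the bicommutant of an element of [N]. The traces of [P]
    and [Q] are infinite, so [tau (W (Q - P))] can only be split once [W] is known to have finite
    trace; the decay of the weight is set against the logarithmic decay of the singular values for
    this purpose. The spectral projections of the path at different times need not commute. What
    does commute with [P] and [Q] is the modulus of [F_t], since [F_t^2] is affine in [A]; this
    confines every vector that contributes to an index to [ker (1 - A)], where [Q = 1 - P] and all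
    the projections are explicit. *)

Section bounded_operators.
Context {R : realType} {H : completeNormedModType R[i]}.

Lemma RcD (a b : R) : (a + b)%:C = a%:C + b%:C.
Proof. exact: rmorphD. Qed.

Lemma RcM (a b : R) : (a * b)%:C = a%:C * b%:C.
Proof. exact: rmorphM. Qed.

(** The norm of [H] lives in [R[i]]; by [nrE] its real part loses nothing, and estimates then take
    place in a totally ordered field. *)
Definition nr (x : H) : R := complex.Re `|x|.

Lemma nrE (x : H) : `|x| = (nr x)%:C.
Proof.
have := normr_ge0 x; rewrite /nr lecE => /andP[/eqP Im0 _].
by case: `|x| Im0 => a b /= ->.
Qed.

Lemma nr_ge0 x : 0 <= nr x.
Proof. by rewrite -ler0c -nrE. Qed.

Lemma nr_eq0 x : (nr x == 0) = (x == 0).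
Proof. by rewrite -(normr_eq0 x) nrE eq_complex /= eqxx andbT. Qed.

Lemma nr0 : nr 0 = 0.
Proof. by apply/eqP; rewrite nr_eq0. Qed.

Lemma nrD x y : nr (x + y) <= nr x + nr y.
Proof. by rewrite -lecR RcD -!nrE ler_normD. Qed.

Lemma nrN x : nr (- x) = nr x.
Proof. by rewrite /nr normrN. Qed.

Lemma nrB x y : nr (x - y) = nr (y - x).
Proof. by rewrite -nrN opprB. Qed.

Lemma normcR (c : R) : `|c%:C| = `|c|%:C.
Proof. by rewrite normc_def /= expr0n /= addr0 sqrtr_sqr. Qed.

Lemma nrZ (c : R) x : nr (c%:C *: x) = `|c| * nr x.
Proof. by apply: complexI; rewrite -nrE normrZ nrE normcR -RcM. Qed.

Lemma nrZc (c : R[i]) x : nr (c *: x) = complex.Re `|c| * nr x.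
Proof.
by apply: complexI; rewrite -nrE normrZ nrE RcM; congr (_ * _).
Qed.

(** Homogeneity turns continuity at 0 into a linear bound. The constant obtained is a positive
    element of [R[i]], hence real. *)
Lemma bounded_operatorP (T : H -> H) :
  bounded_operator T <->
  linear T /\ exists2 M : R, 0 <= M & forall x, nr (T x) <= M * nr x.
Proof.
split=> [[linT cT]|[linT [M M0 bT]]]; split=> //.
- pose f : {linear H -> H} := HB.pack T (GRing.isLinear.Build _ _ _ _ T linT).
  have /linear_boundedP : bounded_near f (nbhs (0 : H)).
    exact/linear_bounded_continuous.
  move/pinfty_ex_gt0 => [r r0 bT].
  exists (complex.Re r).
    by move: r0; rewrite ltcE /= => /andP[_ /ltW].
  move=> x; rewrite -lecR -nrE (le_trans (bT x))// nrE RcM.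
  suff -> : r = (complex.Re r)%:C by [].
  by move: r0; rewrite ltcE /=; case: (r) => a b /= /andP[/eqP -> _].
- pose f : {linear H -> H} := HB.pack T (GRing.isLinear.Build _ _ _ _ T linT).
  apply: (@bounded_linear_continuous _ _ _ f).
  apply/linear_boundedP.
  exists M%:C; split; first exact/complex_realP/(ex_intro _ M).
  move=> x Mx y; rewrite !nrE.
  apply: (@le_trans _ _ (M%:C * (nr y)%:C)).
    by rewrite -RcM lecR; exact: bT.
  by rewrite ler_wpM2r// ?ler0c ?nr_ge0// ltW.
Qed.

Definition bop_pred : {pred H -> H} := fun T => `[< bounded_operator T >].

(** Bundling makes bounded operators a ring with composition as product, while the coercion keeps
    sums, multiples and products convertible to the pointwise operations on plain functions used in
    the statement. *)
Record bop := Bop { bop_fun :> H -> H ; bop_in : bop_fun \in bop_pred }.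

HB.instance Definition _ := [isSub for bop_fun].
HB.instance Definition _ := [Choice of bop by <:].

Lemma bop_pred_submod : submod_closed bop_pred.
Proof.
split=> [|a S T /asboolP/bounded_operatorP[lS [M M0 bS]]
           /asboolP/bounded_operatorP[lT [K K0 bT]]].
  apply/asboolP/bounded_operatorP; split; first by move=> a u v; rewrite scaler0 addr0.
  by exists 0 => // x; rewrite nr0 mul0r.
apply/asboolP/bounded_operatorP; split.
  move=> b u v; rewrite /= !fctE /= lS lT !scalerDr !scalerA mulrC.
  by rewrite addrACA.
exists (complex.Re `|a| * M + K).
  rewrite addr_ge0 ?mulr_ge0//.
  by have := normr_ge0 a; rewrite lecE => /andP[].
move=> x; rewrite !fctE (le_trans (nrD _ _))// mulrDl lerD// nrZc -mulrA.
rewrite ler_wpM2l//.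
by have := normr_ge0 a; rewrite lecE => /andP[].
Qed.

HB.instance Definition _ := GRing.isSubmodClosed.Build _ _ bop_pred bop_pred_submod.
HB.instance Definition _ := [SubChoice_isSubLmodule of bop by <:].

Lemma bop_ext (S T : bop) : (forall x, S x = T x) -> S = T.
Proof. by move=> ST; apply/val_inj/funext. Qed.

Lemma bop_bounded (T : bop) : bounded_operator T.
Proof. by case: T => T /= /asboolP. Qed.

HB.instance Definition _ (T : bop) :=
  GRing.isLinear.Build _ _ _ _ (T : H -> H) (bop_bounded T).1.

Lemma bop_norm (T : bop) : exists2 M : R, 0 <= M & forall x, nr (T x) <= M * nr x.
Proof. by have /bounded_operatorP[] := bop_bounded T. Qed.

Lemma bounded_operator_id : bounded_operator (idfun : H -> H).
Proof.
apply/bounded_operatorP; split=> //.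
by exists 1 => // x; rewrite mul1r.
Qed.

Definition bop1 : bop := Bop (asboolT bounded_operator_id).

Lemma bounded_operator_comp (S T : bop) : bounded_operator (S \o T).
Proof.
apply/bounded_operatorP; split; first by move=> a u v /=; rewrite !linearP.
have [M M0 bS] := bop_norm S; have [K K0 bT] := bop_norm T.
exists (M * K) => [|x /=]; first exact: mulr_ge0.
by rewrite (le_trans (bS _))// -mulrA ler_wpM2l.
Qed.

Definition bopM (S T : bop) : bop := Bop (asboolT (bounded_operator_comp S T)).

Fact bopMA : associative bopM. Proof. by move=> S T U; apply: bop_ext. Qed.
Fact bop1M : left_id bop1 bopM. Proof. by move=> S; apply: bop_ext. Qed.
Fact bopM1 : right_id bop1 bopM. Proof. by move=> S; apply: bop_ext. Qed.
Fact bopMDl : left_distributive bopM +%R.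
Proof. by move=> S T U; apply: bop_ext. Qed.
Fact bopMDr : right_distributive bopM +%R.
Proof. by move=> S T U; apply: bop_ext => x /=; rewrite !fctE linearD. Qed.

HB.instance Definition _ :=
  GRing.Zmodule_isPzRing.Build bop bopMA bop1M bopM1 bopMDl bopMDr.

Lemma bop_scaleAl (a : R[i]) (S T : bop) : a *: (S * T) = a *: S * T.
Proof. exact: bop_ext. Qed.
Lemma bop_scaleAr (a : R[i]) (S T : bop) : a *: (S * T) = S * (a *: T).
Proof. by apply: bop_ext => x /=; rewrite !fctE linearZ. Qed.

Lemma bopD_E (S T : bop) x : (S + T) x = S x + T x. Proof. by []. Qed.
Lemma bopN_E (S : bop) x : (- S) x = - S x. Proof. by []. Qed.
Lemma bopM_E (S T : bop) x : (S * T) x = S (T x). Proof. by []. Qed.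
Lemma bop1_E x : (1 : bop) x = x. Proof. by []. Qed.
Lemma bop0_E x : (0 : bop) x = 0. Proof. by []. Qed.
Lemma bopZ_E a (S : bop) x : (a *: S) x = a *: S x. Proof. by []. Qed.
Definition bopE := (bopD_E, bopN_E, bopM_E, bop1_E, bop0_E, bopZ_E).

Lemma bop_add (T : bop) x y : T (x + y) = T x + T y. Proof. exact: linearD. Qed.
Lemma bop_opp (T : bop) x : T (- x) = - T x. Proof. exact: linearN. Qed.
Lemma bop_scale a (T : bop) x : T (a *: x) = a *: T x. Proof. exact: linearZ. Qed.
Lemma bop_zero (T : bop) : T 0 = 0. Proof. exact: linear0. Qed.
Lemma bop_sub (T : bop) x y : T (x - y) = T x - T y. Proof. exact: linearB. Qed.
Definition bopL := (bop_add, bop_opp, bop_scale, bop_zero).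

End bounded_operators.
Arguments bop {R} H.
Arguments bop_ext {R H S T}.

(** * The real inner product and norm convergence *)

Section inner_product.
Context {R : realType} {H : completeNormedModType R[i]}.
Variable ip : {dot H for Num.conj}.

(** The real inner product underlying [ip]. It separates vectors and determines [ip] ([ip_ext]), so
    operator identities reduce to real polynomial identities within reach of [ring] and [lra]. *)
Definition dr (x y : H) : R := complex.Re (ip x y).

Lemma ReD (a b : R[i]) : complex.Re (a + b) = complex.Re a + complex.Re b.
Proof. by case: a; case: b. Qed.

Lemma ReN (a : R[i]) : complex.Re (- a) = - complex.Re a.
Proof. by case: a. Qed.

Lemma ReZ (c : R) (a : R[i]) : complex.Re (c%:C * a) = c * complex.Re a.
Proof. by case: a => a b /=; rewrite mul0r subr0. Qed.

Lemma ipC x y : ip x y = (ip y x)^*%C.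
Proof. by rewrite hermC /= expr0 mul1r. Qed.

Lemma drC x y : dr x y = dr y x.
Proof. by rewrite /dr ipC; case: (ip y x). Qed.

Lemma drDl x y z : dr (x + y) z = dr x z + dr y z.
Proof. by rewrite /dr linearDl ReD. Qed.
Lemma drNl x z : dr (- x) z = - dr x z.
Proof. by rewrite /dr linearNl ReN. Qed.
Lemma drZl (c : R) x z : dr (c%:C *: x) z = c * dr x z.
Proof. by rewrite /dr linearZl_LR /= ReZ. Qed.
Lemma dr0l z : dr 0 z = 0.
Proof. by rewrite /dr linear0l. Qed.
Lemma drDr x y z : dr z (x + y) = dr z x + dr z y.
Proof. by rewrite drC drDl !(drC z). Qed.
Lemma drNr x z : dr z (- x) = - dr z x.
Proof. by rewrite drC drNl !(drC z). Qed.
Lemma drZr (c : R) x z : dr z (c%:C *: x) = c * dr z x.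
Proof. by rewrite drC drZl !(drC z). Qed.
Lemma dr0r z : dr z 0 = 0.
Proof. by rewrite drC dr0l. Qed.
Definition drE := (drDl, drNl, drZl, dr0l, drDr, drNr, drZr, dr0r).

Lemma ip_dr x : ip x x = (dr x x)%:C.
Proof.
have := dnorm_ge0 ip x; rewrite /dr lecE => /andP[/eqP/= Im0 _].
by case: (ip x x) Im0 => a b /= ->.
Qed.

Lemma dr_ge0 x : 0 <= dr x x.
Proof. by rewrite -ler0c -ip_dr dnorm_ge0. Qed.

Lemma dr_eq0 x : dr x x = 0 -> x = 0.
Proof. by move=> x0; apply/eqP; rewrite -(dnorm_eq0 ip) ip_dr x0. Qed.

Lemma dr_le0 x : dr x x <= 0 -> x = 0.
Proof. by move=> x0; apply: dr_eq0; apply/eqP; rewrite eq_le x0 dr_ge0. Qed.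

Lemma dr_ext x y : (forall z, dr x z = dr y z) -> x = y.
Proof.
move=> xy; apply/subr0_eq/dr_eq0.
by rewrite drDl drNl xy subrr.
Qed.

Lemma ip_im x y : complex.Im (ip x y) = dr (- 'i *: x) y.
Proof. by rewrite /dr linearZl_LR /=; case: (ip x y) => a b /=; ring. Qed.

Lemma ip_ext x y x' y' : dr x y = dr x' y' ->
  dr (- 'i *: x) y = dr (- 'i *: x') y' -> ip x y = ip x' y'.
Proof.
by rewrite -!ip_im /dr; case: (ip x y) => a b; case: (ip x' y') => c d /= -> ->.
Qed.

Lemma discriminant_le (a b c : R) : 0 <= a -> 0 <= c ->
  (forall t : R, 0 <= a + 2 * t * b + t ^+ 2 * c) -> b ^+ 2 <= a * c.
Proof.
move=> a0 c0 h; have [c_eq0|c_neq0] := eqVneq c 0.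
  have [->|b0] := eqVneq b 0; first by rewrite expr0n mulr_ge0.
  (* For [c = 0] the polynomial is affine in [t]; at this point it takes the value -1. *)
  have := h (- (a + 1) / (2 * b)); rewrite c_eq0 mulr0 addr0.
  have -> : a + 2 * (- (a + 1) / (2 * b)) * b = -1 by field.
  by rewrite lerNr oppr0 ler10.
have cp : 0 < c by rewrite lt0r c_neq0.
have := h (- b / c); have -> : a + 2 * (- b / c) * b + (- b / c) ^+ 2 * c =
  (a * c - b ^+ 2) / c by field.
by rewrite pmulr_lge0 ?invr_gt0// subr_ge0.
Qed.

Hypothesis ip_norm : forall x : H, `|x| ^+ 2 = ip x x.

Lemma nr_sqr x : nr x ^+ 2 = dr x x.
Proof. by apply: complexI; rewrite -ip_dr -ip_norm nrE; rewrite rmorphXn. Qed.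

Lemma nr_le_dr x (c : R) : 0 <= c -> (nr x <= c) = (dr x x <= c ^+ 2).
Proof. by move=> c0; rewrite -nr_sqr ler_pXn2r// nnegrE// nr_ge0. Qed.

Lemma dr_cs x y : `|dr x y| <= nr x * nr y.
Proof.
rewrite -(ler_pXn2r (ltn0Sn 1)) ?nnegrE// ?mulr_ge0 ?nr_ge0//.
rewrite exprMn !nr_sqr real_normK ?num_real//.
apply: discriminant_le; [exact: dr_ge0|exact: dr_ge0|] => t.
have := dr_ge0 (x + t%:C *: y); rewrite !drE (drC y x); lra.
Qed.

Definition hcvg (u : nat -> H) (l : H) := nr (u n - l) @[n --> \oo] --> (0 : R).

Lemma hcvgP u l : hcvg u l <->
  forall e : R, 0 < e -> exists n0, forall n, (n0 <= n)%N -> nr (u n - l) < e.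
Proof.
split=> [/cvgrPdist_lt + e e0|h].
  move=> /(_ _ e0)[n0 _ h]; exists n0 => n n0n; have := h n n0n.
  by rewrite sub0r normrN ger0_norm// nr_ge0.
apply/cvgrPdist_lt => e e0; have [n0 hn] := h _ e0.
exists n0 => // n n0n; rewrite /= sub0r normrN ger0_norm ?nr_ge0//.
exact: hn.
Qed.

Lemma hcvg_le u l (v : nat -> R) : v n @[n --> \oo] --> (0 : R) ->
  (forall n, nr (u n - l) <= v n) -> hcvg u l.
Proof.
move=> v0 uv; rewrite /hcvg; apply: (squeeze_cvgr _ (cvg_cst 0) v0).
by near=> n; rewrite nr_ge0 uv.
Unshelve. all: by end_near. Qed.

Lemma hcvg_cst l : hcvg (fun=> l) l.
Proof. by apply: (hcvg_le (cvg_cst 0)) => n; rewrite subrr nr0. Qed.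

Lemma hcvgD u v l m : hcvg u l -> hcvg v m -> hcvg (fun n => u n + v n) (l + m).
Proof.
move=> ul vm; apply: (@hcvg_le _ _ (fun n => nr (u n - l) + nr (v n - m))).
  by rewrite -[X in _ --> X]addr0; exact: cvgD.
by move=> n; rewrite opprD addrACA nrD.
Qed.

Lemma hcvgN u l : hcvg u l -> hcvg (fun n => - u n) (- l).
Proof.
move=> ul; apply: (hcvg_le ul) => n.
by rewrite -opprD nrN.
Qed.

Lemma hcvg_bop (T : bop H) u l : hcvg u l -> hcvg (fun n => T (u n)) (T l).
Proof.
move=> ul; have [M M0 bT] := bop_norm T.
apply: (@hcvg_le _ _ (fun n => M * nr (u n - l))).
  by rewrite -[X in _ --> X](mulr0 M); apply: cvgMr.
by move=> n; rewrite -linearB; exact: bT.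
Qed.

Lemma hcvgZ (a : R[i]) u l : hcvg u l -> hcvg (fun n => a *: u n) (a *: l).
Proof. exact: (@hcvg_bop (a *: (1 : bop H))). Qed.

Lemma hcvg_unique u l m : hcvg u l -> hcvg u m -> l = m.
Proof.
move=> ul um; apply/subr0_eq/eqP; rewrite -nr_eq0.
have := hcvgD ul (hcvgN um); rewrite /hcvg.
have -> : (fun n => nr (u n - u n - (l - m))) = fun=> nr (l - m).
  by apply/funext => n; rewrite subrr sub0r nrN.
by move=> h; apply/eqP; apply: (cvg_unique _ (cvg_cst _) h).
Qed.

Lemma hcvg_nr u l : hcvg u l -> nr (u n) @[n --> \oo] --> nr l.
Proof.
move=> ul; apply/cvgrPdist_le => e e0.
have /hcvgP/(_ _ e0)[n0 h] := ul; exists n0 => // n /= n0n.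
have := h n n0n; have := nrD (u n - l) l; have := nrD (l - u n) (u n).
rewrite !subrK (nrB l); rewrite ler_norml; lra.
Qed.

Lemma cvgn_dist_le (u v : nat -> R) (l : R) : v n @[n --> \oo] --> (0 : R) ->
  (forall n, `|u n - l| <= v n) -> u n @[n --> \oo] --> l.
Proof.
move=> v0 uv.
have h1 : l - v n @[n --> \oo] --> l.
  by rewrite -[X in _ --> X]subr0; apply: cvgB => //; exact: cvg_cst.
have h2 : l + v n @[n --> \oo] --> l.
  by rewrite -[X in _ --> X]addr0; apply: cvgD => //; exact: cvg_cst.
apply: (squeeze_cvgr _ h1 h2); near=> n.
by have := uv n; rewrite ler_norml; lra.
Unshelve. all: by end_near. Qed.

Lemma hcvg_dr u v l m : hcvg u l -> hcvg v m ->
  dr (u n) (v n) @[n --> \oo] --> dr l m.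
Proof.
move=> ul vm.
have h : nr (u n - l) * nr (v n) + nr l * nr (v n - m) @[n --> \oo] --> (0 : R).
  rewrite -[X in _ --> X]addr0 -[X in _ --> X + _](mul0r (nr m)).
  rewrite -[X in _ --> _ + X](mulr0 (nr l)).
  by apply: cvgD; [apply: cvgM => //; exact: hcvg_nr|apply: cvgMr].
apply: (cvgn_dist_le h) => n.
have -> : dr (u n) (v n) - dr l m = dr (u n - l) (v n) + dr l (v n - m).
  by rewrite !drE; ring.
by rewrite (le_trans (ler_normD _ _))// lerD// dr_cs.
Qed.

Lemma hcvg_drl u l y : hcvg u l -> dr (u n) y @[n --> \oo] --> dr l y.
Proof. by move=> ul; apply: hcvg_dr => //; exact: hcvg_cst. Qed.

(** Completeness of [H] enters here. The Cauchy condition refers to a single index [n0], which is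
    the form that the approach of a supremum supplies in [mono_scvg]. *)
Lemma hcvg_cauchy u :
  (forall e : R, 0 < e -> exists n0, forall n, (n0 <= n)%N -> nr (u n - u n0) < e) ->
  exists l, hcvg u l.
Proof.
move=> cu.
have : cauchy (u @ \oo).
  apply/cauchy_exP => e e0.
  have Re0 : 0 < complex.Re e by move: e0; rewrite ltcE => /andP[].
  have [n0 h] := cu _ Re0.
  exists (u n0); exists n0 => // n n0n; rewrite /= -ball_normE /=.
  rewrite nrE nrB; have := h n n0n; rewrite -ltcR.
  move=> /lt_le_trans; apply; rewrite lecE /= lexx andbT.
  by move: e0; rewrite ltcE => /andP[].
move=> /cauchy_cvgP ul; exists (lim (u @ \oo)).
apply/hcvgP => e e0.
have e0' : 0 < e%:C by rewrite -[0]/(0%:C) ltcR.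
move/cvgrPdist_lt : ul => /(_ _ e0')[n0 _ h].
exists n0 => n n0n; have := h n n0n; rewrite /= nrE ltcR nrB.
by [].
Qed.

End inner_product.

(** * Positive operators and square roots *)

Section positive_operators.
Context {R : realType} {H : completeNormedModType R[i]}.
Variable ip : {dot H for Num.conj}.
Implicit Types S T E X Y : bop H.

Local Notation "<< x , y >>" := (dr ip x y) (at level 2, format "<< x ,  y >>").

(** The real condition already amounts to self-adjointness ([sym_selfadjoint]), because [T] commutes
    with the scalar ['i]. *)
Definition sym T := forall x y, <<T x, y>> = <<x, T y>>.
Definition psd T := sym T /\ forall x, 0 <= <<T x, x>>.
(* Membership of X in the commutant of the commutant of {T}. *)
Definition bicomm T X := forall S, S * T = T * S -> S * X = X * S.

Lemma sym0 : sym 0. Proof. by move=> x y; rewrite !bopE !drE. Qed.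
Lemma sym1 : sym 1. Proof. by move=> x y; rewrite !bopE. Qed.
Lemma symD S T : sym S -> sym T -> sym (S + T).
Proof. by move=> sS sT x y; rewrite !bopE !drE sS sT. Qed.
Lemma symN T : sym T -> sym (- T).
Proof. by move=> sT x y; rewrite !bopE !drE sT. Qed.
Lemma symB S T : sym S -> sym T -> sym (S - T).
Proof. by move=> sS sT; apply: symD => //; exact: symN. Qed.
Lemma symZ (c : R) T : sym T -> sym (c%:C *: T).
Proof. by move=> sT x y; rewrite !bopE !drE sT. Qed.
Lemma symM S T : sym S -> sym T -> S * T = T * S -> sym (S * T).
Proof. by move=> sS sT ST x y; rewrite {1}ST !bopE sT sS. Qed.
Lemma symX T n : sym T -> sym (T ^+ n).
Proof.
move=> sT; elim: n => [|n ih]; first exact: sym1.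
by rewrite exprS; apply: symM => //; rewrite -exprS exprSr.
Qed.

(** Polarisation at [x + y]. Most identifications of operators below end here. *)
Lemma sym_ext S T : sym S -> sym T -> (forall x, <<S x, x>> = <<T x, x>>) -> S = T.
Proof.
move=> sS sT ST; apply: bop_ext => x; apply: (@dr_ext _ _ ip) => y.
have := ST (x + y); rewrite !bopL !drE ST (ST y).
by rewrite (sS y x) (sT y x) !(drC _ y); lra.
Qed.

Lemma psd0 : psd 0.
Proof. by split=> [|x]; [exact: sym0|rewrite bopE drE]. Qed.
Lemma psd1 : psd 1.
Proof. by split=> [|x]; [exact: sym1|rewrite bopE dr_ge0]. Qed.
Lemma psdD S T : psd S -> psd T -> psd (S + T).
Proof.
move=> [sS pS] [sT pT]; split=> [|x]; first exact: symD.
by rewrite bopE drE addr_ge0.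
Qed.
Lemma psdZ (c : R) T : 0 <= c -> psd T -> psd (c%:C *: T).
Proof.
move=> c0 [sT pT]; split=> [|x]; first exact: symZ.
by rewrite bopE drE mulr_ge0.
Qed.
Lemma psd_conj S T : sym S -> psd T -> psd (S * T * S).
Proof.
move=> sS [sT pT]; split=> [x y|x]; first by rewrite !bopE sS sT sS.
by rewrite !bopE sS; exact: pT.
Qed.
Lemma psd_sqr T : sym T -> psd (T * T).
Proof. by move=> sT; rewrite -[X in X * _]mulr1; apply: psd_conj => //; exact: psd1. Qed.

(** Induction by steps of two: [T ^+ n.+2] is [T ^+ n] conjugated by [T], so no square root is
    involved. *)
Lemma psdX T n : psd T -> psd (T ^+ n).
Proof.
move=> pT; elim/ltn_ind: n => -[_|[_|n ih]]; [exact: psd1|by rewrite expr1|].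
rewrite exprS exprSr mulrA; apply: psd_conj; first exact: pT.1.
exact: ih.
Qed.

Lemma psd_cs T x y : psd T -> <<T x, y>> ^+ 2 <= <<T x, x>> * <<T y, y>>.
Proof.
move=> [sT pT]; apply: discriminant_le => // t.
have := pT (x + t%:C *: y); rewrite !bopL !drE.
by rewrite (sT y x) (drC _ y); lra.
Qed.

(** Cauchy-Schwarz for the form of [T] at [x] and [T x] bounds the square of [<<T x, T x>>] by
    [<<T x, x>>] times the form of [T] at [T x]; the latter is at most [c <<T x, T x>>], and one
    factor cancels. *)
Lemma psd_sqr_le T (c : R) : psd T -> (forall x, <<T x, x>> <= c * <<x, x>>) ->
  forall x, <<T x, T x>> <= c * <<T x, x>>.
Proof.
move=> pT Tc x; have := psd_cs x (T x) pT.
have [Tx0|Tx0] := eqVneq (T x) 0; first by move=> _; rewrite Tx0 !drE mulr0.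
have d0 : 0 < <<T x, T x>>.
  rewrite lt0r dr_ge0 andbT; apply: contra Tx0 => /eqP /dr_eq0 ->//.
have := Tc (T x); have := pT.2 x; move=> a b /le_trans.
move=> /(_ (<<T x, x>> * (c * <<T x, T x>>))).
rewrite ler_wpM2l// => /(_ isT); rewrite expr2 mulrA ler_pM2r// mulrC.
by [].
Qed.

Lemma psd_ker T x : psd T -> <<T x, x>> = 0 -> T x = 0.
Proof.
move=> pT h; apply: (@dr_eq0 _ _ ip); have := psd_cs x (T x) pT.
rewrite h mul0r => h0; apply/eqP; rewrite -sqrf_eq0 eq_le h0.
by rewrite sqr_ge0.
Qed.

Lemma sqr_ker T x : sym T -> T (T x) = 0 -> T x = 0.
Proof. by move=> sT h; apply: (@dr_eq0 _ _ ip); rewrite sT h drE. Qed.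

Lemma bicomm_refl T : bicomm T T. Proof. by []. Qed.
Lemma bicomm_trans T X Y : bicomm T X -> bicomm X Y -> bicomm T Y.
Proof. by move=> TX XY S /TX /XY. Qed.
Lemma bicomm1 T : bicomm T 1.
Proof. by move=> S _; rewrite mulr1 mul1r. Qed.
Lemma bicomm0 T : bicomm T 0.
Proof. by move=> S _; rewrite mulr0 mul0r. Qed.
Lemma bicommD T X Y : bicomm T X -> bicomm T Y -> bicomm T (X + Y).
Proof. by move=> tX tY S h; rewrite mulrDl mulrDr tX ?tY. Qed.
Lemma bicommN T X : bicomm T X -> bicomm T (- X).
Proof. by move=> tX S h; rewrite mulrN mulNr tX. Qed.
Lemma bicommB T X Y : bicomm T X -> bicomm T Y -> bicomm T (X - Y).
Proof. by move=> tX tY; apply: bicommD => //; exact: bicommN. Qed.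
Lemma bicommM T X Y : bicomm T X -> bicomm T Y -> bicomm T (X * Y).
Proof. by move=> tX tY S h; rewrite mulrA tX// -mulrA tY// mulrA. Qed.
Lemma bicommZ T X a : bicomm T X -> bicomm T (a *: X).
Proof. by move=> tX S h; rewrite -bop_scaleAr -bop_scaleAl tX. Qed.
Lemma bicommX T X n : bicomm T X -> bicomm T (X ^+ n).
Proof.
move=> tX; elim: n => [|n ih]; first exact: bicomm1.
by rewrite exprS; exact: bicommM.
Qed.
Lemma bicomm_comm T X Y : bicomm T X -> bicomm T Y -> X * Y = Y * X.
Proof. by move=> tX tY; apply: tY; apply/esym/tX. Qed.

Hypothesis ip_norm : forall x : H, `|x| ^+ 2 = ip x x.

Lemma dr_bound T : exists2 c : R, 0 < c & forall x, `|<<T x, x>>| <= c * <<x, x>>.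
Proof.
have [M M0 bT] := bop_norm T; exists (M + 1); first by rewrite ltr_wpDl.
move=> x; rewrite (le_trans (dr_cs ip_norm _ _))// -(nr_sqr ip_norm) expr2 mulrA.
by rewrite ler_wpM2r ?nr_ge0// (le_trans (bT x))// ler_wpM2r ?nr_ge0// lerDl.
Qed.

(** Strong operator convergence. *)
Definition scvg (u : nat -> bop H) T := forall x, hcvg (fun n => u n x) (T x).

Lemma scvg_comm u T S : scvg u T -> (forall n, S * u n = u n * S) -> S * T = T * S.
Proof.
move=> uT h; apply: bop_ext => x; rewrite !bopE.
apply: (hcvg_unique _ (uT (S x))).
have -> : (fun n => u n (S x)) = (fun n => S (u n x)).
  by apply/funext => n; rewrite -!bopM_E h.
exact: hcvg_bop.
Qed.

(** Commutants are strongly closed; this is how limits of elements of [N] are kept in [N]. *)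
Lemma scvg_bicomm u T X : scvg u X -> (forall n, bicomm T (u n)) -> bicomm T X.
Proof. by move=> uX h S ST; apply: (scvg_comm uX) => n; exact: h. Qed.

Lemma scvg_sym u T : scvg u T -> (forall n, sym (u n)) -> sym T.
Proof.
move=> uT su x y.
have h1 := hcvg_dr ip_norm (uT x) (hcvg_cst y).
have h2 := hcvg_dr ip_norm (hcvg_cst x) (uT y).
have e : (fun n => <<u n x, y>>) = (fun n => <<x, u n y>>).
  by apply/funext => n; rewrite su.
by rewrite e in h1; exact: (cvg_unique _ h1 h2).
Qed.

Lemma scvg_form u T x : scvg u T -> <<u n x, x>> @[n --> \oo] --> <<T x, x>>.
Proof. by move=> uT; apply: hcvg_drl. Qed.

(** The difference [u n - u m] is positive and bounded by [C], so [psd_sqr_le] bounds the squared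
    norm of its value at [x] by [C] times the increment of the forms at [x]. Forms that increase to
    a finite supremum thus make the vectors Cauchy. *)
Lemma mono_scvg (u : nat -> bop H) (c : R) : (forall n, sym (u n)) ->
  (forall m n x, (m <= n)%N -> <<u m x, x>> <= <<u n x, x>>) ->
  (forall n x, <<u n x, x>> <= c * <<x, x>>) ->
  exists2 T, sym T & scvg u T.
Proof.
move=> su mu bu.
have [M0 M0p bM0] := dr_bound (u 0).
pose C := `|c| + M0.
have C0 : 0 < C by rewrite ltr_wpDl.
have diff m n x : (m <= n)%N ->
    <<u n x - u m x, u n x - u m x>> <= C * (<<u n x, x>> - <<u m x, x>>).
  move=> mn; have pX : psd (u n - u m).
    by split=> [|z]; [exact: symB|rewrite !bopE !drE subr_ge0 mu].
  have -> : <<u n x, x>> - <<u m x, x>> = <<(u n - u m) x, x>> by rewrite !bopE !drE.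
  apply: (psd_sqr_le (T := u n - u m)) => // z.
  rewrite !bopE !drE /C mulrDl lerD//.
    by rewrite (le_trans (bu _ _))// ler_wpM2r ?dr_ge0// ler_norm.
  rewrite lerNl (le_trans _ (mu 0 _ _ _))//.
  by have := bM0 z; rewrite ler_norml => /andP[].
have ex x : exists l, hcvg (fun n => u n x) l.
  apply: hcvg_cauchy => e e0.
  pose a n := <<u n x, x>>.
  have ubA : has_sup (range a).
    split; first by exists (a 0); exists 0.
    by exists (c * <<x, x>>) => _ [n _ <-]; exact: bu.
  (* Tolerance for the forms: [diff] multiplies it by [C] and bounds a squared norm. *)
  have e'0 : 0 < e ^+ 2 / C by rewrite divr_gt0// exprn_gt0.
  have [_ [n0 _ <-] hn0] := sup_adherent e'0 ubA.
  exists n0 => n n0n.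
  rewrite -(ltr_pXn2r (ltn0Sn 1)) ?nnegrE ?nr_ge0// ?ltW// (nr_sqr ip_norm).
  rewrite (le_lt_trans (diff _ _ _ n0n))// -ltr_pdivlMl// mulrC.
  have : a n <= sup (range a) by apply: (sup_upper_bound ubA); exists n.
  rewrite /a in hn0 *; lra.
have [T hT] := choice ex.
have linT : linear T.
  move=> a x y; apply: (hcvg_unique (hT _)).
  have -> : (fun n => u n (a *: x + y)) = (fun n => a *: u n x + u n y).
    by apply/funext => n; rewrite linearP.
  by apply: hcvgD => //; exact: hcvgZ.
have [M1 M10 bM1] := bop_norm (u 0).
have bT : exists2 M : R, 0 <= M & forall x, nr (T x) <= M * nr x.
  exists (C + M1) => [|x]; first by rewrite addr_ge0// ltW.
  apply: (cvgr_to_le (hcvg_nr (hT x))); near=> n.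
  rewrite -(subrK (u 0%N x) (u n x)) (le_trans (nrD _ _))// mulrDl lerD//.
  rewrite (nr_le_dr ip_norm) ?mulr_ge0 ?nr_ge0 ?(ltW C0)// exprMn (nr_sqr ip_norm).
  rewrite (le_trans (diff _ _ _ _))// expr2 -mulrA ler_wpM2l ?(ltW C0)//.
  rewrite /C mulrDl lerD//.
    by rewrite (le_trans (bu _ _))// ler_wpM2r ?dr_ge0// ler_norm.
  by have := bM0 x; rewrite ler_norml lerNl => /andP[].
pose T' : bop H := Bop (asboolT ((bounded_operatorP T).2 (conj linT bT))).
exists T' => //.
exact: (@scvg_sym u T').
Unshelve. all: by end_near. Qed.

Lemma scvg_shift u T : scvg u T -> scvg (fun n => u n.+1) T.
Proof.
move=> uT x; apply/hcvgP => e e0; have /hcvgP/(_ _ e0)[n0 h] := uT x.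
by exists n0 => n n0n; apply: h; exact: leqW.
Qed.

Lemma scvgMl u T S : scvg u T -> scvg (fun n => S * u n) (S * T).
Proof. by move=> uT x; apply: hcvg_bop. Qed.

Lemma scvgMr u T S : scvg u T -> scvg (fun n => u n * S) (T * S).
Proof. by move=> uT x; exact: uT. Qed.

Lemma scvg_unique u S T : scvg u S -> scvg u T -> S = T.
Proof. by move=> uS uT; apply: bop_ext => x; exact: hcvg_unique (uS x) (uT x). Qed.

Lemma psd_le1_nr T x : psd T -> (forall x, <<T x, x>> <= <<x, x>>) ->
  nr (T x) <= nr x.
Proof.
move=> pT T1; rewrite (nr_le_dr ip_norm) ?nr_ge0// (nr_sqr ip_norm).
have T1' z : <<T z, z>> <= 1 * <<z, z>> by rewrite mul1r.
by have := psd_sqr_le pT T1' x; rewrite mul1r => /le_trans; apply.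
Qed.

(** The powers of a positive contraction decrease, hence converge strongly. The limit satisfies
    [T E = E], so every power of [T] fixes [E], and [E E = E] in the limit: [E] projects onto the
    fixed vectors of [T]. Both [neg_proj] and [meet_proj_ex] obtain their projections from this. *)
Lemma pow_proj T : psd T -> (forall x, <<T x, x>> <= <<x, x>>) ->
  exists E, [/\ sym E, E * E = E, T * E = E, bicomm T E &
    (forall x, T x = x -> E x = x) /\ scvg (fun n => T ^+ n) E].
Proof.
move=> pT T1.
have T1' z : <<T z, z>> <= 1 * <<z, z>> by rewrite mul1r.
have decr n x : <<(T ^+ n.+1) x, x>> <= <<(T ^+ n) x, x>>.
  elim/ltn_ind: n x => -[_|[_|n ih]] x.
  - by rewrite expr0 expr1 bop1_E.
  - rewrite expr2 expr1 bopM_E pT.1.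
    by have := psd_sqr_le pT T1' x; rewrite mul1r.
  - have e k z : <<(T ^+ k.+2) z, z>> = <<(T ^+ k) (T z), T z>>.
      by rewrite exprS exprSr !bopM_E pT.1.
    by rewrite !e; apply: ih.
have [E sE hE] : exists2 E, sym E & scvg (fun n => T ^+ n) E.
  (* [mono_scvg] is about increasing sequences, whence the sign; positivity of the powers gives the
     bound 0. *)
  have [n|m n x mn|n x|E sE hE] := @mono_scvg (fun n => - T ^+ n) 0.
  - exact/symN/symX/pT.1.
  - rewrite !bopE !drE lerN2.
    move: mn => /subnK <-; elim: (n - m)%N => // k ih.
    by rewrite addSn (le_trans (decr _ _)).
  - by rewrite bopE drE mul0r oppr_le0; exact: (psdX n pT).2.
  - exists (- E); first exact: symN.
    move=> x; rewrite bopE; have := hcvgN (hE x).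
    by under eq_fun do rewrite bopE opprK.
have TE : T * E = E.
  apply: (@scvg_unique (fun n => T * T ^+ n)); first exact: scvgMl.
  by under eq_fun do rewrite -exprS; exact: (scvg_shift hE).
exists E; split=> //.
- apply: bop_ext => x; apply: (hcvg_unique (hE (E x))).
  have -> : (fun n => (T ^+ n) (E x)) = fun=> E x; last exact: hcvg_cst.
  apply/funext => n; rewrite -bopM_E; congr (bop_fun _ x).
  by elim: n => [|n ih]; rewrite ?mul1r// exprSr -mulrA TE.
- by apply: (scvg_bicomm hE) => n; apply: bicommX; exact: bicomm_refl.
- split=> // x Tx; apply: (hcvg_unique (hE x)).
  have -> : (fun n => (T ^+ n) x) = fun=> x; last exact: hcvg_cst.
  by apply/funext; elim=> // n ih; rewrite exprSr bopM_E Tx.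
Qed.

(** Polynomials in [X] with nonnegative coefficients. They commute, are closed under products and
    are positive when [X] is, so monotonicity of the iteration below becomes a matter of algebra. *)
Inductive pcone X : bop H -> Prop :=
| pcone0 : pcone X 0
| pconeX n (c : R) : 0 <= c -> pcone X (c%:C *: X ^+ n)
| pconeD S T : pcone X S -> pcone X T -> pcone X (S + T).

Lemma pconeM X S T : pcone X S -> pcone X T -> pcone X (S * T).
Proof.
move=> pS pT; elim: pS => [|n c c0|S1 S2 _ h1 _ h2].
- by rewrite mul0r; exact: pcone0.
- elim: pT => [|m d d0|T1 T2 _ h1 _ h2].
  + by rewrite mulr0; exact: pcone0.
  + rewrite -bop_scaleAl -bop_scaleAr scalerA -RcM -exprD.
    by apply: pconeX; exact: mulr_ge0.
  + by rewrite mulrDr; exact: pconeD.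
- by rewrite mulrDl; exact: pconeD.
Qed.

Lemma pconeZ X S (c : R) : 0 <= c -> pcone X S -> pcone X (c%:C *: S).
Proof.
move=> c0; elim=> [|n d d0|T1 T2 _ h1 _ h2].
- by rewrite scaler0; exact: pcone0.
- by rewrite scalerA -RcM; apply: pconeX; exact: mulr_ge0.
- by rewrite scalerDr; exact: pconeD.
Qed.

Lemma pcone_psd X S : psd X -> pcone X S -> psd S.
Proof.
move=> pX; elim=> [|n c c0|T1 T2 _ h1 _ h2]; first exact: psd0.
  by apply: psdZ => //; exact: psdX.
exact: psdD.
Qed.

Lemma pcone_bicomm X S : pcone X S -> bicomm X S.
Proof.
elim=> [|n c c0|T1 T2 _ h1 _ h2]; first exact: bicomm0.
  by apply/bicommZ/bicommX; exact: bicomm_refl.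
exact: bicommD.
Qed.

(* The iteration y -> (X + y^2)/2 converges to y = 1 - sqrt (1 - X). *)
Fixpoint sqrt_iter X n : bop H :=
  if n is m.+1 then (2^-1)%:C *: (X + sqrt_iter X m * sqrt_iter X m) else 0.

Lemma sqrt_iterS X n :
  sqrt_iter X n.+1 = (2^-1)%:C *: (X + sqrt_iter X n * sqrt_iter X n).
Proof. by []. Qed.

Lemma half_ge0 : 0 <= 2^-1 :> R. Proof. by rewrite invr_ge0. Qed.

Lemma sqrt_iter_cone X n : pcone X (sqrt_iter X n).
Proof.
elim: n => [|n ih]; first exact: pcone0.
apply: pconeZ; first exact: half_ge0.
apply: pconeD; last exact: pconeM.
by have := @pconeX X 1 1 ler01; rewrite expr1 scale1r.
Qed.

(** For consecutive iterates [b], [a] the next increment is [(a^2 - b^2) / 2 = (a - b) (a + b) / 2],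
    a product of members of the cone. *)
Lemma sqrt_iter_incr X n : pcone X (sqrt_iter X n.+1 - sqrt_iter X n).
Proof.
elim: n => [|n ih].
  by rewrite subr0; exact: sqrt_iter_cone.
set a := sqrt_iter X n.+1 in ih *; set b := sqrt_iter X n in ih *.
have -> : sqrt_iter X n.+2 - a = (2^-1)%:C *: ((a - b) * (a + b)).
  rewrite {2}/a /= -/a -/b -scalerBr opprD addrACA subrr add0r.
  congr (_ *: _); rewrite mulrDr !mulrBl.
  rewrite (bicomm_comm (pcone_bicomm (sqrt_iter_cone X n))
            (pcone_bicomm (sqrt_iter_cone X n.+1))) -/a -/b.
  by rewrite addrA subrK.
apply: pconeZ; first exact: half_ge0.
by apply: pconeM => //; apply: pconeD; exact: sqrt_iter_cone.
Qed.

Lemma sqrt_iter_le1 X n : psd X -> (forall x, <<X x, x>> <= <<x, x>>) ->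
  forall x, <<sqrt_iter X n x, x>> <= <<x, x>>.
Proof.
move=> pX X1; elim: n => [|n ih] x; first by rewrite bopE drE dr_ge0.
have pn := pcone_psd pX (sqrt_iter_cone X n).
rewrite sqrt_iterS !bopE !drE pn.1.
have T1' z : <<sqrt_iter X n z, z>> <= 1 * <<z, z>> by rewrite mul1r.
have := psd_sqr_le pn T1' x; have := X1 x; have := ih x; lra.
Qed.

Lemma unit_compl T (c : R) : 0 < c -> psd T ->
  (forall x, `|<<T x, x>>| <= c * <<x, x>>) ->
  psd (1 - (c^-1)%:C *: T) /\
  forall x, <<(1 - (c^-1)%:C *: T) x, x>> <= <<x, x>>.
Proof.
move=> c0 pT bT; split=> [|x].
  split=> [|x]; first by apply: symB; [exact: sym1|apply: symZ pT.1].
  rewrite !bopE !drE subr_ge0 mulrC ler_pdivrMr// mulrC.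
  by rewrite (le_trans (ler_norm _)).
rewrite !bopE !drE lerBlDr lerDl mulr_ge0 ?invr_ge0 ?(ltW c0)//.
exact: pT.2.
Qed.

Lemma sqrt_ex T : psd T -> exists S, [/\ psd S, S * S = T & bicomm T S].
Proof.
move=> pT; have [c c0 bT] := dr_bound T.
(* A positive contraction with [1 - X = T / c]; if [y] is the limit of the iteration,
   [sqrt c (1 - y)] is the root of [T]. *)
pose X := 1 - (c^-1)%:C *: T.
have [pX X1] : psd X /\ forall x, <<X x, x>> <= <<x, x>> by exact: unit_compl.
have [n|m n x mn|n x|y sy hy] := @mono_scvg (sqrt_iter X) 1.
- exact: (pcone_psd pX (sqrt_iter_cone X n)).1.
- move: mn => /subnK <-; elim: (n - m)%N => // k ih.
  rewrite addSn (le_trans ih)// -subr_ge0.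
  have := (pcone_psd pX (sqrt_iter_incr X (k + m))).2 x.
  by rewrite bopD_E bopN_E !drE.
- by rewrite mul1r; exact: sqrt_iter_le1.
(* Squares pass to the strong limit because the iterates [u] are contractions: [u (u x) - y (y x)]
   is [u (u x - y x)] plus [u (y x) - y (y x)]. *)
have hyy : scvg (fun n => sqrt_iter X n * sqrt_iter X n) (y * y).
  move=> x; have h1 := hy (y x); have h2 := hy x.
  apply: (@hcvg_le _ _ _ _ (fun n => nr (sqrt_iter X n x - y x) +
      nr (sqrt_iter X n (y x) - y (y x)))).
    by rewrite -[X in _ --> X]addr0; exact: cvgD.
  move=> n; rewrite !bopM_E.
  rewrite -(subrKA (sqrt_iter X n (y x))) (le_trans (nrD _ _))// lerD2r.
  rewrite -(bop_sub (sqrt_iter X n)).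
  apply: psd_le1_nr; first exact: (pcone_psd pX (sqrt_iter_cone X n)).
  exact: sqrt_iter_le1.
have yE : y = (2^-1)%:C *: (X + y * y).
  apply: (scvg_unique (scvg_shift hy)) => x /=.
  by apply: hcvgZ; apply: hcvgD (hyy x); exact: hcvg_cst.
have by_ : bicomm T y.
  apply: (@bicomm_trans _ X).
    by apply: bicommB; [exact: bicomm1|apply: bicommZ; exact: bicomm_refl].
  by apply: (scvg_bicomm hy) => n; apply: pcone_bicomm; exact: sqrt_iter_cone.
have y1 x : <<y x, x>> <= <<x, x>>.
  have h := scvg_form (x := x) hy; apply: (cvgr_to_le h); near=> n.
  exact: sqrt_iter_le1.
exists ((Num.sqrt c)%:C *: (1 - y)); split.
- apply: psdZ; first exact: sqrtr_ge0.
  split=> [|x]; first by apply: symB => //; exact: sym1.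
  by rewrite !bopE !drE subr_ge0.
- rewrite -bop_scaleAl -bop_scaleAr scalerA -RcM -expr2 sqr_sqrtr ?(ltW c0)//.
  have -> : (1 - y) * (1 - y) = 1 - X.
    rewrite mulrBl mul1r mulrBr mulr1.
    have : y + y = X + y * y.
      rewrite {1 2}yE -scalerDl -RcD.
      have -> : 2^-1 + 2^-1 = 1 :> R by field.
      by rewrite scale1r.
    move=> yy; have -> : X = y + (y - y * y) by rewrite addrA yy addrK.
    by rewrite [in RHS]opprD [in RHS]addrA.
  by rewrite /X opprB addrC subrK scalerA -RcM mulfV ?gt_eqF// scale1r.
- by apply: bicommZ; apply: bicommB => //; exact: bicomm1.
Unshelve. all: by end_near. Qed.

(** With [y = S x - T x], commutation gives [S y + T y = 0]; both forms at [y] are nonnegative, so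
    [S y = T y = 0], and moving [S] and [T] across the inner product gives [<<y, y>> = 0]. *)
Lemma psd_sqrt_unique S T : psd S -> psd T -> S * T = T * S -> S * S = T * T -> S = T.
Proof.
move=> pS pT ST SS; apply: bop_ext => x; apply/subr0_eq.
set y := S x - T x.
have h : S y + T y = 0.
  rewrite /y !bopL -!bopM_E SS ST.
  by rewrite addrA subrK subrr.
have h2 : <<S y, y>> + <<T y, y>> = 0 by rewrite -drDl h drE.
have Sy : S y = 0.
  by apply: (psd_ker pS); have := pS.2 y; have := pT.2 y; lra.
have Ty : T y = 0.
  by apply: (psd_ker pT); have := pS.2 y; have := pT.2 y; lra.
apply: (@dr_eq0 _ _ ip); have -> : <<y, y>> = <<S x - T x, y>> by [].
by rewrite drDl drNl pS.1 pT.1 Sy Ty !drE subrr.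
Qed.

(** The root built by [sqrt_ex] commutes with whatever commutes with [S * S], hence with [S], so
    uniqueness identifies it with [S]. Used for the moduli along the path. *)
Lemma psd_sqr_bicomm S : psd S -> bicomm (S * S) S.
Proof.
move=> pS; have [T [pT TT bT]] := sqrt_ex (psd_sqr pS.1).
suff <- : T = S by rewrite TT.
by apply: psd_sqrt_unique => //; apply/esym/bT; rewrite mulrA.
Qed.

(** With [S = |T|], [E] projects onto the kernel of [Z = S + T], the fixed space of [1 - Z^2 / c].
    On its range [T = - S]. Since [Z (S - T) = 0], the range of [S - T] lies in that kernel, so
    [S - T] vanishes on the complement and [T = S] there. The kernel of [T] goes to the negative
    side, which later closes the half-lines on the right. *)
Lemma neg_proj T : sym T -> exists E, [/\ sym E, E * E = E, bicomm T E,
  forall x, <<T (E x), E x>> <= 0 &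
  (forall x, 0 <= <<T (x - E x), x - E x>>) /\ (forall x, T x = 0 -> E x = x)].
Proof.
move=> sT; have [S [pS SS bS]] := sqrt_ex (psd_sqr sT).
have bTS : bicomm T S.
  by apply: bicomm_trans bS; apply: bicommM; exact: bicomm_refl.
have ST : T * S = S * T by exact: bTS.
pose Z := S + T; pose W := S - T.
have sZ : sym Z by apply: symD => //; exact: pS.1.
have ZW : Z * W = 0.
  by rewrite /Z /W mulrDl !mulrBr SS ST addrA subrK subrr.
have [c c0 bZ] := dr_bound (Z * Z).
have pZZ := psd_sqr sZ.
pose V := 1 - (c^-1)%:C *: (Z * Z).
have [pV V1] : psd V /\ forall x, <<V x, x>> <= <<x, x>> by exact: unit_compl.
have [E [sE EE VE bE [fE _]]] := pow_proj pV V1.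
have ZE x : Z (E x) = 0.
  apply: sqr_ker => //; have : V (E x) = E x by rewrite -bopM_E VE.
  rewrite !bopD_E !bopN_E !bopZ_E => /eqP; rewrite -subr_eq0 addrC addrA addNr add0r.
  rewrite oppr_eq0 scaler_eq0 => /orP[|/eqP//].
  by rewrite eq_complex /= invr_eq0 gt_eqF.
have EZ x : Z x = 0 -> E x = x.
  by move=> Zx; apply: fE; rewrite bopD_E bopN_E bopZ_E bopM_E Zx bop_zero scaler0 subr0.
have bTE : bicomm T E.
  apply: bicomm_trans bE; apply: bicommB; first exact: bicomm1.
  apply: bicommZ; apply: bicommM; apply: bicommD => //; exact: bicomm_refl.
have WE x : W (x - E x) = 0.
  rewrite bopL bop_opp.
  have -> : W (E x) = E (W x).
    by rewrite -!bopM_E; congr (bop_fun _ x); apply: bTE; rewrite mulrBl mulrBr ST.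
  by rewrite EZ ?subrr// -bopM_E ZW.
exists E; split=> //.
- move=> x; have /eqP := ZE x; rewrite bopD_E addr_eq0 => /eqP e.
  have := pS.2 (E x); rewrite e drE; lra.
- split=> x.
    have /eqP := WE x; rewrite bopD_E bopN_E subr_eq0 => /eqP <-.
    exact: pS.2.
  move=> Tx; apply: EZ; rewrite bopD_E Tx addr0.
  by apply: sqr_ker; [exact: pS.1|rewrite -bopM_E SS bopM_E Tx bop_zero].
Qed.

End positive_operators.

(** * The spectral theorem *)

Section stieltjes.
Context {R : realType}.

Lemma nondecreasing_right_continuous (G : R -> R) :
  {homo G : a b / a <= b} ->
  (forall l, G (l + n.+1%:R^-1) @[n --> \oo] --> G l) ->
  forall l : R, G @ at_right l --> G l.
Proof.
move=> ndG hG l; apply/cvgrPdist_lt => e e0.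
have /cvgrPdist_lt/(_ _ e0)[n _ hn] := hG l.
have := hn n (leqnn n) => /= h.
near=> y.
have ly : l < y by near: y; exact: nbhs_right_gt.
have yl : y < l + n.+1%:R^-1.
  by near: y; apply: nbhs_right_lt; rewrite ltrDl invr_gt0.
rewrite distrC ger0_norm ?subr_ge0 ?ndG ?(ltW ly)//.
rewrite (le_lt_trans _ h)// distrC ger0_norm ?subr_ge0 ?ndG ?lerDl ?invr_ge0//.
by rewrite lerD2r ndG// ltW.
Unshelve. all: by end_near. Qed.

Lemma lebesgue_stieltjes_oc (G : cumulative R R) (a b : R) : a <= b ->
  lebesgue_stieltjes_measure G `]a, b]%classic = (G b - G a)%:E.
Proof.
move=> ab; rewrite /lebesgue_stieltjes_measure/= /measure_extension/=.
by rewrite measurable_mu_extE/= ?wlength_itv_bnd//; exact: is_ocitv.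
Qed.

Lemma stieltjes_ex (G : R -> R) (K g : R) :
  {homo G : a b / a <= b} -> (forall l, G @ at_right l --> G l) ->
  (forall l, l < - K -> G l = 0) -> (forall l, K < l -> G l = g) ->
  exists mu : {measure set (measurableTypeR R) -> \bar R},
    (forall a b, a <= b -> mu `]a, b]%classic = (G b - G a)%:E) /\
    mu setT = g%:E.
Proof.
move=> ndG rcG G0 G1.
pose G' : cumulative R R := HB.pack G (isCumulative.Build R _ R G ndG rcG).
pose mu : {measure set (measurableTypeR R) -> \bar R} :=
  lebesgue_stieltjes_measure G'.
have muoc a b : a <= b -> mu `]a, b]%classic = (G b - G a)%:E.
  exact: lebesgue_stieltjes_oc.
exists mu; split=> //.
(* [G] is 0 at the left end and [g] at the right end of each of these intervals, so they all have
   mass [g] and their union does too. *)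
pose F n : set (measurableTypeR R) := `](- (`|K| + n.+1%:R)), (`|K| + n.+1%:R)]%classic.
have KF (n : nat) : K < `|K| + n.+1%:R.
  by rewrite (le_lt_trans (ler_norm K))// ltrDl.
have muF n : mu (F n) = g%:E.
  rewrite /F muoc; last by have := normr_ge0 K; have := ler0n R n.+1; lra.
  rewrite G1// G0 ?subr0//; last by rewrite ltrN2.
have ndF : nondecreasing_seq F.
  move=> m n mn; apply/subsetPset => x; rewrite /F /= !in_itv /= => /andP[h1 h2].
  have : (m.+1%:R : R) <= n.+1%:R by rewrite ler_nat.
  by move=> h; apply/andP; split; lra.
have UF : \bigcup_n F n = setT.
  apply/seteqP; split=> // x _; exists (Num.truncn `|x|) => //.
  have := truncnS_gt `|x|; have := normr_ge0 K.
  rewrite /F /= in_itv /= ltr_norml; move=> h /andP[h1 h2]; apply/andP; split; lra.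
have := @nondecreasing_cvg_mu _ _ _ mu F _ _ ndF.
rewrite UF => /(_ (fun=> measurable_itv _) measurableT).
have -> : mu \o F = fun=> g%:E by apply/funext => n; exact: muF.
by move=> /cvg_lim <-//; apply/cvg_lim => //; exact: cvg_cst.
Qed.

End stieltjes.

(** * Spectral families of symmetric operators *)

Section spectral_family.
Context {R : realType} {H : completeNormedModType R[i]}.
Variable ip : {dot H for Num.conj}.
Hypothesis ip_norm : forall x : H, `|x| ^+ 2 = ip x x.
Implicit Types S T E X Y : bop H.

Local Notation "<< x , y >>" := (dr ip x y) (at level 2, format "<< x ,  y >>").
Local Notation sym := (sym ip).
Local Notation psd := (psd ip).

Definition proj E := sym E /\ E * E = E.

Lemma proj_form E x : proj E -> <<E x, x>> = <<E x, E x>>.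
Proof. by move=> [sE EE]; rewrite -sE -bopM_E EE. Qed.

Lemma proj_psd E : proj E -> psd E.
Proof. by move=> pE; split=> [|x]; [exact: pE.1|rewrite proj_form// dr_ge0]. Qed.

Lemma proj_idem E x : proj E -> E (E x) = E x.
Proof. by move=> pE; rewrite -bopM_E pE.2. Qed.

Lemma proj_compl E : proj E -> proj (1 - E).
Proof.
move=> [sE EE]; split; first by apply: symB => //; exact: sym1.
by rewrite mulrBl !mulrBr !mulr1 EE mul1r subrr subr0.
Qed.

Lemma proj_pyth E x : proj E -> <<x, x>> = <<E x, E x>> + <<x - E x, x - E x>>.
Proof.
move=> pE; have := proj_form x (proj_compl pE).
by rewrite !bopE => <-; rewrite -proj_form// !drE; ring.
Qed.

Lemma proj_le1 E x : proj E -> <<E x, x>> <= <<x, x>>.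
Proof. by move=> pE; rewrite proj_form// (proj_pyth x pE) lerDl dr_ge0. Qed.

Lemma proj_form_eq0 E x : proj E -> <<E x, x>> = 0 -> E x = 0.
Proof. by move=> pE; rewrite proj_form// => /dr_eq0. Qed.

Lemma proj_form_eq E x : proj E -> <<E x, x>> = <<x, x>> -> E x = x.
Proof.
move=> pE; rewrite proj_form// [in X in X -> _](proj_pyth x pE) => h.
have /dr_eq0 /subr0_eq xE : <<x - E x, x - E x>> = 0 by lra.
exact: esym.
Qed.

(* E l is the spectral projection of T for the half-line ]-oo, l]. *)
Definition spectral_family T (E : R -> bop H) := forall l,
  [/\ proj (E l), bicomm T (E l),
    forall x, E l x = x -> <<T x, x>> <= l * <<x, x>>,
    forall x, E l x = 0 -> l * <<x, x>> <= <<T x, x>> &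
    forall x, T x = l%:C *: x -> E l x = x].

Lemma spectral_family_ex T : sym T -> exists E : R -> bop H, spectral_family T E.
Proof.
move=> sT.
suff /choice[E hE] : forall l : R, exists E, [/\ proj E, bicomm T E,
    forall x, E x = x -> <<T x, x>> <= l * <<x, x>>,
    forall x, E x = 0 -> l * <<x, x>> <= <<T x, x>> &
    forall x, T x = l%:C *: x -> E x = x] by exists E.
move=> l; pose Tl := T - l%:C *: (1 : bop H).
have sTl : sym Tl by apply: symB => //; apply: symZ; exact: sym1.
have TlE x : <<Tl x, x>> = <<T x, x>> - l * <<x, x>> by rewrite !bopE !drE.
have [E [sE EE bE E0 [E1 fE]]] := neg_proj ip_norm sTl.
exists E; split=> //.
- apply: bicomm_trans bE; apply: bicommB; first exact: bicomm_refl.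
  by apply: bicommZ; exact: bicomm1.
- by move=> x Ex; have := E0 x; rewrite Ex TlE subr_le0.
- by move=> x Ex; have := E1 x; rewrite Ex subr0 TlE subr_ge0.
- by move=> x Tx; apply: fE; rewrite !bopE Tx subrr.
Qed.

Section family.
Variables (T : bop H) (E : R -> bop H).
Hypotheses (sT : sym T) (hE : spectral_family T E).

Let pE l : proj (E l). Proof. by have [] := hE l. Qed.
Let bE l : bicomm T (E l). Proof. by have [] := hE l. Qed.

Lemma sf_comm a b : E a * E b = E b * E a.
Proof. exact: (bicomm_comm (bE a) (bE b)). Qed.

Lemma sf_commT a : E a * T = T * E a.
Proof. by apply/esym; apply: bE. Qed.

(** On the kernel of [E l] the operator [T - l] is positive, so a vanishing form makes [x] an
    eigenvector for [l]; but [E l] fixes those. This strictness is what right continuity rests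
    on. *)
Lemma sf_strict l x : E l x = 0 -> <<T x, x>> = l * <<x, x>> -> x = 0.
Proof.
move=> Ex Tx; pose F := 1 - E l.
have pF : proj F by exact: proj_compl.
have pY : psd (F * (T - l%:C *: (1 : bop H)) * F).
  have sTl : sym (T - l%:C *: (1 : bop H)) by apply: symB => //; apply: symZ; exact: sym1.
  split=> [z y|z]; first by rewrite !bopM_E pF.1 sTl pF.1.
  rewrite !bopM_E pF.1.
  have : E l (F z) = 0 by rewrite -bopM_E mulrBr mulr1 (pE l).2 subrr.
  move: (F z) => v Ev; rewrite !bopD_E !bopN_E !bopZ_E !drE subr_ge0.
  by have [_ _ _ h _] := hE l; apply: h.
have Fx : F x = x by rewrite !bopE Ex subr0.
have FY : F * (T - l%:C *: (1 : bop H)) * F = (T - l%:C *: (1 : bop H)) * F.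
  have bF : bicomm T F by apply: bicommB; [exact: bicomm1|exact: bE].
  have -> : F * (T - l%:C *: (1 : bop H)) = (T - l%:C *: (1 : bop H)) * F.
    by apply/esym/bF; rewrite mulrBl mulrBr -bop_scaleAl -bop_scaleAr mulr1 mul1r.
  by rewrite -mulrA pF.2.
have := psd_ker (x := x) pY; rewrite FY !bopM_E Fx.
rewrite !bopE !drE Tx subrr => /(_ erefl)/subr0_eq Tlx.
by have [_ _ _ _ /(_ _ Tlx)] := hE l; rewrite Ex.
Qed.

(** For [a < b] a vector [v] in the range of [E a] and in the kernel of [E b] satisfies
    [b <<v, v>> <= <<T v, v>> <= a <<v, v>>], hence vanishes. *)
Lemma sf_le a b : a <= b -> E b * E a = E a.
Proof.
rewrite le_eqVlt => /predU1P[->|ab]; first exact: (pE b).2.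
have pp c y : E c (E c y) = E c y by exact: proj_idem.
have cm c d y : E c (E d y) = E d (E c y) by rewrite -!bopM_E sf_comm.
apply: bop_ext => x; apply/esym/subr0_eq.
set v := _ - _.
have Eav : E a v = v.
  by rewrite /v bop_sub !bopM_E pp (cm a b) pp.
have Ebv : E b v = 0.
  by rewrite /v bop_sub !bopM_E pp subrr.
have [_ _ /(_ _ Eav) h1 _ _] := hE a.
have [_ _ _ /(_ _ Ebv) h2 _] := hE b.
apply: (@dr_le0 _ _ ip); have h3 := le_trans h2 h1.
have : (b - a) * <<v, v>> <= 0 by lra.
by rewrite pmulr_rle0// subr_gt0.
Qed.

Lemma sf_sub_proj a b : a <= b -> proj (E b - E a).
Proof.
move=> ab; split; first by apply: symB; [exact: (pE b).1|exact: (pE a).1].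
rewrite mulrBl !mulrBr (pE a).2 (pE b).2 (sf_comm a b) sf_le//.
by rewrite subrr subr0.
Qed.

Lemma sf_form_le x a b : a <= b -> <<E a x, x>> <= <<E b x, x>>.
Proof.
move=> ab; rewrite -subr_ge0; have := (proj_psd (sf_sub_proj ab)).2 x.
by rewrite bopD_E bopN_E !drE.
Qed.

(** Let [L] be the strong limit of these decreasing projections. A vector [v = L y - E l y] lies in
    all their ranges and in the kernel of [E l], so its form is exactly [l <<v, v>>] and [sf_strict]
    gives [v = 0]. *)
Lemma sf_rc x l : <<E (l + n.+1%:R^-1) x, x>> @[n --> \oo] --> <<E l x, x>>.
Proof.
pose a n : R := l + n.+1%:R^-1.
have aS m n : (m <= n)%N -> a n <= a m.
  by move=> mn; rewrite /a lerD2l lef_pV2 ?posrE// ler_nat.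
have la n : l <= a n by rewrite /a lerDl invr_ge0.
have [n|m n y mn|n y|L' sL hL'] := @mono_scvg _ _ ip ip_norm (fun n => - E (a n)) 0.
- exact/symN/(pE _).1.
- by rewrite !bopN_E !drE lerN2 sf_form_le// aS.
- by rewrite bopN_E drE mul0r oppr_le0; exact: (proj_psd (pE _)).2.
pose L := - L'.
have hL : scvg (fun n => E (a n)) L.
  move=> y; rewrite bopN_E; have := hcvgN (hL' y).
  by under eq_fun do rewrite bopN_E opprK.
suff -> : E l = L by exact: (scvg_form ip_norm (x := x) hL).
have EL n : E (a n) * L = L.
  have h1 : scvg (fun k => E (a n) * E (a (k + n)%N)) (E (a n) * L).
    move=> y; apply: hcvg_bop; apply/hcvgP => e e0.
    have /hcvgP/(_ _ e0)[n0 h] := hL y; exists n0 => k kn; apply: h.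
    by rewrite (leq_trans kn)// leq_addr.
  apply: (scvg_unique h1) => y; apply/hcvgP => e e0.
  have /hcvgP/(_ _ e0)[n0 h] := hL y; exists n0 => k kn.
  rewrite sf_le; last by apply: aS; rewrite leq_addl.
  by apply: h; rewrite (leq_trans kn)// leq_addr.
have ElL : E l * L = E l.
  apply: (scvg_unique (scvgMl (E l) hL)) => y.
  by under eq_fun do rewrite sf_comm sf_le//; exact: hcvg_cst.
apply: bop_ext => y; apply/esym/subr0_eq.
set v := _ - _.
have Ev n : E (a n) v = v.
  by rewrite /v bop_sub -!bopM_E EL sf_le.
have Elv : E l v = 0 by rewrite /v bop_sub -!bopM_E ElL (pE l).2 subrr.
apply: (sf_strict Elv).
apply/eqP; rewrite eq_le; apply/andP; split; last first.
  by have [_ _ _ h _] := hE l; exact: h.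
have h n : <<T v, v>> <= a n * <<v, v>>.
  by have [_ _ h _ _] := hE (a n); apply: h.
have cv : a n * <<v, v>> @[n --> \oo] --> l * <<v, v>>.
  apply: cvgMl; rewrite -[X in _ --> X]addr0; apply: cvgD; first exact: cvg_cst.
  exact: cvg_harmonic.
by apply: (cvgr_to_ge cv); near=> n.
Unshelve. all: by end_near. Qed.

Lemma sf_bounds : exists2 K : R, 0 < K &
  (forall l, l < - K -> E l = 0) /\ (forall l, K < l -> E l = 1).
Proof.
have [c c0 bT] := dr_bound ip_norm T.
exists c => //; split=> l lc.
  apply: bop_ext => x; rewrite bop0_E; set v := E l x.
  have Ev : E l v = v by exact: proj_idem.
  have [_ _ /(_ _ Ev) h _ _] := hE l; apply: (@dr_le0 _ _ ip).
  have := bT v; rewrite ler_norml => /andP[h1 _].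
  have : (- c - l) * <<v, v>> <= 0 by lra.
  by rewrite pmulr_rle0// subr_gt0.
apply: bop_ext => x; rewrite bop1_E; apply/esym/subr0_eq; set v := x - _.
have Ev : E l v = 0 by rewrite /v bop_sub proj_idem// subrr.
have [_ _ _ /(_ _ Ev) h _] := hE l; apply: (@dr_le0 _ _ ip).
have := bT v; rewrite ler_norml => /andP[_ h1].
have : (l - c) * <<v, v>> <= 0 by lra.
by rewrite pmulr_rle0// subr_gt0.
Qed.

Lemma sf_measure : exists mu : H -> {measure set (measurableTypeR R) -> \bar R},
  forall x, (forall a b, a <= b ->
     mu x `]a, b]%classic = (<<(E b - E a) x, x>>)%:E) /\
   mu x setT = (<<x, x>>)%:E.
Proof.
have [K K0 [E0 E1]] := sf_bounds.
suff /choice[mu hmu] : forall x, exists mu : {measure set (measurableTypeR R) -> \bar R},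
  (forall a b, a <= b -> mu `]a, b]%classic = (<<(E b - E a) x, x>>)%:E) /\
   mu setT = (<<x, x>>)%:E by exists mu.
move=> x.
have [||l lK|l lK|mu [h1 h2]] := @stieltjes_ex _ (fun l => <<E l x, x>>) K <<x, x>>.
- by move=> a b; exact: sf_form_le.
- apply: nondecreasing_right_continuous; first by move=> a b; exact: sf_form_le.
  exact: sf_rc.
- by rewrite E0// bop0_E drE.
- by rewrite E1// bop1_E.
by exists mu; split=> // a b /h1 ->; rewrite bopD_E bopN_E !drE.
Qed.

End family.
End spectral_family.

(** * Integrals against a measure concentrated on a set *)

Section integral_of_measure.
Context d (U : measurableType d) {R : realType}.
Local Open Scope ereal_scope.
Variable mu : {measure set U -> \bar R}.

Lemma finite_measureD (m : R) A B : measurable A -> measurable B -> B `<=` A ->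
  mu A = m%:E -> mu (A `\` B) = mu A - mu B.
Proof.
move=> mA mB BA Am; rewrite measureD ?(setIidr BA)//.
by have := ltry m; rewrite -Am.
Qed.

Lemma disjoint_measureU A B : measurable A -> measurable B -> A `&` B = set0 ->
  mu (A `|` B) = mu A + mu B.
Proof. by move=> *; rewrite measureU. Qed.

Lemma null_setU A B : measurable A -> measurable B -> mu A = 0 -> mu B = 0 ->
  mu (A `|` B) = 0.
Proof. by move=> mA mB A0 B0; rewrite measureU0. Qed.

Lemma concentrated_le_integral (D : set U)
    (f g : U -> \bar R) :
  measurable D -> mu (~` D) = 0 ->
  measurable_fun setT f -> measurable_fun setT g ->
  (forall l, 0 <= f l) -> (forall l, 0 <= g l) ->
  (forall l, D l -> f l <= g l) -> \int[mu]_l f l <= \int[mu]_l g l.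
Proof.
move=> mD D0 mf mg f0 g0 fg; apply: ae_ge0_le_integral => //.
exists (~` D); split => //; first exact: measurableC.
by move=> l /= h Dl; apply: h => _; exact: fg.
Qed.

Lemma concentrated_bounds (D : set U)
    (f : U -> R) (a b m : R) :
  measurable D -> mu (~` D) = 0 -> mu setT = m%:E ->
  measurable_fun setT f -> (forall l, 0 <= f l)%R ->
  (0 <= a)%R -> (0 <= b)%R -> (forall l, D l -> a <= f l <= b)%R ->
  (a * m)%:E <= \int[mu]_l (f l)%:E <= (b * m)%:E.
Proof.
move=> mD D0 mT mf f0 a0 b0 ab.
have mf' : measurable_fun setT (fun l => (f l)%:E) by exact/measurable_EFinP.
have cstE (c : R) : (c * m)%:E = \int[mu]_l (cst c%:E) l.
  by rewrite integral_cst// EFinM; congr (_ * _); exact/esym.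
apply/andP; split; rewrite cstE.
- apply: (concentrated_le_integral mD) => // l Dl /=.
  by rewrite lee_fin; have /andP[] := ab _ Dl.
- apply: (concentrated_le_integral mD) => // l Dl /=.
  by rewrite lee_fin; have /andP[] := ab _ Dl.
Qed.

End integral_of_measure.

(** * From scalar measures to projections and operators *)

Section calculus.
Context d (U : measurableType d) {R : realType} {H : completeNormedModType R[i]}.
Variable ip : {dot H for Num.conj}.
Hypothesis ip_norm : forall x : H, `|x| ^+ 2 = ip x x.
Implicit Types S T E F : bop H.

Local Notation "<< x , y >>" := (dr ip x y) (at level 2, format "<< x ,  y >>").
Local Notation sym := (sym ip).
Local Notation psd := (psd ip).
Local Notation proj := (proj ip).

Variable mu : H -> {measure set U -> \bar R}.
Hypothesis muT : forall x, mu x setT = (<<x, x>>)%:E.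

(** The value on [B] of the projection-valued measure behind [mu]; by [sym_ext] at most one
    symmetric [E] qualifies. *)
Definition repr_set (B : set U) E :=
  forall x, mu x B = (<<E x, x>>)%:E.
Definition repr_fun (f : U -> R) S :=
  forall x, (\int[mu x]_l (f l)%:E = (<<S x, x>>)%:E)%E.

Lemma repr_setC B E : measurable B -> repr_set B E -> repr_set (~` B) (1 - E).
Proof.
move=> mB BE x; rewrite -setTD (finite_measureD measurableT mB _ (muT x))//.
by rewrite muT BE -EFinB bopD_E bopN_E bop1_E !drE.
Qed.

(** At [v = E x] the set [A] already carries the whole mass [<<v, v>>], so nothing is left for [B]
    and [F v = 0]. *)
Lemma repr_set_disj A B E F : measurable A -> measurable B -> A `&` B = set0 ->
  proj E -> proj F -> repr_set A E -> repr_set B F -> F * E = 0.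
Proof.
move=> mA mB AB pE pF AE BF; apply: bop_ext => x; rewrite bopM_E bop0_E.
set v := E x; have Ev : E v = v by exact: (proj_idem x pE).
apply: (proj_form_eq0 pF).
have : (mu v (A `|` B) <= mu v setT)%E by apply: le_measure; rewrite ?inE//; exact: measurableU.
rewrite disjoint_measureU// AE BF muT Ev -EFinD lee_fin gerDl => h.
by apply/eqP; rewrite eq_le h (proj_psd pF).2.
Qed.

Lemma repr_set_conc B E x : measurable B -> repr_set B E -> E x = x ->
  mu x (~` B) = 0%E.
Proof. by move=> mB BE Ex; rewrite (repr_setC mB BE) bopD_E bopN_E bop1_E Ex subrr drE. Qed.

(** Write [E = (E - G) + G] and [F = (F - G) + G]. The three pieces belong to pairwise disjoint
    sets, so every cross product vanishes and only [G G = G] survives. *)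
Lemma repr_setI A B E F : measurable A -> measurable B ->
  proj E -> proj F -> repr_set A E -> repr_set B F ->
  forall G, proj G -> repr_set (A `&` B) G -> E * F = G.
Proof.
move=> mA mB pE pF AE BF G pG ABG.
have mAB : measurable (A `&` B) by exact: measurableI.
have diff C K : proj K -> measurable C -> A `&` B `<=` C -> repr_set C K ->
    repr_set (C `\` (A `&` B)) (K - G) /\ proj (K - G) /\ K * G = G.
  move=> pK mC sC CK.
  have h1 : repr_set (C `\` (A `&` B)) (K - G).
    move=> x; rewrite (finite_measureD mC mAB sC (CK x)).
    by rewrite CK ABG -EFinB bopD_E bopN_E !drE.
  have KG : (1 - K) * G = 0.
    apply: (repr_set_disj (A := A `&` B) (B := ~` C)) => //.
    - exact: measurableC.
    - by rewrite -subset0 => l [/sC].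
    - exact: proj_compl.
    - exact: repr_setC.
  have KG' : K * G = G by move/eqP: KG; rewrite mulrBl mul1r subr_eq0 => /eqP.
  split=> //; split=> //; split; first by apply: symB; [exact: pK.1|exact: pG.1].
  have GK : G * K = G.
    apply: bop_ext => x; apply: (@dr_ext _ _ ip) => y.
    by rewrite bopM_E pG.1 pK.1 -bopM_E KG' -pG.1.
  by rewrite mulrBl !mulrBr pK.2 pG.2 KG' GK subrr subr0.
have [hE [pEG EG]] := diff A E pE mA (@subIsetl _ _ _) AE.
have [hF [pFG FG]] := diff B F pF mB (@subIsetr _ _ _) BF.
have d1 : (E - G) * G = 0 by rewrite mulrBl EG pG.2 subrr.
have d2 : (E - G) * (F - G) = 0.
  apply: (repr_set_disj (A := B `\` (A `&` B)) (B := A `\` (A `&` B))) => //.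
  - exact: measurableD.
  - exact: measurableD.
  - by rewrite -subset0 => l [[Bl h] [Al _]]; apply: h.
have d3 : G * (F - G) = 0.
  apply: (repr_set_disj (A := B `\` (A `&` B)) (B := A `&` B)) => //.
  - exact: measurableD.
  - by rewrite -subset0 => l [[Bl h] ABl].
rewrite -(subrK G E) -(subrK G F).
move: (E - G) (F - G) d1 d2 d3 => E' F' d1 d2 d3.
by rewrite mulrDl !mulrDr d1 d2 d3 pG.2 !add0r.
Qed.

Section existence.
Variable T : bop H.
Let has_proj (B : set U) := exists F, [/\ proj F, bicomm T F & repr_set B F].

(** Dynkin induction. In the countable step, disjointness makes the projections orthogonal, so their
    partial sums are increasing projections; the strong limit is a projection, and its form is the
    sum of the masses. *)
Lemma repr_set_ex (G : set (set U)) : @measurable _ U = <<s G >> ->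
  setI_closed G -> (forall B, G B -> has_proj B) ->
  forall B, measurable B -> has_proj B.
Proof.
move=> mG IG hG B; rewrite mG.
apply: (@dynkin_induction _ U G) => //.
- exists 1; split; [by split; [exact: sym1|rewrite mulr1]|exact: bicomm1|].
  by move=> x; rewrite muT.
- move=> S mS [F [pF bF SF]]; exists (1 - F); split; [exact: proj_compl| |exact: repr_setC].
  by apply: bicommB => //; exact: bicomm1.
- move=> A mA tA /choice[F hF].
  have pF n : proj (F n) by have [] := hF n.
  have bF n : bicomm T (F n) by have [] := hF n.
  have AF n : repr_set (A n) (F n) by have [] := hF n.
  have FF i j : i <> j -> F i * F j = 0.
    move=> ij; apply: (repr_set_disj (A := A j) (B := A i)) => //.
    by move/trivIsetP: tA; apply => //; apply/eqP => /esym.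
  pose S n : bop H := \sum_(i < n) F i.
  have pS n : proj (S n).
    elim: n => [|n [sS SS]]; rewrite /S ?big_ord0 ?big_ord_recr /=.
      by split; [exact: sym0|rewrite mulr0].
    rewrite -/(S n); split; first by apply: symD => //; exact: (pF n).1.
    have h1 : S n * F n = 0.
      rewrite /S mulr_suml big1// => i _; apply: FF => e.
      by have := ltn_ord i; rewrite e ltnn.
    have h2 : F n * S n = 0.
      rewrite /S mulr_sumr big1// => i _; apply: FF => e.
      by have := ltn_ord i; rewrite -e ltnn.
    by rewrite mulrDl !mulrDr SS h1 h2 (pF n).2 add0r addr0.
  have SF n x : (\sum_(0 <= i < n) mu x (A i) = (<<S n x, x>>)%:E)%E.
    have Sn n' : S n'.+1 = S n' + F n' by rewrite /S big_ord_recr.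
    elim: n => [|n ih]; first by rewrite /S big_geq// big_ord0 bop0_E drE.
    by rewrite big_nat_recr//= ih AF Sn bopD_E drE EFinD.
  have SS m n : (m <= n)%N -> S m * S n = S m.
    move=> /subnK <-; elim: (n - m)%N => [|k ih]; first exact: (pS m).2.
    rewrite addSn /S [X in _ * X]big_ord_recr /= -/(S (k + m)) mulrDr ih.
    rewrite [X in _ + X](_ : _ = 0) ?addr0//.
    rewrite /S mulr_suml big1// => i _; apply: FF => e.
    by have := ltn_ord i; rewrite e; lia.
  have [n|m n x mn|n x|L sL hL] := @mono_scvg _ _ ip ip_norm S 1.
  + exact: (pS n).1.
  + have := SS _ _ mn => h; rewrite !proj_form// -h.
    rewrite bopM_E; have := proj_pyth (S n x) (pS m).
    by have := dr_ge0 ip (S n x - S m (S n x)); lra.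
  + by rewrite mul1r proj_le1.
  exists L; split.
  + split=> //; apply: (scvg_unique (scvgMr L hL)).
    have e n : S n * L = S n.
      apply: (scvg_unique (scvgMl (S n) hL)) => x; apply/hcvgP => e e0.
      by exists n => k nk; rewrite SS// subrr nr0.
    by under eq_fun do rewrite e.
  + apply: (scvg_bicomm hL) => n; apply: big_ind => //; first exact: bicomm0.
    exact: bicommD.
  + move=> x; have h1 := scvg_form ip_norm (x := x) hL.
    have := @measure_semi_sigma_additive _ _ _ (mu x) A mA tA (bigcupT_measurable _ mA).
    under eq_fun do rewrite SF.
    by move=> /cvg_lim <-//; apply/cvg_lim => //; apply: cvg_EFin => //; exact: nearW.
Qed.

(** Simple functions give finite combinations of projections; along an increasing approximation of
    [f] the integrals and the operators converge together, by monotone convergence on each side. *)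
Lemma repr_fun_ex (f : U -> R) (M : R) :
  (forall B, measurable B -> has_proj B) -> measurable_fun setT f ->
  (forall l, 0 <= f l) -> (forall l, f l <= M) ->
  exists S, [/\ psd S, bicomm T S & repr_fun f S].
Proof.
move=> hproj mf f0 fM.
have mEf : measurable_fun setT (EFin \o f) by exact/measurable_EFinP.
pose h n : {nnsfun U >-> R} := nnsfun_approx measurableT mEf n.
have hle m n l : (m <= n)%N -> h m l <= h n l.
  by move=> mn; have /lefP := nd_nnsfun_approx measurableT mEf mn; exact.
have hcv l : (h n l)%:E @[n --> \oo] --> (f l)%:E.
  by apply: (@cvg_nnsfun_approx _ _ _ _ measurableT _ mEf) => // x _; rewrite lee_fin.
have hf n l : h n l <= f l.
  rewrite -lee_fin; have := hcv l; move=> /cvg_lim <-//.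
  apply: lime_ge; first by apply/cvg_ex; exists (f l)%:E; exact: hcv.
  near=> k; rewrite lee_fin hle//; near: k; exact: nbhs_infty_ge.
have simple n : exists S, [/\ psd S, bicomm T S & repr_fun (h n) S].
  have /choice[F hF] : forall y : R, exists F, [/\ proj F, bicomm T F &
      repr_set (h n @^-1` [set y]) F].
    by move=> y; apply: hproj.
  have fr : finite_set (range (h n)) by [].
  exists (\sum_(y <- fset_set (range (h n))) (y%:C *: F y)); split.
  - rewrite big_seq; apply: big_ind; [exact: psd0|exact: psdD|].
    move=> y; rewrite in_fset_set// inE => -[l _ <-]; apply: psdZ => //.
    by have [pF _ _] := hF (h n l); exact: proj_psd.
  - apply: big_ind; [exact: bicomm0|exact: bicommD|].
    by move=> y _; apply: bicommZ; have [] := hF y.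
  - move=> x; rewrite integralT_nnsfun sintegralE fsbig_finite//=.
    elim: (enum_fset _) => [|y s ih]; first by rewrite !big_nil bop0_E drE.
    rewrite !big_cons ih bopD_E bopZ_E !drE; have [_ _ ->] := hF y.
    by rewrite EFinD EFinM.
move/choice : simple => [S hS].
have SM n x : <<S n x, x>> <= M * <<x, x>>.
  have [_ _ Sx] := hS n; rewrite -lee_fin -Sx.
  apply: (@le_trans _ _ (\int[mu x]_l (cst M%:E) l)%E); last first.
    by rewrite integral_cst// EFinM; move: (muT x) => /= ->.
  apply: ge0_le_integral => //.
  - by move=> l _; rewrite lee_fin.
  - exact/measurable_EFinP.
  - by move=> l _; rewrite lee_fin (le_trans (hf n l)).
have [n|m n x mn|n x|L sL hL] := @mono_scvg _ _ ip ip_norm S M.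
- by have [[]] := hS n.
- have [_ _ Sm] := hS m; have [_ _ Sn] := hS n; rewrite -lee_fin -Sm -Sn.
  apply: ge0_le_integral => //.
  - by move=> l _; rewrite lee_fin.
  - exact/measurable_EFinP.
  - exact/measurable_EFinP.
  - by move=> l _; rewrite lee_fin hle.
- exact: SM.
exists L; split.
- split=> // x; apply: (cvgr_to_ge (scvg_form ip_norm (x := x) hL)).
  by near=> n; have [[_ ]] := hS n.
- by apply: (scvg_bicomm hL) => n; have [] := hS n.
- move=> x.
  have cv : (\int[mu x]_l (h n l)%:E @[n --> \oo] --> \int[mu x]_l (f l)%:E)%E.
    have -> : (fun l => (f l)%:E) = (fun l => limn (fun n => (h n l)%:E)).
      by apply/funext => l; apply/esym/cvg_lim => //; exact: hcv.
    apply: cvg_monotone_convergence => //.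
    - by move=> n; exact/measurable_EFinP.
    - by move=> n l _; rewrite lee_fin.
    - by move=> l _ m n mn; rewrite lee_fin hle.
  have e : (fun n => \int[mu x]_l (h n l)%:E)%E = fun n => (<<S n x, x>>)%:E.
    by apply/funext => n; have [_ _ ->] := hS n.
  rewrite e in cv; move: cv => /cvg_lim <-//.
  apply/cvg_lim => //; apply: cvg_EFin; first exact: nearW.
  exact: (scvg_form ip_norm (x := x) hL).
Unshelve. all: by end_near. Qed.

End existence.
End calculus.

Section constancy.
Context {R : realType}.

(** Over [n.+1] equal pieces the bounds telescope to [(b - a) (G b - G a) / n.+1], which is
    arbitrarily small. This stands in for a Riemann-Stieltjes argument in [sf_first_moment]. *)
Lemma increment_const (phi G : R -> R) (a b : R) : a <= b ->
  (forall c d, a <= c -> c <= d -> d <= b ->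
    `|phi d - phi c| <= (d - c) * (G d - G c)) -> phi a = phi b.
Proof.
move=> ab h.
have key (n : nat) : `|phi b - phi a| <= (b - a) / n.+1%:R * (G b - G a).
  pose c (i : nat) : R := a + (b - a) * (i%:R / n.+1%:R).
  have step i : (i <= n.+1)%N ->
      `|phi (c i) - phi a| <= (b - a) / n.+1%:R * (G (c i) - G a).
    elim: i => [_|i ih iln].
      by rewrite /c mul0r mulr0 addr0 !subrr normr0 mulr0.
    have ba0 : 0 <= b - a by rewrite subr_ge0.
    have ci : c i <= c i.+1.
      rewrite /c lerD2l ler_wpM2l// ler_wpM2r ?invr_ge0// ler_nat.
      exact: leqnSn.
    have ac : a <= c i by rewrite /c lerDl mulr_ge0// divr_ge0.
    have cb : c i.+1 <= b.
      have : (b - a) * (i.+1%:R / n.+1%:R) <= (b - a) * 1.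
        by rewrite ler_wpM2l// ler_pdivrMr// mul1r ler_nat.
      move=> h'; have -> : c i.+1 = a + (b - a) * (i.+1%:R / n.+1%:R) by [].
      by rewrite -lerBrDl (le_trans h')// mulr1.
    have cE : c i.+1 - c i = (b - a) / n.+1%:R.
      have : n.+1%:R != 0 :> R by rewrite pnatr_eq0.
      by rewrite /c -(natr1 i); move: (n.+1%:R : R) => m m0; field.
    have := h _ _ ac ci cb; have := ih (ltnW iln).
    rewrite cE; set t := _ / _.
    have := ler_normD (phi (c i.+1) - phi (c i)) (phi (c i) - phi a).
    rewrite addrA subrK; lra.
  have := step n.+1 (leqnn _); rewrite /c divff ?pnatr_eq0// mulr1.
  by have -> : a + (b - a) = b by lra.
apply/eqP; rewrite eq_sym -subr_eq0 -normr_le0 leNgt; apply/negP => d0.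
set D := `|_| in d0 key; set K := (b - a) * (G b - G a).
have := key (Num.truncn (K / D)); rewrite mulrAC ler_pdivlMr//.
have := truncnS_gt (K / D); rewrite ltr_pdivrMr// -/K mulrC; lra.
Qed.

End constancy.

(** * Existence and uniqueness of the spectral measure; evaluation of the Borel calculus *)

Section spectral_measures.
Context {R : realType} {H : completeNormedModType R[i]}.
Variable ip : {dot H for Num.conj}.
Hypothesis ip_norm : forall x : H, `|x| ^+ 2 = ip x x.
Implicit Types S T F : bop H.
Let U := measurableTypeR R.

Local Notation "<< x , y >>" := (dr ip x y) (at level 2, format "<< x ,  y >>").
Local Notation sym := (sym ip).
Local Notation psd := (psd ip).
Local Notation proj := (proj ip).
Local Notation repr_set mu := (repr_set ip mu).
Local Notation repr_fun mu := (repr_fun ip mu).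

Definition total_mass (mu : H -> {measure set U -> \bar R}) :=
  forall x, mu x setT = (<<x, x>>)%:E.
Definition first_moment (mu : H -> {measure set U -> \bar R}) T :=
  forall x, (\int[mu x]_l l%:E = (<<T x, x>>)%:E)%E.

Section moments.
Variables (T : bop H) (mu : H -> {measure set U -> \bar R}).
Hypotheses (muT : total_mass mu) (mu1 : first_moment mu T).

Lemma first_moment_integrable x : (mu x).-integrable setT (fun l => l%:E).
Proof.
have mid : measurable_fun setT (@idfun R : U -> U) by exact: measurable_id.
apply/integrableP; split; first exact/measurable_EFinP.
by rewrite integral_fin_num_abs// mu1.
Qed.

Lemma integrable_cstT x (c : R) : (mu x).-integrable setT (fun=> c%:E).
Proof.
apply/integrableP; split; first exact: measurable_cst.
by rewrite integral_cst//=; move: (muT x) => /= ->; rewrite -EFinM ltry.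
Qed.

Lemma integral_cstT x (c : R) : (\int[mu x]_l c%:E = (c * <<x, x>>)%:E)%E.
Proof. by rewrite integral_cst//; move: (muT x) => /= ->; rewrite -EFinM. Qed.

Lemma conc_first_moment_ge (B : set U) (a : R) x : measurable B ->
  mu x (~` B) = 0%E -> (forall l, B l -> a <= l) -> a * <<x, x>> <= <<T x, x>>.
Proof.
move=> mB B0 aB; rewrite -lee_fin -integral_cstT -mu1.
have mCB : measurable (~` B) by exact: measurableC.
rewrite (negligible_integral mCB measurableT (integrable_cstT x a) B0).
rewrite (negligible_integral mCB measurableT (first_moment_integrable x) B0).
rewrite setTD setCK; apply: le_integral => //.
- exact: (integrableS measurableT mB (@subsetT _ _) (integrable_cstT x a)).
- exact: (integrableS measurableT mB (@subsetT _ _) (first_moment_integrable x)).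
- by move=> l; rewrite inE => Bl; rewrite lee_fin; exact: aB.
Qed.

Lemma conc_first_moment_le (B : set U) (a : R) x : measurable B ->
  mu x (~` B) = 0%E -> (forall l, B l -> l <= a) -> <<T x, x>> <= a * <<x, x>>.
Proof.
move=> mB B0 aB; rewrite -lee_fin -integral_cstT -mu1.
have mCB : measurable (~` B) by exact: measurableC.
rewrite (negligible_integral mCB measurableT (integrable_cstT x a) B0).
rewrite (negligible_integral mCB measurableT (first_moment_integrable x) B0).
rewrite setTD setCK; apply: le_integral => //.
- exact: (integrableS measurableT mB (@subsetT _ _) (first_moment_integrable x)).
- exact: (integrableS measurableT mB (@subsetT _ _) (integrable_cstT x a)).
- by move=> l; rewrite inE => Bl; rewrite lee_fin; exact: aB.
Qed.

Hypothesis sT : sym T.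
Hypothesis repr_ex : forall B, measurable B -> exists2 F, proj F & repr_set mu B F.

(** The represented projections commute with [F]. For [x] in its range and [y] in its kernel the
    measure at [x + y] is therefore the sum of those at [x] and [y]; comparing first moments gives
    [<<T x, y>> = 0], so [T] respects the decomposition defined by [F]. *)
Lemma repr_set_commT (B : set U) F : measurable B -> proj F -> repr_set mu B F ->
  F * T = T * F.
Proof.
move=> mB pF BF.
have FC C K : measurable C -> proj K -> repr_set mu C K -> K * F = F * K.
  move=> mC pK CK.
  have [G pG CBG] := repr_ex (measurableI _ _ mC mB).
  rewrite (repr_setI muT mC mB pK pF CK BF pG CBG).
  by rewrite setIC in CBG; rewrite (repr_setI muT mB mC pF pK BF CK pG CBG).
have orth x y : F x = x -> F y = 0 -> <<T x, y>> = 0.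
  move=> Fx Fy.
  have : (\int[mu (x + y)%R]_l l%:E = \int[mu x]_l l%:E + \int[mu y]_l l%:E)%E.
    rewrite -integral_measure_add//; [|exact: first_moment_integrable..].
    apply: eq_measure_integral => C mC _.
    rewrite /measure_add/= /msum !big_ord_recr /= big_ord0 add0e.
    have [K pK CK] := repr_ex mC; rewrite !CK -EFinD; congr (_%:E).
    rewrite bop_add !drE.
    have -> : <<K x, y>> = 0.
      by rewrite -Fx -bopM_E (FC C K)// bopM_E pF.1 Fy drE.
    have -> : <<K y, x>> = 0.
      by rewrite pK.1 -Fx -(bopM_E K) (FC C K)// bopM_E -pF.1 Fy drE.
    by rewrite add0r addr0.
  rewrite (mu1 (x + y)) (mu1 x) (mu1 y) -EFinD; move=> e; have {e} := EFin_inj e.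
  rewrite bop_add !drE (sT y x) (drC _ y); lra.
have FTF : F * T * F = T * F.
  apply: bop_ext => x; apply: (@dr_ext _ _ ip) => y; rewrite !bopM_E.
  have h : <<T (F x), y - F y>> = 0.
    by apply: orth; [exact: (proj_idem _ pF)|rewrite bop_sub (proj_idem _ pF) subrr].
  by rewrite pF.1; move: h; rewrite !drE; lra.
apply: bop_ext => x; apply: (@dr_ext _ _ ip) => y.
rewrite -FTF bopM_E pF.1 sT -bopM_E -FTF.
by rewrite !bopM_E pF.1 sT pF.1.
Qed.

End moments.

Section uniqueness.
Variables (T : bop H) (E : R -> bop H).
Hypotheses (sT : sym T) (hE : spectral_family ip T E).

Let pE l : proj (E l). Proof. by have [] := hE l. Qed.
Let bE l : bicomm T (E l). Proof. by have [] := hE l. Qed.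

(** Let [F] represent the half-line up to [b]. If [a < b], a vector in the range of [E a] and the
    kernel of [F] has a form at most [a] and at least [b] times its square norm, so it vanishes;
    likewise with the roles exchanged if [b < a]. The case [a = b] follows by approaching [a] from
    the right, with right continuity of [E] on one side and of the measure on the other. *)
Lemma spectral_measure_unique mu : total_mass mu -> first_moment mu T ->
  (forall B, measurable B -> exists2 F, proj F & repr_set mu B F) ->
  forall a, repr_set mu `]-oo, a]%classic (E a).
Proof.
move=> muT mu1 repr_ex.
have main a b F : proj F -> repr_set mu `]-oo, b]%classic F ->
    (a < b -> F * E a = E a) /\ (b < a -> E a * F = F).
  move=> pF bF; have mb : measurable (`]-oo, b]%classic : set U) by exact: measurable_itv.
  have FT := repr_set_commT muT mu1 sT repr_ex mb pF bF.
  have EF : F * E a = E a * F by exact: bE.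
  split=> [ab|ba]; apply: bop_ext => x; apply/esym/subr0_eq; apply: (@dr_le0 _ _ ip).
  - set v := _ - _.
    have Fv : F v = 0 by rewrite /v bop_sub !bopM_E (proj_idem _ pF) subrr.
    have Ev : E a v = v.
      rewrite /v bop_sub bopM_E (proj_idem _ (pE a)); congr (_ - _).
      by rewrite -bopM_E -EF bopM_E (proj_idem _ (pE a)).
    have [_ _ /(_ _ Ev) h1 _ _] := hE a.
    have Cv : (1 - F) v = v by rewrite bopD_E bopN_E Fv subr0.
    have := repr_set_conc muT (measurableC mb) (repr_setC muT mb bF) Cv.
    move=> /(conc_first_moment_ge muT mu1 (measurableC mb)) => /(_ b) h2.
    have {}h2 : b * <<v, v>> <= <<T v, v>>.
      by apply: h2 => l; rewrite /= in_itv /= => /negP; rewrite -ltNge => /ltW.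
    have : (b - a) * <<v, v>> <= 0 by lra.
    by rewrite pmulr_rle0// subr_gt0.
  - set v := _ - _.
    have Ev : E a v = 0 by rewrite /v bop_sub !bopM_E (proj_idem _ (pE a)) subrr.
    have Fv : F v = v.
      rewrite /v bop_sub bopM_E (proj_idem _ pF); congr (_ - _).
      by rewrite -bopM_E EF bopM_E (proj_idem _ pF).
    have [_ _ _ /(_ _ Ev) h1 _] := hE a.
    have := repr_set_conc muT mb bF Fv.
    move=> /(conc_first_moment_le muT mu1 mb) => /(_ b) h2.
    have {}h2 : <<T v, v>> <= b * <<v, v>>.
      by apply: h2 => l; rewrite /= in_itv.
    have : (a - b) * <<v, v>> <= 0 by lra.
    by rewrite pmulr_rle0// subr_gt0.
have pmono K L x : proj K -> proj L -> L * K = K -> <<K x, x>> <= <<L x, x>>.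
  move=> pK pL LK; rewrite (proj_form x pK) (proj_form x pL).
  have KL : K * L = K.
    apply: bop_ext => z; apply: (@dr_ext _ _ ip) => y.
    by rewrite bopM_E pK.1 pL.1 -bopM_E LK -pK.1.
  have := proj_pyth (L x) pK; rewrite -(bopM_E K) KL.
  by have := dr_ge0 ip (L x - K x); lra.
move=> a x; have ma : measurable (`]-oo, a]%classic : set U) by exact: measurable_itv.
have [F pF aF] := repr_ex _ ma.
rewrite aF; congr (_%:E); apply/eqP; rewrite eq_le; apply/andP; split.
  have h : <<E (a + n.+1%:R^-1) x, x>> @[n --> \oo] --> <<E a x, x>>.
    exact: (sf_rc ip_norm sT hE).
  apply: (cvgr_to_ge h); near=> n.
  by apply: pmono => //; apply: (main _ _ _ pF aF).2; rewrite ltrDl invr_gt0.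
have [F' hF'] : exists F' : nat -> bop H, forall n,
    proj (F' n) /\ repr_set mu `]-oo, (a + n.+1%:R^-1)]%classic (F' n).
  suff /choice[F' h] : forall n : nat, exists F, proj F /\
    repr_set mu `]-oo, (a + n.+1%:R^-1)]%classic F by exists F'.
  move=> n; have [F' ? ?] := repr_ex `]-oo, (a + n.+1%:R^-1)]%classic (measurable_itv _).
  by exists F'.
pose B n : set U := `]-oo, (a + n.+1%:R^-1)]%classic.
have cv : (mu x (B n) @[n --> \oo] --> mu x (\bigcap_n B n))%E.
  apply: nonincreasing_cvg_mu => //.
  - by rewrite (hF' 0).2 ltry.
  - by move=> n; exact: measurable_itv.
  - by apply: bigcapT_measurable => n; exact: measurable_itv.
  - move=> m n mn; apply/subsetPset => l; rewrite /B /= !in_itv /= => /le_trans; apply.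
    by rewrite lerD2l lef_pV2 ?posrE// ler_nat.
have BE : \bigcap_n B n = `]-oo, a]%classic.
  apply/seteqP; split=> l; rewrite /B /= in_itv /=.
    move=> h; apply/ler_addgt0Pr => e e0.
    have := h (Num.truncn e^-1) I; rewrite /= in_itv /= => /le_trans; apply.
    by rewrite lerD2l invf_ple ?posrE// ltW// truncnS_gt.
  by move=> la n _; rewrite /= in_itv /= (le_trans la)// lerDl invr_ge0.
rewrite BE aF in cv.
have cv' : <<F' n x, x>> @[n --> \oo] --> <<F x, x>>.
  have e : (fun n => mu x (B n)) = (fun n => (<<F' n x, x>>)%:E).
    by apply/funext => n; rewrite (hF' n).2.
  by rewrite e in cv; move/fine_cvgP : cv => [].
apply: (cvgr_to_ge cv'); near=> n.
have [pF'n aF'n] := hF' n.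
by apply: pmono => //; apply: (main _ _ _ pF'n aF'n).1; rewrite ltrDl invr_gt0.
Unshelve. all: by end_near. Qed.

End uniqueness.

(** The bicommutant clause keeps spectral projections in [N]; the last clause allows functions of
    [T] to be evaluated on eigenvectors. *)
Definition spectral_data T (mu : H -> {measure set U -> \bar R}) :=
  [/\ total_mass mu, first_moment mu T,
     forall B, measurable B -> exists F, [/\ proj F, bicomm T F & repr_set mu B F] &
     forall x l, T x = l%:C *: x -> mu x (~` [set l]) = 0%E].

Section existence.
Variables (T : bop H) (E : R -> bop H).
Hypotheses (sT : sym T) (hE : spectral_family ip T E).
Variable mu : H -> {measure set U -> \bar R}.
Hypothesis muT : total_mass mu.
Hypothesis muoc : forall x a b, a <= b -> mu x `]a, b]%classic = (<<(E b - E a) x, x>>)%:E.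

Let pE l : proj (E l). Proof. by have [] := hE l. Qed.
Let bE l : bicomm T (E l). Proof. by have [] := hE l. Qed.

Let repr_ex B : measurable B -> exists F, [/\ proj F, bicomm T F & repr_set mu B F].
Proof.
apply: (@repr_set_ex _ U R H ip ip_norm mu muT T (@ocitv R)) => //.
  exact: ocitvI.
move=> _ [[a b] _ <-] /=; have [ab|ba] := leP a b.
  exists (E b - E a); split; [exact: (sf_sub_proj hE ab)|exact: bicommB|].
  by move=> x; exact: muoc.
exists 0; split; [split; [exact: sym0|by rewrite mulr0]|exact: bicomm0|].
move=> x; rewrite set_itv_ge ?measure0 ?bop0_E ?drE//.
by rewrite bnd_simp -leNgt ltW.
Qed.

(** Let [Z] be the difference between the operator given by the calculus and [T] (up to a shift by
    [K]). On the range of [E b - E a] both operators have forms between [a] and [b], so the form of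
    [Z] is at most [b - a] there, and [increment_const] shows that [Z] vanishes. *)
Lemma sf_first_moment : first_moment mu T.
Proof.
have [K0 K00 [E0 E1]] := sf_bounds ip_norm hE.
pose K := K0 + 1.
have K_gt0 : 0 < K by rewrite addr_gt0.
have EK : E K = 1 by apply: E1; rewrite ltrDl.
have EmK : E (- K) = 0 by apply: E0; rewrite ltrN2 ltrDl.
(* [repr_fun_ex] covers bounded nonnegative functions: the identity is shifted by [K] and clipped
   outside []- K, K]], which carries all the mass. *)
pose f (l : U) : R := Num.max 0 (Num.min (l + K) (2 * K)).
have mf : measurable_fun setT f.
  apply: measurable_maxr; first exact: measurable_cst.
  apply: measurable_minr; last exact: measurable_cst.
  by apply: measurable_funD; [exact: measurable_id|exact: measurable_cst].
have f0 l : 0 <= f l by rewrite le_max lexx.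
have fK l : f l <= 2 * K by rewrite ge_max ge_min lexx orbT andbT mulr_ge0// ltW.
have fE l : - K < l -> l <= K -> f l = l + K.
  move=> l1 l2; rewrite /f min_l; last by lra.
  by rewrite max_r//; lra.
have [S [pS bS fS]] := repr_fun_ex ip_norm muT repr_ex mf f0 fK.
have SE a : S * E a = E a * S by apply/esym/bS; exact/esym/(bE a).
pose Z := S - T - K%:C *: (1 : bop H).
have sZ : sym Z.
  by apply: symB; [apply: symB => //; exact: pS.1|apply: symZ; exact: sym1].
have ZE a : Z * E a = E a * Z.
  rewrite /Z !mulrBl !mulrBr SE (sf_commT hE) -bop_scaleAl -bop_scaleAr.
  by rewrite mulr1 mul1r.
have key v a b : - K <= a -> a <= b -> b <= K -> (E b - E a) v = v ->
    `|<<Z v, v>>| <= (b - a) * <<v, v>>.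
  move=> Ka ab bK vE.
  have pab : proj (E b - E a) by exact: (sf_sub_proj hE ab).
  have Ebv : E b v = v.
    rewrite -{1}vE -bopM_E mulrBr (pE b).2 (sf_le hE ab); exact: vE.
  have Eav : E a v = 0.
    have : E b v - E a v = v by exact: vE.
    by rewrite Ebv => /eqP; rewrite subr_eq addrC -subr_eq subrr => /eqP.
  have mab : measurable (`]a, b]%classic : set U) by exact: measurable_itv.
  have c0 := repr_set_conc muT mab (fun x => muoc x ab) vE.
  have := @concentrated_bounds _ U R (mu v) _ f (a + K) (b + K) _ mab c0 (muT v) mf f0.
  rewrite fS !lee_fin => h.
  have {h} /andP[h1 h2] : (a + K) * <<v, v>> <= <<S v, v>> <= (b + K) * <<v, v>>.
    apply: h; [lra|lra|] => l; rewrite /= in_itv /= => /andP[al lb].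
    by rewrite fE//; lra.
  have [_ _ /(_ _ Ebv) h3 _ _] := hE b.
  have [_ _ _ /(_ _ Eav) h4 _] := hE a.
  by rewrite !bopE !drE ler_norml; apply/andP; split; lra.
have Z0 : Z = 0.
  apply: (sym_ext sZ (@sym0 _ _ ip)) => x.
  pose phi l := <<Z (E l x), x>>; pose G l := <<E l x, x>>.
  have pK : phi K = <<Z x, x>> by rewrite /phi EK bop1_E.
  have pmK : phi (- K) = 0 by rewrite /phi EmK bop0_E bop_zero drE.
  rewrite bop0_E drE; suff : phi (- K) = phi K by rewrite pK pmK.
  apply: (@increment_const _ phi G); first by lra.
  move=> a b Ka ab bK; set v := (E b - E a) x.
  have pab : proj (E b - E a) by exact: (sf_sub_proj hE ab).
  have Ev : (E b - E a) v = v by exact: (proj_idem _ pab).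
  have -> : <<Z (E b x), x>> - <<Z (E a x), x>> = <<Z v, v>>.
    have -> : <<Z v, v>> = <<Z v, x>>.
      rewrite {2}/v -pab.1 -bopM_E mulrBl -!ZE -mulrBr bopM_E Ev.
      by [].
    by rewrite /v bopD_E bopN_E bop_sub !drE.
  have -> : G b - G a = <<v, v>>.
    by rewrite /v -(proj_form x pab) bopD_E bopN_E !drE.
  exact: key.
have TS : T = S - K%:C *: (1 : bop H).
  by apply/esym/subr0_eq; rewrite -{}Z0 /Z addrAC.
move=> x.
pose D : set U := `](- K), K]%classic.
have mD : measurable D by exact: measurable_itv.
have D0 : mu x (~` D) = 0%E.
  have KK : - K <= K by lra.
  apply: (repr_set_conc muT mD (fun x => muoc x KK)).
  by rewrite EK EmK subr0.
have mid : measurable_fun setT (@idfun R : U -> U) by exact: measurable_id.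
rewrite (@ae_eq_integral _ _ _ (mu x) setT (fun l => (f l)%:E - K%:E)%E)//; first last.
- exists (~` D); split=> //; first exact: measurableC.
  move=> l /= h Dl; apply: h => _; move: Dl; rewrite /D /= in_itv /= => /andP[l1 l2].
  by rewrite fE// -EFinB addrK.
- apply/measurable_EFinP; apply: measurable_funB => //; exact: measurable_cst.
rewrite (@integralB_EFin _ _ _ (mu x) setT f (fun=> K))//; last first.
- exact: (integrable_cstT muT).
- apply/integrableP; split; first exact/measurable_EFinP.
  under eq_integral => l _ do rewrite gee0_abs ?lee_fin//.
  by rewrite fS ltry.
rewrite fS (integral_cstT muT) -EFinB {1}TS; congr (_%:E).
by rewrite !bopE !drE.
Qed.

(** The family jumps at [l]: [E a x] is 0 for [a < l] and [x] for [l <= a]. The complement of [l] is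
    covered by one open half-line above it and countably many closed ones below, all of mass 0. *)
Lemma sf_eigen x l : T x = l%:C *: x -> mu x (~` [set l]) = 0%E.
Proof.
move=> Tx.
have comm a : T (E a x) = l%:C *: E a x.
  by rewrite -bopM_E (bE a)// bopM_E Tx bop_scale.
have Elt a : a < l -> E a x = 0.
  move=> al; set v := E a x; have Ev : E a v = v by exact: (proj_idem _ (pE a)).
  have [_ _ /(_ _ Ev)] := hE a; rewrite comm -/v drE => h _ _.
  apply: (@dr_le0 _ _ ip); have : (l - a) * <<v, v>> <= 0 by lra.
  by rewrite pmulr_rle0// subr_gt0.
have Ege a : l <= a -> E a x = x.
  rewrite le_eqVlt => /predU1P[<-|la]; first by have [_ _ _ _] := hE l; apply.
  apply/esym/subr0_eq; set v := x - E a x.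
  have Ev : E a v = 0 by rewrite /v bop_sub (proj_idem _ (pE a)) subrr.
  have [_ _ _ /(_ _ Ev)] := hE a.
  have -> : T v = l%:C *: v by rewrite /v bop_sub comm Tx scalerBr.
  rewrite drZl => h _.
  apply: (@dr_le0 _ _ ip); have : (a - l) * <<v, v>> <= 0 by lra.
  by rewrite pmulr_rle0// subr_gt0.
have ray : forall a, mu x `]-oo, a]%classic = (<<E a x, x>>)%:E.
  move=> a; apply: (spectral_measure_unique sT hE muT sf_first_moment) => B mB.
  by have [F [? _ ?]] := repr_ex mB; exists F.
have m1 : measurable (`]-oo, l]%classic : set U) by exact: measurable_itv.
have r1 : mu x (~` `]-oo, l]%classic) = 0%E.
  have -> : ~` `]-oo, l]%classic = setT `\` (`]-oo, l]%classic : set U) by rewrite setTD.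
  rewrite (finite_measureD measurableT m1 _ (muT x))// muT ray Ege// -EFinB.
  by rewrite subrr.
have r2 n : mu x (`]-oo, (l - n.+1%:R^-1)]%classic) = 0%E.
  by rewrite ray Elt ?drE// gtrDl oppr_lt0 invr_gt0.
have sub : ~` [set l] `<=` (~` `]-oo, l]%classic : set U) `|`
    \bigcup_n `]-oo, (l - n.+1%:R^-1)]%classic.
  move=> a /= /eqP al; have [la|al'] := ltP l a.
    by left; rewrite /= in_itv /=; apply/negP; rewrite -ltNge.
  have {}al' : a < l by rewrite lt_neqAle al al'.
  right; exists (Num.truncn (l - a)^-1) => //=; rewrite in_itv /= lerBrDl -lerBrDr.
  by rewrite invf_ple ?posrE ?subr_gt0// ltW// truncnS_gt.
have mU : measurable (\bigcup_n (`]-oo, (l - n.+1%:R^-1)]%classic : set U)).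
  by apply: bigcupT_measurable => n; exact: measurable_itv.
have U0 : mu x (\bigcup_n `]-oo, (l - n.+1%:R^-1)]%classic) = 0%E.
  apply/negligibleP => //; apply: negligible_bigcup => n.
  by exists `]-oo, (l - n.+1%:R^-1)]%classic; split=> //; exact: r2.
have m2 : measurable (~` (`]-oo, l]%classic : set U)) by exact: measurableC.
have mS : measurable (~` [set l] : set U) by apply: measurableC; exact: measurable_set1.
apply: (@subset_measure0 _ U R (mu x) _ _ mS (measurableU _ _ m2 mU) sub).
exact: null_setU.
Qed.

End existence.

Lemma spectral_data_ex T : sym T -> exists mu, spectral_data T mu.
Proof.
move=> sT; have [E hE] := spectral_family_ex ip_norm sT.
have [mu hmu] := sf_measure ip_norm sT hE.
have muT x : mu x setT = (<<x, x>>)%:E by have [] := hmu x.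
have muoc x a b : a <= b -> mu x `]a, b]%classic = (<<(E b - E a) x, x>>)%:E.
  by have [h _] := hmu x; exact: h.
exists mu; split => //.
- exact: (sf_first_moment sT hE muT muoc).
- apply: (@repr_set_ex _ U R H ip ip_norm mu muT T (@ocitv R)) => //.
    exact: ocitvI.
  move=> _ [[a b] _ <-] /=; have [ab|ba] := leP a b.
    exists (E b - E a); split; [exact: (sf_sub_proj hE ab)| |by move=> x; exact: muoc].
    by apply: bicommB; [have [] := hE b|have [] := hE a].
  exists 0; split; [split; [exact: sym0|by rewrite mulr0]|exact: bicomm0|].
  move=> x; rewrite set_itv_ge ?measure0 ?bop0_E ?drE//.
  by rewrite bnd_simp -leNgt ltW.
- exact: (sf_eigen sT hE muT muoc).
Qed.

Lemma spectral_data_unique T mu mu' : sym T -> spectral_data T mu ->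
  total_mass mu' -> first_moment mu' T ->
  (forall B, measurable B -> exists2 F, proj F & repr_set mu' B F) ->
  forall x B, measurable B -> mu x B = mu' x B.
Proof.
move=> sT [muT mu1 rep _] muT' mu1' rep' x B.
have [E hE] := spectral_family_ex ip_norm sT.
have {}rep C : measurable C -> exists2 F, proj F & repr_set mu C F.
  by move=> /rep[F [? _ ?]]; exists F.
have r1 := spectral_measure_unique sT hE muT mu1 rep.
have r2 := spectral_measure_unique sT hE muT' mu1' rep'.
have ocE (nu : H -> {measure set U -> \bar R}) a b : a <= b ->
    (forall a, repr_set nu `]-oo, a]%classic (E a)) ->
    nu x `]a, b]%classic = (<<E b x, x>> - <<E a x, x>>)%:E.
  move=> ab r.
  have -> : `]a, b]%classic = (`]-oo, b]%classic : set U) `\` `]-oo, a]%classic.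
    apply/seteqP; split=> l; rewrite /= !in_itv /=.
      by move=> /andP[al lb]; split=> //; rewrite leNgt al.
    by move=> [lb /negP]; rewrite -ltNge => ->.
  rewrite (@finite_measureD _ _ _ (nu x) (<<E b x, x>>)) ?r//.
  by move=> l; rewrite /= !in_itv /= => /le_trans; exact.
apply: (@dynkin_induction _ U (@ocitv R) (fun B => mu x B = mu' x B)) => //.
- exact: ocitvI.
- by rewrite muT muT'.
- move=> _ [[a b] _ <-] /=; have [ab|ba] := leP a b.
    by rewrite (ocE mu)// (ocE mu').
  by rewrite set_itv_ge ?measure0// bnd_simp -leNgt ltW.
- move=> A mA AE; rewrite -setTD.
  rewrite (@finite_measureD _ _ _ (mu x) _ _ _ measurableT mA (@subsetT _ _) (muT x)).
  rewrite (@finite_measureD _ _ _ (mu' x) _ _ _ measurableT mA (@subsetT _ _) (muT' x)).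
  by rewrite AE muT muT'.
- move=> F mF tF FE.
  rewrite !measure_semi_bigcup//; try exact: bigcupT_measurable.
  by apply: eq_eseriesr => i _.
Qed.

Lemma sym_adjoint T : sym T -> adjoint ip T T.
Proof.
move=> sT x y; apply: ip_ext; first exact: sT.
by rewrite -bop_scale sT.
Qed.

Lemma sym_selfadjoint T : sym T <-> selfadjoint ip T.
Proof.
split=> [sT|[_ aT] x y]; last by rewrite /dr aT.
by split; [exact: bop_bounded|exact: sym_adjoint].
Qed.

Lemma proj_projection F : proj F <-> projection ip F.
Proof.
split=> [[sF FF]|[sF FF]].
  split; first exact/sym_selfadjoint.
  by rewrite -[RHS]/(bop_fun F) -[in RHS]FF.
split; first exact/sym_selfadjoint.
by apply: bop_ext => x; rewrite bopM_E -[in RHS]FF.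
Qed.

Lemma bop_of (T : H -> H) : bounded_operator T -> exists S : bop H, S = T :> (H -> H).
Proof. by move=> bT; exists (Bop (asboolT bT)). Qed.

(** Settles the choice in [borel_calculus]: a competing spectral measure agrees with [mu] on Borel
    sets, so its operator has the same quadratic form as [S]. *)
Lemma borel_calculusE T (f : R -> R) S mu : sym T -> spectral_data T mu ->
  sym S -> repr_fun mu f S -> borel_calculus ip f T = S.
Proof.
move=> sT dmu sS fS; have [muT mu1 rep _] := dmu.
apply: xget_unique.
- split; first exact/sym_selfadjoint.
  (* The projection-valued map must be total; sets that are not measurable receive 0. *)
  have /choice[F hF] : forall B : set U, exists F, measurable B ->
      [/\ proj F, bicomm T F & repr_set mu B F].
    move=> B; have [mB|mB] := pselect (measurable B); last by exists 0.
    by have [F hF] := rep B mB; exists F.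
  exists (fun B => F B : H -> H), mu; split=> //.
  split=> //.
  - by move=> B mB; have [pF _ _] := hF B mB; apply/proj_projection.
  - have [pF _ FT] := hF setT measurableT.
    suff -> : F setT = 1 by [].
    apply: (sym_ext pF.1 (@sym1 _ _ ip)) => x.
    by apply: EFin_inj; rewrite -FT muT.
  - by move=> x B mB; have [_ _ ->] := hF B mB.
- move=> S' [[bS' aS'] [E' [mu' [[E'p E'T mu'E mu1'] fS']]]].
  have [S1 S1E] := bop_of bS'.
  have sS1 : sym S1 by apply/sym_selfadjoint; rewrite S1E.
  suff -> : S = S1 by rewrite S1E.
  apply: (sym_ext sS sS1) => x; apply: EFin_inj.
  have uniq := @spectral_data_unique T mu mu' sT dmu.
  rewrite -fS S1E -[RHS]fS'; apply: eq_measure_integral => B mB _.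
  apply: uniq => //.
  - by move=> y; rewrite mu'E// E'T.
  - move=> C mC; have [[bE aE] EE] := E'p C mC.
    have [F FE] := bop_of bE; exists F.
      by apply/proj_projection; rewrite FE; exact: E'p.
    by move=> y; rewrite mu'E// FE.
Qed.

End spectral_measures.

(** * The operator norm *)

Section operator_norm.
Context {R : realType} {H : completeNormedModType R[i]}.
Implicit Types S T : bop H.

Lemma opnorm_le (T : H -> H) (c : R) : 0 <= c ->
  (forall x, nr (T x) <= c * nr x) -> opnorm T <= c.
Proof.
move=> c0 h; rewrite /opnorm; apply: ge_sup.
  by exists (nr (T 0)); exists 0 => //=; rewrite normr0 ler01.
move=> _ [x /= x1 <-]; rewrite (le_trans (h x))//.
rewrite -[leRHS]mulr1 ler_wpM2l//; move: x1; rewrite nrE.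
by rewrite -[1]/(1%:C) lecR.
Qed.

Lemma opnorm_ub T x : nr x <= 1 -> nr (T x) <= opnorm T.
Proof.
move=> x1; apply: ub_le_sup; last first.
  by exists x => //=; rewrite nrE -[1]/(1%:C) lecR.
have [M M0 bT] := bop_norm T; exists M => _ [y /= y1 <-].
rewrite (le_trans (bT y))// -[leRHS]mulr1 ler_wpM2l//; move: y1; rewrite nrE.
by rewrite -[1]/(1%:C) lecR.
Qed.

(** True of arbitrary functions: on an unbounded set [sup] has the default value 0. *)
Lemma opnorm_ge0 (T : H -> H) : 0 <= opnorm T.
Proof.
rewrite /opnorm; set A := [set _ | _ in _].
have A0 : A (nr (T 0)) by exists 0 => //=; rewrite normr0 ler01.
have [hA|/sup_out ->//] := pselect (has_sup A).
by rewrite (le_trans (nr_ge0 (T 0)))//; apply: (sup_upper_bound hA).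
Qed.

Lemma opnorm_bound T x : nr (T x) <= opnorm T * nr x.
Proof.
have [->|x0] := eqVneq x 0; first by rewrite bop_zero nr0 mulr0.
have nx : 0 < nr x by rewrite lt0r nr_eq0 x0 nr_ge0.
rewrite -ler_pdivrMr// mulrC.
have := @opnorm_ub T ((nr x)^-1%:C *: x); rewrite bop_scale !nrZ.
by rewrite gtr0_norm ?invr_gt0// mulVf ?gt_eqF//; apply.
Qed.

End operator_norm.

(** * Traces and the ideal of compact elements *)

Section algebra.
Context {R : realType} {H : completeNormedModType R[i]}.
Variable ip : {dot H for Num.conj}.
Hypothesis ip_norm : forall x : H, `|x| ^+ 2 = ip x x.
Implicit Types S T E F X Y : bop H.

Local Notation "<< x , y >>" := (dr ip x y) (at level 2, format "<< x ,  y >>").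
Local Notation sym := (sym ip).
Local Notation psd := (psd ip).
Local Notation proj := (proj ip).

(** Over the complex numbers a real-valued form is automatically symmetric; the imaginary part of
    the form at [x + 'i *: y] shows it. *)
Lemma psd_positive T : psd T <-> positive_op ip T.
Proof.
split=> [[sT pT]|[_ pT]].
  split; first exact: bop_bounded.
  move=> x; have aT := sym_adjoint sT.
  have := ipC ip (T x) x; rewrite -aT lecE => /= e.
  have := pT x; rewrite /dr; case: (ip (T x) x) e => a b [] /= b0 ->.
  by rewrite andbT; apply/eqP; lra.
have im x : complex.Im (ip (T x) x) = 0.
  by have := pT x; rewrite lecE => /andP[/eqP].
split=> [x y|x]; last by have := pT x; rewrite lecE => /andP[].
have := im (x + 'i *: y).
rewrite !bopL !linearDl !linearDr !linearZl_LR !linearZr_LR /=.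
rewrite /dr (ipC ip x); have := im x; have := im y.
case: (ip (T x) x) => a b; case: (ip (T y) y) => c d.
case: (ip (T x) y) => e f; case: (ip (T y) x) => g h /=; lra.
Qed.

Lemma op_leP S T : sym S -> sym T ->
  op_le ip S T <-> forall x, <<S x, x>> <= <<T x, x>>.
Proof.
move=> sS sT.
have im X x : sym X -> complex.Im (ip (X x) x) = 0.
  move=> sX; have := ipC ip (X x) x; rewrite -(sym_adjoint sX).
  by case: (ip (X x) x) => a b [] /= ?; lra.
split=> h x; have := h x; first by rewrite lecE => /andP[].
by rewrite lecE !im// eqxx.
Qed.

Variable N : set (H -> H).
Hypothesis vN : von_neumann_algebra ip N.

Lemma N_bop (T : H -> H) : N T -> exists S : bop H, S = T :> (H -> H).
Proof. by rewrite -vN.2 => -[/bop_of]. Qed.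

Lemma N_comm (S T : bop H) : (S \o T = T \o S :> (H -> H)) <-> S * T = T * S.
Proof.
split=> [e|e]; last by rewrite -[LHS]/(bop_fun (S * T)) e.
by apply: bop_ext => x; have := congr1 (fun f : H -> H => f x) e.
Qed.

Lemma N_bopP T : N T <-> forall S : bop H, commutant N S -> T * S = S * T.
Proof.
rewrite -{1}vN.2; split=> [[_ h] S /h/N_comm //|h].
split; first exact: bop_bounded.
by move=> S NS; have [S' S'E] := bop_of NS.1; rewrite -S'E; apply/N_comm/h; rewrite S'E.
Qed.

Lemma commutant_comm (S : bop H) T : commutant N S -> N T -> T * S = S * T.
Proof. by move=> [_ h] /h /N_comm ->. Qed.

(** The way in which [N], as its own bicommutant, is used: an operator built from [T] needs no other
    argument to lie in [N]. *)
Lemma N_bicomm T X : N T -> bicomm T X -> N X.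
Proof.
move=> NT bX; apply/N_bopP => S NS; apply/esym/bX.
by rewrite (commutant_comm NS NT).
Qed.

Lemma N1 : N (1 : bop H). Proof. by apply/N_bopP => S _; rewrite mul1r mulr1. Qed.
Lemma N0 : N (0 : bop H). Proof. by apply/N_bopP => S _; rewrite mul0r mulr0. Qed.
Lemma ND S T : N S -> N T -> N (S + T : bop H).
Proof.
move=> NS NT; apply/N_bopP => X NX.
by rewrite mulrDl mulrDr (commutant_comm NX NS) (commutant_comm NX NT).
Qed.
Lemma NM S T : N S -> N T -> N (S * T : bop H).
Proof.
move=> NS NT; apply/N_bopP => X NX.
by rewrite -mulrA (commutant_comm NX NT) mulrA (commutant_comm NX NS) mulrA.
Qed.
Lemma NZ a T : N T -> N (a *: T : bop H).
Proof. by move=> NT; apply: (N_bicomm NT); apply: bicommZ; exact: bicomm_refl. Qed.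
Lemma NN T : N T -> N (- T : bop H).
Proof. by move=> NT; apply: (N_bicomm NT); apply: bicommN; exact: bicomm_refl. Qed.
Lemma NB S T : N S -> N T -> N (S - T : bop H).
Proof. by move=> NS NT; apply: ND => //; exact: NN. Qed.
Lemma N_exp T n : N T -> N (T ^+ n : bop H).
Proof. by move=> NT; apply: (N_bicomm NT); apply: bicommX; exact: bicomm_refl. Qed.

Variable tau : (H -> H) -> \bar R.
Hypothesis tau_fns : fns_trace ip N tau.

Lemma cone_psd T : pos_cone ip N T <-> N T /\ psd T.
Proof. by split=> -[NT pT]; split=> //; apply/psd_positive. Qed.

Lemma cone_bop (T : H -> H) : pos_cone ip N T ->
  exists S : bop H, [/\ S = T :> (H -> H), N S & psd S].
Proof.
move=> [NT pT]; have [S ST] := N_bop NT; exists S.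
by split; rewrite ?ST//; apply/psd_positive; rewrite ST.
Qed.

Let tr : is_trace ip N tau. Proof. by case: tau_fns. Qed.

Lemma tau_ge0 T : N T -> psd T -> (0 <= tau T)%E.
Proof. by move=> NT pT; case: tr => + _ _ _; apply; apply/cone_psd. Qed.

Lemma tauD S T : N S -> psd S -> N T -> psd T ->
  tau (S + T : bop H) = (tau S + tau T)%E.
Proof. by move=> *; case: tr => _ + _ _; apply; apply/cone_psd. Qed.

Lemma tauZ (c : R) T : 0 <= c -> N T -> psd T ->
  tau (c%:C *: T : bop H) = (c%:E * tau T)%E.
Proof. by move=> c0 *; case: tr => _ _ + _; apply => //; apply/cone_psd. Qed.

Lemma tauC S T : N S -> N T -> (forall x y, <<T x, y>> = <<x, S y>>) ->
  tau (S * T : bop H) = tau (T * S : bop H).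
Proof.
move=> NS NT ST; case: tr => _ _ _; apply => // x y.
apply: ip_ext; first exact: ST.
by rewrite -bop_scale ST.
Qed.

Lemma tau0 : tau (0 : bop H) = 0%E.
Proof.
have := tauZ (lexx 0) N0 (@psd0 _ _ ip).
by rewrite scaler0 mul0e.
Qed.

Lemma tau_mono S T : N S -> psd S -> N T -> psd T ->
  (forall x, <<S x, x>> <= <<T x, x>>) -> (tau S <= tau T)%E.
Proof.
move=> NS pS NT pT ST.
have pTS : psd (T - S).
  split=> [|x]; first by apply: symB; [exact: pT.1|exact: pS.1].
  by rewrite bopD_E bopN_E !drE subr_ge0.
have -> : T = S + (T - S) by rewrite addrC subrK.
rewrite tauD//; last exact: NB.
by rewrite leeDl// tau_ge0//; exact: NB.
Qed.

(** Normality is stated for directed sets and least upper bounds in [N]; a pointwise limit of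
    increasing forms is such a bound. *)
Lemma tau_normal (u : nat -> bop H) T : (forall n, N (u n)) -> (forall n, psd (u n)) ->
  (forall m n x, (m <= n)%N -> <<u m x, x>> <= <<u n x, x>>) ->
  N T -> psd T -> (forall x, <<u n x, x>> @[n --> \oo] --> <<T x, x>>) ->
  tau (u n) @[n --> \oo] --> tau T.
Proof.
move=> Nu pu mu NT pT uT.
have ub n x : <<u n x, x>> <= <<T x, x>>.
  apply: (cvgr_to_ge (uT x)); near=> m; apply: mu; near: m.
  exact: nbhs_infty_ge.
have -> : tau T = ereal_sup (range (fun n => tau (u n))).
  pose A : set (H -> H) := range (fun n => u n : H -> H).
  have [_ _ nt _] := tau_fns.
  rewrite (nt A T).
  - congr ereal_sup; apply/seteqP; split.
      by move=> _ [_ [n _ <-] <-]; exists n.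
    by move=> _ [n _ <-]; exists (u n) => //; exists n.
  - by exists (u 0); exists 0.
  - by move=> _ [n _ <-]; apply/cone_psd.
  - move=> _ _ [m _ <-] [n _ <-]; exists (u (maxn m n)); split.
    + by exists (maxn m n).
    + by apply/op_leP => [||x]; [exact: (pu _).1|exact: (pu _).1|apply: mu; exact: leq_maxl].
    + by apply/op_leP => [||x]; [exact: (pu _).1|exact: (pu _).1|apply: mu; exact: leq_maxr].
  - split; first exact/cone_psd.
      move=> _ [n _ <-]; apply/op_leP; [exact: (pu _).1|exact: pT.1|].
      by move=> x; exact: ub.
    move=> V NV sV h; have [W WV] := N_bop NV.
    have sW : sym W by apply/sym_selfadjoint; rewrite WV.
    rewrite -WV; apply/op_leP; [exact: pT.1|exact: sW|] => x.
    apply: (cvgr_to_le (uT x)); near=> n.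
    have : op_le ip (u n) V by apply: h; exists n.
    by rewrite -WV => /op_leP; apply => //; exact: (pu n).1.
apply: ereal_nondecreasing_cvgn => m n mn.
by apply: tau_mono => // x; exact: mu.
Unshelve. all: by end_near. Qed.

(** [tau_normal] applied to [u 0 - u n]; the finite trace of [u 0] is what permits subtracting. *)
Lemma tau_normal_decr (u : nat -> bop H) T : (forall n, N (u n)) ->
  (forall n, psd (u n)) ->
  (forall m n x, (m <= n)%N -> <<u n x, x>> <= <<u m x, x>>) ->
  N T -> psd T -> (forall x, <<u n x, x>> @[n --> \oo] --> <<T x, x>>) ->
  (tau (u 0%N) < +oo)%E -> fine (tau (u n)) @[n --> \oo] --> fine (tau T).
Proof.
move=> Nu pu mu NT pT uT fin0.
have lb n x : <<T x, x>> <= <<u n x, x>>.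
  apply: (cvgr_to_le (uT x)); near=> m; apply: mu; near: m.
  exact: nbhs_infty_ge.
have fin S : N S -> psd S -> (forall x, <<S x, x>> <= <<u 0%N x, x>>) ->
    tau S \is a fin_num.
  move=> NS pS h; rewrite ge0_fin_numE ?tau_ge0//.
  by rewrite (le_lt_trans _ fin0)// tau_mono.
have sub S : N S -> psd S -> (forall x, <<S x, x>> <= <<u 0%N x, x>>) ->
    [/\ N (u 0%N - S : bop H), psd (u 0%N - S) &
       fine (tau S) = fine (tau (u 0%N)) - fine (tau (u 0%N - S : bop H))].
  move=> NS pS h.
  have NuS : N (u 0%N - S : bop H) by exact: NB.
  have puS : psd (u 0%N - S).
    split=> [|x]; first by apply: symB; [exact: (pu _).1|exact: pS.1].
    by rewrite bopD_E bopN_E !drE subr_ge0.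
  split=> //; have e : u 0%N = S + (u 0%N - S) by rewrite addrC subrK.
  have := tauD NS pS NuS puS; rewrite -e => ->; rewrite fineD ?addrK//.
    exact: fin.
  apply: fin => // x; rewrite bopD_E bopN_E !drE gerDl oppr_le0.
  exact: pS.2.
have le0 n x : <<u n x, x>> <= <<u 0%N x, x>> by exact: mu.
have cv : tau (u 0%N - u n : bop H) @[n --> \oo] --> tau (u 0%N - T : bop H).
  apply: tau_normal.
  - by move=> n; have [] := sub (u n) (Nu n) (pu n) (le0 n).
  - by move=> n; have [] := sub (u n) (Nu n) (pu n) (le0 n).
  - by move=> m n x mn; rewrite !bopD_E !bopN_E !drE lerD2l lerN2 mu.
  - by have [] := sub T NT pT (lb 0%N).
  - by have [] := sub T NT pT (lb 0%N).
  - move=> x; rewrite bopD_E bopN_E !drE.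
    under eq_fun do rewrite bopD_E bopN_E !drE.
    by apply: cvgB => //; exact: cvg_cst.
have [N1' p1' ->] := sub T NT pT (lb 0%N).
under eq_fun => n do have [_ _ ->] := sub (u n) (Nu n) (pu n) (le0 n).
apply: cvgB; first exact: cvg_cst.
apply: fine_cvg; rewrite fineK//.
apply: fin => // x; rewrite bopD_E bopN_E !drE gerDl oppr_le0.
exact: pT.2.
Unshelve. all: by end_near. Qed.

(** [T] is at least [a] on the range of [E] and at most [a / 2] in norm on that of [F], so [E F],
    and hence its adjoint [F E], has norm at most 1/2. Then [E (1 - F) E] is at least [E / 2], and
    cyclicity turns its trace into that of [(1 - F) E (1 - F)], at most [tau (1 - F)]. This
    dispenses with the comparison theory of projections at the price of the factor 2. *)
Lemma tau_proj_bound T E F (a b : R) : sym T -> N E -> proj E -> N F -> proj F ->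
  E * T = T * E -> 0 < a -> b <= a / 2 ->
  (forall v, E v = v -> a * <<v, v>> <= <<T v, v>>) ->
  (forall v, nr (T (F v)) <= b * nr v) ->
  (tau E <= 2%:E * tau (1 - F : bop H)%R)%E.
Proof.
move=> sT NE pE NF pF ET a0 ba aE bF.
have nrE' v : nr (E v) <= nr v.
  by apply: (@psd_le1_nr _ _ ip ip_norm E v (proj_psd pE)) => x; exact: proj_le1.
have EF v : nr (E (F v)) <= 2^-1 * nr v.
  have h1 : a * nr (E (F v)) <= nr (T (E (F v))).
    have [->|w0] := eqVneq (E (F v)) 0; first by rewrite bop_zero nr0 mulr0.
    have nw : 0 < nr (E (F v)) by rewrite lt0r nr_eq0 w0 nr_ge0.
    rewrite -(ler_pM2r nw) -mulrA -expr2 (nr_sqr ip_norm).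
    rewrite (le_trans (aE _ _))//; first exact: (proj_idem _ pE).
    by rewrite (le_trans (ler_norm _))// dr_cs.
  have h2 : nr (T (E (F v))) <= b * nr v.
    by rewrite -bopM_E -ET bopM_E (le_trans (nrE' _)).
  rewrite -(ler_pM2l a0) (le_trans h1)// (le_trans h2)// mulrA ler_wpM2r ?nr_ge0//.
have FE v : nr (F (E v)) <= 2^-1 * nr (E v).
  set z := F (E v).
  have [->|z0] := eqVneq z 0; first by rewrite nr0 mulr_ge0 ?nr_ge0 ?invr_ge0.
  have nz : 0 < nr z by rewrite lt0r nr_eq0 z0 nr_ge0.
  rewrite -(ler_pM2r nz) -expr2 (nr_sqr ip_norm).
  have -> : <<z, z>> = <<E v, E (F z)>>.
    rewrite -pE.1 (proj_idem _ pE) -pF.1 -/z.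
    by [].
  rewrite (le_trans (ler_norm _))// (le_trans (dr_cs ip_norm _ _))//.
  by rewrite [leRHS]mulrAC [leLHS]mulrC ler_wpM2r ?nr_ge0.
pose T1 := (1 - F) * E; pose T2 := E * (1 - F).
have pF' := proj_compl pF.
have NF' : N (1 - F : bop H) by apply: NB => //; exact: N1.
have tE : tau (E * (1 - F) * E : bop H) = tau ((1 - F) * E * (1 - F) : bop H).
  have e1 : T2 * T1 = E * (1 - F) * E by rewrite /T1 /T2 mulrA -(mulrA E) pF'.2.
  have e2 : T1 * T2 = (1 - F) * E * (1 - F).
    by rewrite /T1 /T2 mulrA -(mulrA (1 - F)) pE.2.
  rewrite -e1 -e2; apply: tauC; [exact: NM|exact: NM|] => x y.
  by rewrite /T1 /T2 !bopM_E pF'.1 pE.1.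
have le1 : (tau ((1 - F) * E * (1 - F) : bop H)%R <= tau (1 - F : bop H)%R)%E.
  apply: tau_mono => //.
  - by apply: NM => //; exact: NM.
  - by apply: psd_conj; [exact: pF'.1|exact: proj_psd].
  - exact: proj_psd.
  - move=> x; rewrite !bopM_E pF'.1 (le_trans (proj_le1 _ pE))//.
    by rewrite -(proj_form x pF').
have NEE : N (E * (1 - F) * E : bop H) by apply: NM => //; exact: NM.
have pEE : psd (E * (1 - F) * E) by apply: psd_conj; [exact: pE.1|exact: proj_psd].
have le2 : (tau E <= 2%:E * tau (E * (1 - F) * E : bop H)%R)%E.
  rewrite -tauZ//; apply: tau_mono => //.
  - exact: proj_psd.
  - exact: NZ.
  - exact: psdZ.
  - move=> x; rewrite [leRHS](_ : _ = 2 * <<(E * (1 - F) * E) x, x>>); last exact: drZl.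
    have -> : <<(E * (1 - F) * E) x, x>> = <<E x, E x>> - <<F (E x), E x>>.
      by rewrite !bopM_E pE.1 bopD_E bopN_E !drE.
    rewrite (proj_form x pE) (proj_form (E x) pF) -!(nr_sqr ip_norm).
    have := FE x; have := nr_ge0 (F (E x)); have := nr_ge0 (E x).
    move: (nr (E x)) (nr (F (E x))) => e f e0 f0 fe.
    by nra.
rewrite (le_trans le2)// lee_pmul2l// tE; exact: le1.
Qed.

End algebra.

(** * Membership in the compact ideal, and traces of functions of an operator *)

Section ideal.
Context {R : realType} {H : completeNormedModType R[i]}.
Variable ip : {dot H for Num.conj}.
Hypothesis ip_norm : forall x : H, `|x| ^+ 2 = ip x x.
Implicit Types S T E F X Y : bop H.

Local Notation "<< x , y >>" := (dr ip x y) (at level 2, format "<< x ,  y >>").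
Local Notation sym := (sym ip).
Local Notation psd := (psd ip).
Local Notation proj := (proj ip).

Variables (N : set (H -> H)) (tau : (H -> H) -> \bar R).
Hypothesis vN : von_neumann_algebra ip N.
Hypothesis tau_fns : fns_trace ip N tau.

Local Notation K := (compact_ideal ip N tau).

Lemma K0 : K (0 : bop H).
Proof. by move=> J [_ J0 _ _ _] _. Qed.

Lemma KD S T : K S -> K T -> K (S + T : bop H).
Proof. by move=> KS KT J cJ fJ; have [_ _ JD _ _] := cJ; apply: JD; [exact: KS|exact: KT]. Qed.

Lemma KMl S T : N S -> K T -> K (S * T : bop H).
Proof.
move=> NS KT J cJ fJ; have [_ _ _ JM _] := cJ.
by have [] := JM _ _ NS (KT J cJ fJ).
Qed.

Lemma KZ a T : K T -> K (a *: T : bop H).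
Proof.
move=> KT; have -> : a *: T = (a *: (1 : bop H)) * T by rewrite -bop_scaleAl mul1r.
by apply: KMl => //; apply: (NZ vN); exact: (N1 vN).
Qed.

Lemma KN T : K T -> K (- T : bop H).
Proof. by move=> KT; rewrite -scaleN1r; exact: KZ. Qed.

Lemma KB S T : K S -> K T -> K (S - T : bop H).
Proof. by move=> KS KT; apply: KD => //; exact: KN. Qed.

Lemma K_closed T : N T ->
  (forall e : R, 0 < e -> exists2 S : bop H, K S & opnorm (T - S : bop H) < e) -> K T.
Proof.
move=> NT h J cJ fJ; have [_ _ _ _ Jc] := cJ; apply: Jc => // e e0.
by have [S KS TS] := h e e0; exists S => //; exact: KS.
Qed.

Lemma finite_pos0 : finite_pos ip N tau (0 : bop H).
Proof.
split; first by apply/cone_psd; split; [exact: (N0 vN)|exact: psd0].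
by rewrite (tau0 vN tau_fns) ltry.
Qed.

Lemma K_finite T : N T -> psd T -> (tau T < +oo)%E -> K T.
Proof.
move=> NT pT fT J cJ; apply; exists T, (0 : bop H), (0 : bop H), (0 : bop H).
have f0 := finite_pos0.
split=> //; first by split=> //; exact/cone_psd.
rewrite -[LHS]/(bop_fun T) -[RHS]/(bop_fun (T - 0 + 'i *: (0 - 0))).
by rewrite !subr0 scaler0 addr0.
Qed.

(** [T (1 - F)] is in the ideal because [1 - F] has finite trace, and it differs from [T] by [T F],
    of norm at most the chosen bound. *)
Lemma K_small T : N T ->
  (forall e : R, 0 < e -> exists F, [/\ N F, proj F,
     (tau (1 - F : bop H)%R < +oo)%E & forall v, nr (T (F v)) <= e * nr v]) -> K T.
Proof.
move=> NT h; apply: K_closed => // e e0.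
have e20 : 0 < e / 2 by rewrite divr_gt0.
have [F [NF pF fF TF]] := h _ e20.
have NF' : N (1 - F : bop H) by apply: (NB vN) => //; exact: (N1 vN).
exists (T * (1 - F)).
  by apply: KMl => //; apply: K_finite => //; apply/proj_psd/proj_compl.
have -> : T - T * (1 - F) = T * F by rewrite mulrBr mulr1 subKr.
rewrite (@le_lt_trans _ _ (e / 2)) ?ltr_pdivrMr ?ltr_pMr ?ltr1n//.
by apply: opnorm_le; rewrite ?divr_ge0 ?(ltW e0).
Qed.

(* X is congruent to X^2 / 2, hence to X^(n+1) / 2^n for all n. *)
Lemma K_half X : N X -> psd X -> (forall x, <<X x, x>> <= <<x, x>>) ->
  K (X * (2%:R - X) : bop H) -> K X.
Proof.
move=> NX pX X1 KX.
pose c n : R[i] := ((2^-1) ^+ n)%:C.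
have step n : K (X - c n *: X ^+ n.+1 : bop H).
  elim: n => [|n ih]; first by rewrite /c expr0 scale1r expr1 subrr; exact: K0.
  have -> : X - c n.+1 *: X ^+ n.+2 =
      (X - c n *: X ^+ n.+1) + c n.+1 *: (X ^+ n * (X * (2%:R - X))).
    rewrite mulrBr mulr_natr mulrBr mulrnAr mulrA -!exprSr.
    rewrite scalerBr -scaler_nat scalerA.
    have -> : c n.+1 * 2%:R = c n.
      rewrite /c exprSr RcM -mulrA -(rmorph_nat (real_complex R)) -rmorphM mulVf//.
      by rewrite rmorph1 mulr1.
    by rewrite addrA subrK.
  by apply: KD => //; apply: KZ; apply: KMl => //; exact: (N_exp vN).
apply: K_closed => // e e0.
have [n ne] : exists n, (2^-1 : R) ^+ n < e.
  have := @cvg_expr R (2^-1); rewrite ger0_norm ?invr_ge0// invf_lt1 ?ltr1n//.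
  move=> /(_ isT)/cvgrPdist_lt/(_ _ e0)[n _ h]; exists n.
  by have := h n (leqnn n) => /=; rewrite sub0r normrN ger0_norm.
exists (X - c n *: X ^+ n.+1); first exact: step.
rewrite opprB addrC subrK (le_lt_trans _ ne)//.
apply: opnorm_le => [|x]; first by rewrite exprn_ge0 ?invr_ge0.
rewrite bopZ_E nrZ ger0_norm ?exprn_ge0 ?invr_ge0// ler_wpM2l ?exprn_ge0 ?invr_ge0//.
elim: n.+1 => [|m ih]; first by rewrite expr0 bop1_E.
by rewrite exprS bopM_E (le_trans _ ih)// (@psd_le1_nr _ _ ip ip_norm).
Qed.

Lemma quot_opnorm_lt1 (T : H -> H) : K T -> quot_opnorm ip N tau T < 1.
Proof.
move=> KT; apply: (@le_lt_trans _ _ 0) => //.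
have z : opnorm (T - T) = 0.
  apply/eqP; rewrite eq_le opnorm_ge0 andbT; apply: opnorm_le => // x.
  by rewrite subrr nr0 mul0r.
rewrite -z; apply: ge_inf; last by exists T.
by exists 0 => _ [V _ <-]; exact: opnorm_ge0.
Qed.

Section tau_calculus.
Variables (T : bop H) (mu : H -> {measure set (measurableTypeR R) -> \bar R}).
Hypotheses (sT : sym T) (NT : N T) (dmu : spectral_data ip T mu).

Let muT : total_mass ip mu. Proof. by have [] := dmu. Qed.

Lemma calculus_ex (f : R -> R) (M : R) :
  measurable_fun setT (f : measurableTypeR R -> R) ->
  (forall l, 0 <= f l) -> (forall l, f l <= M) ->
  exists S, [/\ psd S, bicomm T S & repr_fun ip mu f S].
Proof.
have [_ _ rep _] := dmu => mf f0 fM.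
exact: (repr_fun_ex ip_norm muT rep mf f0 fM).
Qed.

Lemma ray_tau (a t : R) E F : 0 < a -> N F -> proj F ->
  (tau (1 - F : bop H)%R <= t%:E)%E ->
  (forall v, nr (T (F v)) <= a / 2 * nr v) ->
  proj E -> bicomm T E -> repr_set ip mu `]a, +oo[%classic E ->
  (tau E <= (2 * t)%:E)%E.
Proof.
move=> a0 NF pF Ft TF pE bE aE; have [_ mu1 _ _] := dmu.
have ma : measurable (`]a, +oo[%classic : set (measurableTypeR R)).
  exact: measurable_itv.
apply: (@le_trans _ _ (2%:E * tau (1 - F : bop H)%R)%E).
  apply: (tau_proj_bound ip_norm vN tau_fns (T := T) (a := a) (b := a / 2)) => //.
  - exact: (N_bicomm vN NT bE).
  - by apply/esym; exact: bE.
  - move=> v Ev; apply: (conc_first_moment_ge muT mu1 ma).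
      exact: (repr_set_conc muT ma aE Ev).
    by move=> l; rewrite /= in_itv /= andbT => /ltW.
by rewrite EFinM lee_pmul2l.
Qed.

(* Slicing the half-line at the points x n, on each slice ]x (n+1), x n] the
   operator w(T) is at most c n times a projection of trace at most 2 t (n+1). *)
Lemma tau_calculus_lty (w : R -> R) W (x c t : nat -> R) (B C : R) :
  measurable_fun setT (w : measurableTypeR R -> R) ->
  (forall l, 0 <= w l) -> (forall l, w l <= B) -> (forall l, l <= 0 -> w l = 0) ->
  psd W -> bicomm T W -> repr_fun ip mu w W ->
  (forall n, 0 < x n) -> (forall n, x n.+1 <= x n) -> x n @[n --> \oo] --> (0 : R) ->
  (forall n, 0 <= c n) ->
  (forall n l, x n.+1 < l -> l <= x n -> w l <= c n) ->
  (forall n, exists F, [/\ N F, proj F, (tau (1 - F : bop H)%R <= (t n)%:E)%E &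
     forall v, nr (T (F v)) <= x n / 2 * nr v]) ->
  (forall n, \sum_(k < n) c k * (2 * t k.+1) <= C) ->
  (tau W < +oo)%E.
Proof.
move=> mw w0 wB wneg pW bW wW x0 xS xcv c0 wc fF sumC.
pose J n : set (measurableTypeR R) := `]x n, +oo[%classic.
have mJ n : measurable (J n) by exact: measurable_itv.
(* Since [w] vanishes on the nonpositive reals and [x n] tends to 0, these cut-offs increase to [w];
   normality then carries the bound on their traces over to [W]. *)
pose h n (l : measurableTypeR R) : R := w l * \1_(J n) l.
have mh n : measurable_fun setT (h n).
  by apply: measurable_funM => //; exact: measurable_indic.
have indic01 n l : 0 <= (\1_(J n) l : R) <= 1.
  by rewrite indicE; case: (l \in J n); rewrite ?lexx ?ler01.
have h0 n l : 0 <= h n l by rewrite mulr_ge0//; have /andP[] := indic01 n l.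
have hw n l : h n l <= w l.
  by rewrite -[leRHS]mulr1 ler_wpM2l//; have /andP[] := indic01 n l.
have hB n l : h n l <= B by rewrite (le_trans (hw n l)).
have xmono m n : (m <= n)%N -> x n <= x m.
  by move=> /subnK <-; elim: (n - m)%N => // k ih; rewrite addSn (le_trans (xS _)).
have /choice[V hV] : forall n, exists S, [/\ psd S, bicomm T S & repr_fun ip mu (h n) S].
  by move=> n; exact: calculus_ex (mh n) (h0 n) (hB n).
have pV n : psd (V n) by have [] := hV n.
have NV n : N (V n) by have [_ /(N_bicomm vN NT)] := hV n.
have Vr n : repr_fun ip mu (h n) (V n) by have [] := hV n.
have [_ mu1 rep _] := dmu.
have /choice[E hE] : forall n, exists F, [/\ proj F, bicomm T F & repr_set ip mu (J n) F].
  by move=> n; exact: rep.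
have pE n : proj (E n) by have [] := hE n.
have NE n : N (E n) by have [_ /(N_bicomm vN NT)] := hE n.
have tE n : (tau (E n) <= (2 * t n)%:E)%E.
  have [F [NF pF Ft TF]] := fF n; have [_ bEn JE] := hE n.
  exact: (ray_tau (x0 n) NF pF Ft TF (pE n) bEn JE).
have t0 n : 0 <= 2 * t n.
  by rewrite -lee_fin (le_trans _ (tE n))// (tau_ge0 tau_fns)//; exact: proj_psd.
have B0 : 0 <= B by rewrite (le_trans (w0 0)).
have indicE' n y : (\int[mu y]_l (\1_(J n) l)%:E = (<<E n y, y>>)%:E)%E.
  by rewrite integral_indic// setIT; have [_ _ ->] := hE n.
have mI n (k : R) : measurable_fun setT (fun l : measurableTypeR R => (k * \1_(J n) l)%:E).
  by apply/measurable_EFinP; apply: measurable_funM => //; exact: measurable_cst.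
have kI n (k : R) y : 0 <= k ->
    (\int[mu y]_l (k * \1_(J n) l)%:E = (k * <<E n y, y>>)%:E)%E.
  move=> k0; under eq_integral do rewrite EFinM.
  rewrite ge0_integralZl_EFin//.
  - by rewrite indicE' EFinM.
  - by apply/measurable_EFinP; exact: measurable_indic.
have V0 : (tau (V 0%N) <= (B * (2 * t 0%N))%:E)%E.
  rewrite EFinM (le_trans _ (lee_wpmul2l _ (tE 0%N)))// ?lee_fin//.
  rewrite -(tauZ tau_fns)//; last exact: proj_psd.
  apply: (tau_mono vN tau_fns) => //.
  - exact: (NZ vN).
  - by apply: psdZ => //; exact: proj_psd.
  - move=> y; rewrite bopZ_E drZl -lee_fin -Vr -kI//.
    apply: ge0_le_integral => //.
    + by move=> l _; rewrite lee_fin.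
    + exact/measurable_EFinP.
    + by move=> l _; rewrite lee_fin ler_wpM2r//; have /andP[] := indic01 0%N l.
have VS n : (tau (V n.+1) <= tau (V n) + (c n * (2 * t n.+1))%:E)%E.
  have pcE : psd ((c n)%:C *: E n.+1) by apply: psdZ => //; exact: proj_psd.
  have NcE : N ((c n)%:C *: E n.+1 : bop H) by exact: (NZ vN).
  apply: (@le_trans _ _ (tau (V n) + tau ((c n)%:C *: E n.+1 : bop H)%R)%E); last first.
    rewrite leeD2l// (tauZ tau_fns)//; last exact: proj_psd.
    by rewrite EFinM lee_wpmul2l// lee_fin.
  rewrite -(tauD tau_fns)//; apply: (tau_mono vN tau_fns) => //.
  - exact: (ND vN).
  - exact: psdD.
  - move=> y; rewrite bopD_E bopZ_E drDl drZl -lee_fin EFinD -!Vr -kI//.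
    rewrite -ge0_integralD//; first last.
    + by move=> l _; rewrite lee_fin mulr_ge0//; have /andP[] := indic01 n.+1 l.
    + exact/measurable_EFinP.
    + by move=> l _; rewrite lee_fin.
    apply: ge0_le_integral => //.
    + by move=> l _; rewrite lee_fin.
    + exact/measurable_EFinP.
    + by apply: emeasurable_funD => //; exact/measurable_EFinP.
    + move=> l _; rewrite -EFinD lee_fin /h !indicE !mem_setE.
      rewrite !in_itv /= !andbT; have [h1|h1] := ltP (x n.+1) l; last first.
        by rewrite !mulr0 addr0 mulr_ge0// ler0n.
      have [h2|h2] := ltP (x n) l; first by rewrite !mulr1 lerDl.
      by rewrite mulr0 add0r !mulr1 wc.
have Vb n : (tau (V n) <= (B * (2 * t 0%N) + \sum_(k < n) c k * (2 * t k.+1))%:E)%E.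
  elim: n => [|n ih]; first by rewrite big_ord0 addr0.
  by rewrite (le_trans (VS n))// big_ord_recr /= addrA EFinD leeD2r.
have Vmono m n y : (m <= n)%N -> <<V m y, y>> <= <<V n y, y>>.
  move=> mn; rewrite -lee_fin -!Vr; apply: ge0_le_integral => //.
  - by move=> l _; rewrite lee_fin.
  - exact/measurable_EFinP.
  - exact/measurable_EFinP.
  - move=> l _; rewrite lee_fin /h ler_wpM2l// !indicE !mem_setE !in_itv /= !andbT.
    rewrite ler_nat; case: (ltP (x m) l) => // xl.
    by rewrite (le_lt_trans (xmono _ _ mn) xl).
have cv : tau (V n) @[n --> \oo] --> tau W.
  apply: (tau_normal vN tau_fns) => //; first exact: (N_bicomm vN NT bW).
  move=> y.
  have cvh : (\int[mu y]_l (h n l)%:E @[n --> \oo] --> \int[mu y]_l (w l)%:E)%E.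
    have e : (fun l => (w l)%:E) = (fun l => limn (fun n => (h n l)%:E)).
      apply/funext => l; apply/esym/cvg_lim => //.
      apply: cvg_EFin; first exact: nearW.
      have [l0|l0] := leP l 0.
        rewrite (_ : (fun n => _) = fun=> 0); first by rewrite wneg//; exact: cvg_cst.
        by apply/funext => n /=; rewrite /h wneg// mul0r.
      apply: cvg_near_cst; move/cvgrPdist_lt: xcv => /(_ _ l0).
      apply: filterS => n /=; rewrite sub0r normrN gtr0_norm// => xl.
      by rewrite /h indicE mem_setE in_itv /= xl mulr1.
    rewrite e; apply: cvg_monotone_convergence => //.
    - by move=> n; exact/measurable_EFinP.
    - by move=> n l _; rewrite lee_fin.
    - move=> l _ m n mn; rewrite lee_fin /h ler_wpM2l// !indicE !mem_setE !in_itv /= !andbT.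
      rewrite ler_nat; case: (ltP (x m) l) => // xl.
      by rewrite (le_lt_trans (xmono _ _ mn) xl).
  rewrite wW in cvh.
  have e : (fun n => \int[mu y]_l (h n l)%:E)%E = (fun n => (<<V n y, y>>)%:E).
    by apply/funext => n; rewrite Vr.
  by rewrite e in cvh; move/fine_cvgP : cvh => [].
apply: (@le_lt_trans _ _ (B * (2 * t 0%N) + C)%:E); last by rewrite ltry.
have <- : limn (fun n => tau (V n)) = tau W by exact/cvg_lim.
apply: lime_le; first by apply/cvg_ex; exists (tau W).
by near=> n; rewrite (le_trans (Vb n))// lee_fin lerD2l.
Unshelve. all: by end_near. Qed.

End tau_calculus.
End ideal.

(** * Pairs of projections *)

Section projection_pair.
Context {R : realType} {H : completeNormedModType R[i]}.
Variable ip : {dot H for Num.conj}.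
Hypothesis ip_norm : forall x : H, `|x| ^+ 2 = ip x x.
Implicit Types S T E F X Y : bop H.

Local Notation "<< x , y >>" := (dr ip x y) (at level 2, format "<< x ,  y >>").
Local Notation sym := (sym ip).
Local Notation psd := (psd ip).
Local Notation proj := (proj ip).

(** The root of [T] commutes with [S], so the product is [S] conjugated by that root. *)
Lemma psdM S T : psd S -> psd T -> S * T = T * S -> psd (S * T).
Proof.
move=> pS pT ST; have [Y [pY YY bY]] := sqrt_ex ip_norm pT.
have YS : S * Y = Y * S by exact: bY.
by rewrite -YY mulrA YS; apply: psd_conj => //; exact: pY.1.
Qed.

Section pair.
Variables p q : bop H.
Hypotheses (pp : proj p) (pq : proj q).

Definition diff2 := (q - p) * (q - p).

Lemma diff2E : diff2 = q + p - q * p - p * q.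
Proof.
apply: bop_ext => x; apply: (@dr_ext _ _ ip) => y.
rewrite /diff2 !(bopM_E, bopD_E, bopN_E, bop_add, bop_opp).
by rewrite !(proj_idem _ pp) !(proj_idem _ pq) !drE; ring.
Qed.

Lemma diff2_l : q * diff2 = q - q * p * q.
Proof.
apply: bop_ext => x; apply: (@dr_ext _ _ ip) => y.
rewrite diff2E !(bopM_E, bopD_E, bopN_E, bop_add, bop_opp).
by rewrite !(proj_idem _ pq) !drE; ring.
Qed.

Lemma diff2_commr : diff2 * q = q * diff2.
Proof.
rewrite diff2_l; apply: bop_ext => x; apply: (@dr_ext _ _ ip) => y.
rewrite diff2E !(bopM_E, bopD_E, bopN_E, bop_add, bop_opp).
by rewrite !(proj_idem _ pq) !drE; ring.
Qed.

Lemma diff2_compl : q * (1 - diff2) = q * p * q.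
Proof. by rewrite mulrBr mulr1 diff2_l subKr. Qed.

(** As the square of a symmetric operator, [1 - diff2] is positive, and a vector fixed by [diff2] is
    killed by [1 - p - q] itself ([diff2_fix]). *)
Lemma diff2_sqr : 1 - diff2 = (1 - p - q) * (1 - p - q).
Proof.
apply: bop_ext => x; apply: (@dr_ext _ _ ip) => y.
rewrite diff2E !(bopM_E, bopD_E, bopN_E, bop1_E, bop_add, bop_opp).
by rewrite !(proj_idem _ pp) !(proj_idem _ pq) !drE; ring.
Qed.

Lemma sym_diff2 : sym diff2.
Proof.
have sD : sym (q - p) by apply: symB; [exact: pq.1|exact: pp.1].
by apply: symM.
Qed.

Lemma psd_diff2 : psd diff2.
Proof. by apply: psd_sqr; apply: symB; [exact: pq.1|exact: pp.1]. Qed.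

Lemma psd_diff2_compl : psd (1 - diff2).
Proof.
rewrite diff2_sqr; apply: psd_sqr; apply: symB; last exact: pq.1.
by apply: symB; [exact: sym1|exact: pp.1].
Qed.

(** The projection onto [ran q] intersected with [ker p]. The limit clause is part of the definition
    because normality of the trace is applied along these powers. *)
Definition meet_proj V := [/\ proj V, bicomm (q * diff2) V,
  forall x, V x = x <-> (q x = x /\ p x = 0) &
  scvg (fun n => (q * diff2) ^+ n) V].

(** [q * diff2] equals [q (1 - p) q], a positive contraction. A vector [x] fixed by it satisfies
    [q x = x], and equality of forms leaves [<<p x, x>> = 0]. *)
Lemma meet_proj_ex : exists V, meet_proj V.
Proof.
have qE : q * diff2 = q * (1 - p) * q.
  by rewrite diff2_l mulrBr mulr1 mulrBl pq.2.
have pQ : psd (q * diff2).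
  by rewrite qE; apply: psd_conj; [exact: pq.1|exact/proj_psd/proj_compl].
have Q1 x : <<(q * diff2) x, x>> <= <<x, x>>.
  rewrite qE !bopM_E pq.1 (le_trans (proj_le1 _ (proj_compl pp)))//.
  by rewrite -(proj_form x pq) proj_le1.
have [V [sV VV QV bV [fV cV]]] := pow_proj ip_norm pQ Q1.
exists V; split=> // x; split=> [Vx|[qx px]]; last first.
  by apply: fV; rewrite qE !bopM_E qx bopD_E bopN_E px subr0 bop1_E.
have Qx : (q * (1 - p) * q) x = x by rewrite -qE -Vx -bopM_E QV.
have qx : q x = x by rewrite -Qx !bopM_E (proj_idem _ pq).
split=> //; apply: (proj_form_eq0 pp).
have : <<(q * (1 - p) * q) x, x>> = <<x, x>> by rewrite Qx.
by rewrite !bopM_E qx pq.1 qx bopD_E bopN_E bop1_E drDl drNl; lra.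
Qed.

End pair.

Lemma diff2C p q : diff2 q p = diff2 p q.
Proof. by rewrite /diff2 -(opprB q p) mulrNN. Qed.

Lemma diff2_comml p q : proj p -> proj q -> diff2 p q * p = p * diff2 p q.
Proof. by move=> pp pq; rewrite -diff2C diff2_commr. Qed.

Variables (N : set (H -> H)) (tau : (H -> H) -> \bar R).
Hypothesis vN : von_neumann_algebra ip N.
Hypothesis tau_fns : fns_trace ip N tau.

(** Infinite values need no exclusion, as [fine] sends them to 0. *)
Lemma fineZ (c : R) (y : \bar R) : fine (c%:E * y)%E = c * fine y.
Proof.
case: y => [r| |] //=; rewrite mulr0.
  have [c0|c0|->] := ltgtP c 0; last by rewrite mul0e.
    by rewrite lt0_muley ?lte_fin.
  by rewrite gt0_muley ?lte_fin.
have [c0|c0|->] := ltgtP c 0; last by rewrite mul0e.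
  by rewrite lt0_muleNy ?lte_fin.
by rewrite gt0_muleNy ?lte_fin.
Qed.

(** [W X <= W], because [W (1 - X)] is a product of commuting positive operators. *)
Lemma trace_psdM_lty (W X : bop H) : N W -> psd W -> (tau W < +oo)%E -> N X -> psd X ->
  (forall x, <<X x, x>> <= <<x, x>>) -> X * W = W * X ->
  [/\ N (W * X : bop H), psd (W * X) & tau (W * X : bop H) \is a fin_num].
Proof.
move=> NW pW fW NX pX X1 XW.
have NWX : N (W * X : bop H) by exact: (NM vN).
have pWX : psd (W * X) by exact: psdM.
split=> //; rewrite ge0_fin_numE ?(tau_ge0 tau_fns)//.
rewrite (le_lt_trans _ fW)//; apply: (tau_mono vN tau_fns) => // x.
have pX' : psd (1 - X).
  split=> [|y]; first by apply: symB; [exact: sym1|exact: pX.1].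
  by rewrite bopD_E bopN_E bop1_E drDl drNl subr_ge0.
have := (psdM pW pX' _).2 x; rewrite mulrBr mulr1 mulrBl mul1r XW => /(_ erefl).
by rewrite bopD_E bopN_E drDl drNl subr_ge0.
Qed.

(** * The trace of [W (q - p)] when [W] is a positive operator of finite trace *)

Section trace_limit.
Variables p q W V : bop H.
Hypotheses (pp : proj p) (pq : proj q) (Np : N p) (Nq : N q).
Hypotheses (pW : psd W) (bW : bicomm (diff2 p q) W) (fW : (tau W < +oo)%E).
Hypothesis hV : meet_proj p q V.

Let A : bop H := diff2 p q.
Let NA : N A. Proof. by apply: (NM vN); apply: (NB vN). Qed.
Let NW : N W. Proof. exact: (N_bicomm vN NA bW). Qed.
Let qA : A * q = q * A. Proof. exact: diff2_commr. Qed.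
Let pA : A * p = p * A. Proof. exact: diff2_comml. Qed.
Let qW : q * W = W * q. Proof. by apply: bW; rewrite qA. Qed.
Let pWc : p * W = W * p. Proof. by apply: bW; rewrite pA. Qed.
Let AW : A * W = W * A. Proof. by apply: bW. Qed.

Let Q : bop H := q * A.
Let pQ : psd Q. Proof. by apply: psdM; [exact: proj_psd|exact: psd_diff2|rewrite qA]. Qed.
Let NQ : N Q. Proof. exact: (NM vN). Qed.
Let Qn n : Q ^+ n.+1 = q * A ^+ n.+1.
Proof.
rewrite /Q exprMn_comm; last by rewrite /GRing.comm qA.
congr (_ * _); elim: n => [|n ih]; first by rewrite expr1.
by rewrite exprS ih pq.2.
Qed.
Let Q1 x : <<Q x, x>> <= <<x, x>>.
Proof.
have : psd (q * (1 - A)).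
  apply: psdM; [exact: proj_psd|exact: psd_diff2_compl|].
  by rewrite mulrBr mulrBl mulr1 mul1r qA.
move=> [_ /(_ x)]; rewrite mulrBr mulr1 bopD_E bopN_E drDl drNl subr_ge0.
by move=> /le_trans; apply; exact: proj_le1.
Qed.
Let WQ : Q * W = W * Q. Proof. by rewrite /Q -mulrA AW mulrA qW mulrA. Qed.
Let WQX n : Q ^+ n * W = W * Q ^+ n. Proof. by apply/esym; apply: commrX; apply/esym. Qed.
Let decr (n : nat) (x : H) : <<(Q ^+ n.+1) x, x>> <= <<(Q ^+ n) x, x>>.
Proof.
have pQ' : psd (1 - Q).
  split=> [|y]; first by apply: symB; [exact: sym1|exact: pQ.1].
  by rewrite bopD_E bopN_E bop1_E drDl drNl subr_ge0.
have := (psdM (psdX n pQ) pQ' _).2 x.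
rewrite mulrBr mulr1 mulrBl mul1r -exprS -exprSr => /(_ erefl).
by rewrite bopD_E bopN_E drDl drNl subr_ge0.
Qed.
Let Qle1 (n : nat) (x : H) : <<(Q ^+ n) x, x>> <= <<x, x>>.
Proof.
elim: n => [|n ih]; first by rewrite expr0 bop1_E.
by rewrite (le_trans (decr n x)).
Qed.
Let fin n : [/\ N (W * Q ^+ n : bop H), psd (W * Q ^+ n) &
  tau (W * Q ^+ n : bop H) \is a fin_num].
Proof.
apply: (trace_psdM_lty NW pW fW); [exact: (N_exp vN)|exact: psdX|exact: Qle1|exact: WQX].
Qed.

(** Normality along the decreasing sequence [W (q A)^n]. Exponents start at 1, because [(q A)^0] is
    1 and not [q]. *)
Lemma trace_meet_cvg :
  fine (tau (W * (q * A ^+ n.+1) : bop H)) @[n --> \oo] --> fine (tau (W * V : bop H)).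
Proof.
have [pV bV _ cV] := hV.
have NV : N V by exact: (N_bicomm vN NQ bV).
have VW : V * W = W * V by apply/esym/bV; rewrite -WQ.
under eq_fun do rewrite -Qn.
apply: (tau_normal_decr vN tau_fns).
- by move=> n; have [] := fin n.+1.
- by move=> n; have [] := fin n.+1.
- move=> m n x /subnK <-; elim: (n - m)%N => // k ih.
  rewrite addSn (le_trans _ ih)//.
  have [Y [pY YY bY]] := sqrt_ex ip_norm pW.
  have YQ k' : Q ^+ k' * Y = Y * Q ^+ k' by apply: bY; exact: WQX.
  have e k' : <<(W * Q ^+ k') x, x>> = <<(Q ^+ k') (Y x), Y x>>.
    by rewrite -YY -mulrA -YQ !bopM_E pY.1.
  by rewrite !e decr.
- exact: (NM vN).
- by apply: psdM => //; exact: proj_psd.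
- move=> x; apply: (scvg_form ip_norm (x := x)).
  by apply: scvgMl; exact: (scvg_shift cV).
- have [_ _ f] := fin 1; by rewrite -ge0_fin_numE// (tau_ge0 tau_fns)//; have [] := fin 1.
Qed.

(* tau (T^* T) = tau (T T^* ) for T = p q sqrt (W A^n). *)
Lemma trace_step n : exists2 r : \bar R, r \is a fin_num &
  (tau (W * (q * A ^+ n) : bop H)%R = tau (W * (q * A ^+ n.+1) : bop H)%R + r)%E /\
  (tau (W * (p * A ^+ n) : bop H)%R = tau (W * (p * A ^+ n.+1) : bop H)%R + r)%E.
Proof.
have AnW : A ^+ n * W = W * A ^+ n by apply/esym; apply: commrX; apply/esym.
have qAn : A ^+ n * q = q * A ^+ n by apply/esym; apply: commrX; apply/esym.
have AAn : A * A ^+ n = A ^+ n * A by apply: commrX.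
have pAn : A ^+ n * p = p * A ^+ n by apply/esym; apply: commrX; apply/esym.
pose W' : bop H := W * A ^+ n.
have pAn' : psd (A ^+ n) by apply: psdX; exact: psd_diff2.
have pW' : psd W' by exact: psdM.
have NW' : N W' by apply: (NM vN) => //; exact: (N_exp vN).
have qW' : q * W' = W' * q by rewrite /W' mulrA qW -!mulrA qAn.
have pW'c : p * W' = W' * p by rewrite /W' mulrA pWc -!mulrA pAn.
have AW' : A * W' = W' * A by rewrite /W' mulrA AW -mulrA AAn mulrA.
have [Y [pY YY bY]] := sqrt_ex ip_norm pW'.
have NY : N Y by exact: (N_bicomm vN NW').
have Yq : q * Y = Y * q by exact: bY.
have Yp : p * Y = Y * p by exact: bY.
have tE : tau (W' * (q * p * q) : bop H)%R = tau (W' * (p * q * p) : bop H)%R.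
  have e1 : (Y * q * p) * (p * q * Y) = W' * (q * p * q).
    rewrite !mulrA -(mulrA _ p p) pp.2 -(mulrA _ q Y) Yq -YY.
    by rewrite mulrA -(mulrA _ p Y) Yp mulrA -(mulrA Y q) Yq !mulrA.
  have e2 : (p * q * Y) * (Y * q * p) = W' * (p * q * p).
    rewrite -!mulrA [Y * (Y * _)]mulrA YY [q * (W' * _)]mulrA qW' -mulrA.
    by rewrite [q * (q * _)]mulrA pq.2 [p * (W' * _)]mulrA pW'c !mulrA.
  rewrite -e1 -e2; apply: (tauC tau_fns).
  - by do 2?apply: (NM vN).
  - by do 2?apply: (NM vN).
  - by move=> x y; rewrite !bopM_E pp.1 pq.1 pY.1.
(* One computation for both projections: [z (1 - A) = z w z] splits [W z A^n] into [W z A^(n+1)] and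
   [W' z w z]; the second summand is dominated by [W], so its trace is finite. *)
have part (z w : bop H) : N z -> proj z -> proj w -> N w -> z * W = W * z -> A * z = z * A ->
    z * (1 - A) = z * w * z ->
   [/\ N (W' * (z * w * z) : bop H), psd (W' * (z * w * z)) ,
    tau (W' * (z * w * z) : bop H)%R \is a fin_num &
   (tau (W * (z * A ^+ n) : bop H)%R =
     tau (W * (z * A ^+ n.+1) : bop H)%R + tau (W' * (z * w * z) : bop H)%R)%E].
  move=> Nz pz pw Nw zW zA zwz.
  have zAk k : z * A ^+ k = A ^+ k * z by apply: commrX; apply/esym.
  have pzwz : psd (z * w * z) by apply: psd_conj; [exact: pz.1|exact: proj_psd].
  have zW' : z * W' = W' * z by rewrite /W' mulrA zW -!mulrA zAk.
  have e : W * (z * A ^+ n) = W * (z * A ^+ n.+1) + W' * (z * w * z).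
    rewrite -zwz /W' mulrBr mulr1 mulrBr -!mulrA -!zAk.
    by rewrite [A ^+ n * (z * A)]mulrA -zAk -mulrA -exprSr addrC subrK.
  have NAk k : N (A ^+ k : bop H) by exact: (N_exp vN).
  have pAk k : psd (A ^+ k) by apply: psdX; exact: psd_diff2.
  have AkW k : A ^+ k * W = W * A ^+ k by apply/esym; apply: commrX; apply/esym.
  have p1 : psd (W' * (z * w * z)).
    apply: psdM => //; rewrite -zwz mulrBr mulr1 mulrBl mulrBr zW'; congr (_ - _).
    by rewrite -[RHS]mulrA AW' [RHS]mulrA zW' -[RHS]mulrA.
  have N1' : N (W' * (z * w * z) : bop H) by do 3?apply: (NM vN).
  have N2 : N (W * (z * A ^+ n.+1) : bop H) by do 2?apply: (NM vN).
  have pzA k : psd (z * A ^+ k) by apply: psdM; [exact: proj_psd|exact: pAk|exact: zAk].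
  have zAW k : (z * A ^+ k) * W = W * (z * A ^+ k).
    by rewrite -mulrA AkW mulrA zW mulrA.
  have p2 : psd (W * (z * A ^+ n.+1)) by exact: psdM.
  have tot := tauD tau_fns N2 p2 N1' p1; rewrite -e in tot.
  split=> //.
  rewrite ge0_fin_numE ?(tau_ge0 tau_fns)// (le_lt_trans _ fW)//.
  apply: (tau_mono vN tau_fns) => // x.
  have [Z [pZ ZZ bZ]] := sqrt_ex ip_norm pW.
  have le1 : <<(A ^+ n * (z * w * z)) (Z x), Z x>> <= <<Z x, Z x>>.
    rewrite -zwz mulrBr mulr1 mulrBr [A ^+ n * (z * A)]mulrA -!zAk -[z * A ^+ n * A]mulrA -exprSr.
    have := (pzA n.+1).2 (Z x); rewrite bopD_E bopN_E drDl drNl.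
    have : <<(z * A ^+ n) (Z x), Z x>> <= <<Z x, Z x>>; last lra.
    have zA1 k : <<(z * A ^+ k) (Z x), Z x>> <= <<z (Z x), Z x>>.
      elim: k => [|k ih]; first by rewrite expr0 mulr1.
      rewrite (le_trans _ ih)//.
      have pAA : psd (1 - A) by exact: psd_diff2_compl.
      have := (psdM (pzA k) pAA _).2 (Z x).
      rewrite mulrBr mulr1 mulrBl mul1r -mulrA -exprSr mulrA zA -mulrA -exprS => /(_ erefl).
      by rewrite bopD_E bopN_E drDl drNl subr_ge0.
    by rewrite (le_trans (zA1 n))// proj_le1.
  have BZ : A ^+ n * (z * w * z) * Z = Z * (A ^+ n * (z * w * z)).
    apply: bZ; rewrite -zwz mulrBr mulr1 mulrBr [A ^+ n * (z * A)]mulrA -!zAk.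
    by rewrite -[z * A ^+ n * A]mulrA -exprSr mulrBl mulrBr !zAW.
  have -> : <<(W' * (z * w * z)) x, x>> = <<(A ^+ n * (z * w * z)) (Z x), Z x>>.
    by rewrite /W' -mulrA -ZZ -mulrA -BZ !bopM_E pZ.1.
  by rewrite (le_trans le1)// -ZZ bopM_E [leRHS]pZ.1.
have [_ _ fq eq_] := part q p Nq pq pp Np qW qA (diff2_compl pp pq).
have [_ _ fp ep] : [/\ N (W' * (p * q * p) : bop H), psd (W' * (p * q * p)) ,
    tau (W' * (p * q * p) : bop H)%R \is a fin_num &
   (tau (W * (p * A ^+ n) : bop H)%R =
     tau (W * (p * A ^+ n.+1) : bop H)%R + tau (W' * (p * q * p) : bop H)%R)%E].
  by apply: part => //; rewrite /A -diff2C diff2_compl.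
by exists (tau (W' * (q * p * q) : bop H)%R) => //; split; [exact: eq_|rewrite tE; exact: ep].
Qed.

Lemma trace_qAn_fin n : tau (W * (q * A ^+ n) : bop H) \is a fin_num.
Proof.
case: n => [|n]; last by rewrite -Qn; have [] := fin n.+1.
rewrite expr0 mulr1.
by have [] := trace_psdM_lty NW pW fW Nq (proj_psd pq) (fun x => proj_le1 x pq) qW.
Qed.

(** [A] is 1 on the range of [V], so the form of [W] there is [lam] times the norm squared and
    [W V = lam V]. *)
Lemma trace_meet_eigen (lam : R) :
  (forall x, A x = x -> <<W x, x>> = lam * <<x, x>>) ->
  fine (tau (W * V : bop H)) = lam * fine (tau V).
Proof.
move=> eig; have [pV bV fV _] := hV.
have VW : V * W = W * V by apply/esym/bV; rewrite -WQ.
have NV : N V by exact: (N_bicomm vN NQ bV).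
have Ax x : V x = x -> A x = x.
  move=> /fV[qx px]; rewrite /A /diff2E (diff2E pp pq).
  have -> : (q + p - q * p - p * q) x = q x + p x - q (p x) - p (q x) by [].
  by rewrite qx px bop_zero !subr0 addr0.
have -> : W * V = lam%:C *: V.
  apply: (sym_ext (ip := ip)).
  - by apply: symM => //; [exact: pW.1|exact: pV.1].
  - by apply: symZ; exact: pV.1.
  move=> x; have VVx : V (V x) = V x by exact: (proj_idem _ pV).
  have -> : <<(W * V) x, x>> = <<W (V x), V x>>.
    by rewrite -VW bopM_E -[in RHS]bopM_E -VW bopM_E -pV.1 (proj_idem _ pV).
  by rewrite (eig _ (Ax _ VVx)) bopZ_E drZl (proj_form x pV).
have [l0|l0] := leP 0 lam.
  by rewrite (tauZ tau_fns)// ?fineZ//; exact: proj_psd.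
(* [tauZ] requires a nonnegative scalar; for negative [lam] the positivity of [W] leaves only this
   case. *)
have V0 : V = 0.
  apply: bop_ext => x; rewrite bop0_E; have VVx := proj_idem x pV.
  apply: (@dr_le0 _ _ ip); have := pW.2 (V x); rewrite (eig _ (Ax _ VVx)).
  by rewrite nmulr_rge0.
by rewrite V0 scaler0 (tau0 vN tau_fns) mulr0.
Qed.

End trace_limit.

(** [trace_step] lowers both traces by the same [r], so their difference at exponent 0 equals its
    limit. The second limit comes from exchanging [p] and [q], which leaves [diff2] unchanged. *)
Lemma trace_meet_diff p q W V V' (lam : R) :
  proj p -> proj q -> N p -> N q -> psd W -> bicomm (diff2 p q) W ->
  (tau W < +oo)%E -> meet_proj p q V -> meet_proj q p V' ->
  (forall x, diff2 p q x = x -> <<W x, x>> = lam * <<x, x>>) ->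
  fine (tau (W * q : bop H)) - fine (tau (W * p : bop H)) =
    lam * (fine (tau V) - fine (tau V')).
Proof.
move=> pp pq Np Nq pW bW fW hV hV' eig.
have bW' : bicomm (diff2 q p) W by rewrite diff2C.
have eig' x : diff2 q p x = x -> <<W x, x>> = lam * <<x, x>> by rewrite diff2C; exact: eig.
pose f (z : bop H) n := fine (tau (W * (z * diff2 p q ^+ n) : bop H)).
have fq n : tau (W * (q * diff2 p q ^+ n) : bop H) \is a fin_num by exact: trace_qAn_fin.
have fp n : tau (W * (p * diff2 p q ^+ n) : bop H) \is a fin_num.
  by rewrite -diff2C; exact: trace_qAn_fin.
have step n : f q n - f p n = f q 0%N - f p 0%N.
  elim: n => // n <-; rewrite /f.
  have [r fr [-> ->]] := trace_step pp pq Np Nq pW bW fW n.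
  by rewrite !fineD//; ring.
have cq : f q n.+1 @[n --> \oo] --> fine (tau (W * V : bop H)) by exact: trace_meet_cvg.
have cp : f p n.+1 @[n --> \oo] --> fine (tau (W * V' : bop H)).
  by rewrite /f -diff2C; exact: trace_meet_cvg.
have c : f q n.+1 - f p n.+1 @[n --> \oo] -->
    fine (tau (W * V : bop H)) - fine (tau (W * V' : bop H)) by exact: cvgB.
have c0 : f q n.+1 - f p n.+1 @[n --> \oo] --> f q 0%N - f p 0%N.
  by under eq_fun do rewrite step; exact: cvg_cst.
have := cvg_unique _ c c0; rewrite /f expr0 !mulr1 => <- //.
rewrite (trace_meet_eigen pp pq Np Nq pW bW hV eig).
by rewrite (trace_meet_eigen pq pp Nq Np pW bW' hV' eig') mulrBr.
Qed.

(** Independence of the decomposition chosen by [trace_ext]: [X - Y] is symmetric, so the skew part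
    [C - D] of another decomposition vanishes, and [X + B = A + Y] is an identity between sums of
    positive elements of finite trace. *)
Lemma trace_ext_diff X Y : N X -> psd X -> (tau X < +oo)%E -> N Y -> psd Y ->
  (tau Y < +oo)%E -> finite_trace ip N tau (X - Y : bop H) /\
  trace_ext ip N tau (X - Y : bop H) = (fine (tau X) - fine (tau Y))%:C.
Proof.
move=> NX pX fX NY pY fY.
have fin (Z : bop H) : N Z -> psd Z -> (tau Z < +oo)%E -> finite_pos ip N tau Z.
  by move=> NZ pZ fZ; split=> //; apply/cone_psd.
have dXY : trace_decomp ip N tau (X - Y : bop H) X Y (0 : bop H) (0 : bop H).
  split; try exact: fin; try exact: (finite_pos0 vN tau_fns).
  by rewrite subrr scaler0 addr0.
split; first by exists X, Y, (0 : bop H), (0 : bop H).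
rewrite /trace_ext.
case: xgetP => [c _ [A [B [C [D [[fA fB fC fD e] ->]]]]]|/(_ (fine (tau X) - fine (tau Y))%:C)[]]; last first.
  exists X, Y, (0 : bop H), (0 : bop H); split => //.
  by rewrite (tau0 vN tau_fns) subrr.
have bp Z : finite_pos ip N tau Z -> exists Z' : bop H,
    [/\ Z = Z' :> (H -> H), N Z', psd Z' & tau Z' \is a fin_num].
  case=> cZ fZ; have [Z' [eZ NZ pZ]] := cone_bop vN cZ.
  exists Z'; split=> //; move: fZ; rewrite -eZ => fZ.
  by rewrite ge0_fin_numE ?(tau_ge0 tau_fns).
have [A' [eA NA pA fA']] := bp _ fA; have [B' [eB NB' pB fB']] := bp _ fB.
have [C' [eC NC pC fC']] := bp _ fC; have [D' [eD ND' pD fD']] := bp _ fD.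
rewrite {}eA {}eB {}eC {}eD in e *.
have e' : X - Y = A' - B' + 'i *: (C' - D').
  by apply: bop_ext => x; rewrite -[LHS]/((X - Y : H -> H) x) e.
have im0 S x : sym S -> << 'i *: S x, x>> = 0.
  move=> sS.
  have e1 : << - 'i *: S x, x>> = << - 'i *: x, S x>> by rewrite -bop_scale sS.
  move: e1; rewrite -!ip_im [ip x _]ipC; case E : (ip (S x) x) => [a b] /= e1.
  have : << - 'i *: S x, x>> = 0 by rewrite -ip_im E /=; lra.
  by rewrite scaleNr drNl => /eqP; rewrite oppr_eq0 => /eqP.
have sAB : sym (A' - B') by apply: symB; [exact: pA.1|exact: pB.1].
have sCD : sym (C' - D') by apply: symB; [exact: pC.1|exact: pD.1].
have sXY : sym (X - Y) by apply: symB; [exact: pX.1|exact: pY.1].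
have e1 : X - Y = A' - B'.
  by apply: (sym_ext (ip := ip)) => // x; rewrite e' bopD_E bopZ_E drDl im0// addr0.
have e2 : C' = D'.
  apply/subr0_eq/(scalerI (a := 'i)); first by rewrite eq_complex /= oner_eq0 andbF.
  by rewrite scaler0; apply: (addrI (A' - B')); rewrite -e' addr0.
have e3 : X + B' = A' + Y by apply/eqP; rewrite -subr_eq addrAC e1 subrK.
have e4 : (tau X + tau B' = tau A' + tau Y)%E.
  by rewrite -!(tauD tau_fns)// e3.
have fX' : tau X \is a fin_num by rewrite ge0_fin_numE ?(tau_ge0 tau_fns).
have fY' : tau Y \is a fin_num by rewrite ge0_fin_numE ?(tau_ge0 tau_fns).
move/(congr1 fine): e4; rewrite !fineD// e2 subrr => e4.
by congr (_ +i* _); lra.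
Qed.

End projection_pair.

(** * The weight *)

Lemma ler_powRN {R : realType} (a x y : R) : 0 <= a -> 0 < x -> x <= y ->
  y `^ (- a) <= x `^ (- a).
Proof.
move=> a0 x0 xy; have y0 := lt_le_trans x0 xy.
by rewrite !powRN lef_pV2 ?posrE ?powR_gt0// ge0_ler_powR// nnegrE ltW.
Qed.

Lemma ltr_powRN {R : realType} (a x y : R) : 0 < a -> 0 < x -> x < y ->
  y `^ (- a) < x `^ (- a).
Proof.
move=> a0 x0 xy; have y0 := lt_trans x0 xy.
by rewrite !powRN ltf_pV2 ?posrE ?powR_gt0// gt0_ltr_powR// nnegrE ltW.
Qed.

Section weight.
Context {R : realType}.
Variables r q : R.
Hypotheses (r0 : 0 <= r) (q0 : 0 < q).
Local Notation w := (weight r q).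
Local Notation mu := lebesgue_measure.

Lemma weight_ge0 x : 0 <= w x.
Proof. by rewrite /weight; case: ifP => // _; rewrite mulr_ge0 ?powR_ge0 ?expR_ge0. Qed.

Lemma weight_npos x : x <= 0 -> w x = 0.
Proof. by rewrite /weight ltNge => ->. Qed.

(* With y = x^(-1/q): x^(-a) = y^(qa) <= 1 + y^(n+1) for some n, and a power of y
   is bounded by a multiple of e^(y/2). *)
Lemma powRN_le_expR a : 0 <= a -> exists2 M, 0 < M &
  forall x, 0 < x -> x `^ (- a) <= M * expR (x `^ (- q^-1) / 2).
Proof.
move=> a0; have [n hn] : exists n : nat, a * q <= n.+1%:R.
  exists (Num.truncn (a * q)).
  by rewrite ltW// truncnS_gt// mulr_ge0// ltW.
exists (1 + 2 ^+ n.+1 * n.+1`!%:R) => [|x x0].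
  by rewrite ltr_pwDl// mulr_ge0// exprn_ge0.
set y := x `^ (- q^-1).
have y0 : 0 < y by rewrite powR_gt0.
have -> : x `^ (- a) = y `^ (a * q).
  by rewrite /y -powRrM; congr (_ `^ _); field; rewrite gt_eqF.
have e1 : 1 <= expR (y / 2) by rewrite -expR0 ler_expR divr_ge0// ltW.
rewrite mulrDl mul1r; have [y1|/ltW y1] := leP y 1.
  rewrite (@le_trans _ _ 1)//; last first.
    by rewrite ler_wpDr// !mulr_ge0// ?exprn_ge0// expR_ge0.
  by rewrite -[leRHS](powRr0 y) ger_powR ?y0// mulr_ge0// ltW.
rewrite (le_trans (ler_powR y1 hn))// powR_mulrn ?(ltW y0)// ler_wpDl ?expR_ge0//.
have y2 : 0 <= y / 2 by rewrite divr_ge0// ltW.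
have h : (y / 2) ^+ n.+1 / n.+1`!%:R <= expR (y / 2).
  by rewrite (le_trans _ (expR_ge1Dxn n y2))// lerDr.
rewrite -{1}[y](@divfK _ 2)// exprMn mulrC -mulrA ler_pM2l ?exprn_gt0//.
by rewrite [leRHS]mulrC -ler_pdivrMr.
Qed.

(** Half of the exponent absorbs the power [x^(-r)]; the other half is the decay that remains. *)
Lemma weight_le_expR : exists2 M, 0 < M &
  forall x, 0 < x -> w x <= M * expR (- (x `^ (- q^-1) / 2)).
Proof.
have [M M0 hM] := powRN_le_expR r0; exists M => // x x0; rewrite /weight x0.
rewrite [in leLHS](_ : - x `^ _ = - (x `^ (- q^-1) / 2) - x `^ (- q^-1) / 2); last by lra.
rewrite expRD mulrA ler_wpM2r ?expR_ge0// expRN.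
by rewrite ler_pdivrMr ?expR_gt0// hM.
Qed.

(** Gives continuity at 0. It is [powRN_le_expR] for the exponent [r + 1], the additional power
    being the factor [x]. *)
Lemma weight_le_lin : exists2 M, 0 < M & forall x, 0 < x -> w x <= M * x.
Proof.
have [M M0 hM] := powRN_le_expR (addr_ge0 r0 ler01); exists M => // x x0.
rewrite /weight x0.
have -> : x `^ (- r) = x `^ (- (r + 1)) * x.
  rewrite -[X in _ * X](powRr1 (ltW x0)) -powRD; last by rewrite (gt_eqF x0) implybT.
  by rewrite opprD -addrA addNr addr0.
rewrite mulrAC ler_pM2r//.
rewrite (le_trans (ler_wpM2r (expR_ge0 _) (hM x x0)))// -mulrA -expRD.
rewrite -[leRHS]mulr1 ler_pM2l// -[leRHS]expR0 ler_expR.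
by have := powR_ge0 x (- q^-1); lra.
Qed.

Lemma weight_le_cst : exists2 M, 0 < M & forall x, w x <= M.
Proof.
have [M M0 hM] := weight_le_expR; exists M => // x.
have [x0|x0] := leP x 0; first by rewrite weight_npos// ltW.
rewrite (le_trans (hM x x0))// -[leRHS]mulr1 ler_pM2l// -[leRHS]expR0 ler_expR.
by have := powR_ge0 x (- q^-1); lra.
Qed.

Lemma continuous_powRl a (x : R) : 0 < x -> {for x, continuous (fun y => y `^ a)}.
Proof.
move=> x0; apply: differentiable_continuous; apply/derivable1_diffP.
exact: (@ex_derive _ _ _ _ _ _ _ (is_derive1_powR a x0)).
Qed.

Lemma continuous_weight : continuous (w : R -> R).
Proof.
move=> x; have [x0|x0|->] := ltgtP x 0.
- apply: (@near_cst_continuous _ _ 0); near=> y; apply: weight_npos.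
  by apply/ltW; near: y; exact: lt_nbhsl.
- have : {for x, continuous (fun y => y `^ (- r) * expR (- (y `^ (- q^-1))))}.
    apply: continuousM; first exact: continuous_powRl.
    apply: (continuous_comp (f := fun y => - (y `^ (- q^-1)))); last exact: continuous_expR.
    by apply: continuousN; exact: continuous_powRl.
  rewrite /continuous_at /= => h; rewrite {2}/weight x0.
  apply: cvg_trans h; apply: near_eq_cvg; near=> y.
  have y0 : 0 < y by near: y; exact: lt_nbhsr.
  by rewrite /weight y0.
- have [M M0 hM] := weight_le_lin.
  rewrite /continuous_at weight_npos//; apply/cvgrPdist_lt => e e0.
  near=> y; rewrite sub0r normrN ger0_norm ?weight_ge0//.
  have [y0|y0] := leP y 0; first by rewrite weight_npos.
  rewrite (le_lt_trans (hM y y0))// mulrC -ltr_pdivlMr//.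
  near: y; apply: lt_nbhsl; exact: divr_gt0.
Unshelve. all: by end_near. Qed.

Lemma measurable_weight : measurable_fun setT (w : measurableTypeR R -> R).
Proof. exact: continuous_measurable_fun continuous_weight. Qed.

Lemma quadratic_continuous (a b c : R) : continuous (fun u : R => a + b * u + c * u ^+ 2).
Proof.
move=> u; apply: cvgD; first (apply: cvgD; first exact: cvg_cst).
  by apply: cvgM; [exact: cvg_cst|exact: cvg_id].
by apply: cvgM; [exact: cvg_cst|exact: exprn_continuous].
Qed.

Lemma continuous_weight_quadratic (a b c : R) :
  continuous (fun u : R => w (a + b * u + c * u ^+ 2)).
Proof.
move=> u; apply: (@continuous_comp _ _ _ (fun u : R => a + b * u + c * u ^+ 2) w).
  exact: quadratic_continuous.
exact: continuous_weight.
Qed.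

Let G (u : R) : R := w (1 - u ^+ 2).
Let cG : continuous (G : R -> R).
Proof.
have -> : G = (fun u => w (1 + 0 * u + (-1) * u ^+ 2)).
  by apply/funext => u; rewrite /G /= mul0r addr0 mulN1r.
exact: continuous_weight_quadratic.
Qed.

Let sub (t : R) : 1 - (2 * t - 1) ^+ 2 = 4 * t * (1 - t). Proof. by ring. Qed.

Lemma integrable_weight : mu.-integrable `[0, 1] (fun t => (2 * w (4 * t * (1 - t)))%:E).
Proof.
apply: continuous_compact_integrable; first exact: segment_compact.
apply: continuous_subspaceT.
have -> : (fun t => 2 * w (4 * t * (1 - t))) = (fun t => 2 * w (0 + 4 * t + (-4) * t ^+ 2)).
  by apply/funext => s /=; congr (_ * w _); ring.
have c := @continuous_weight_quadratic 0 4 (-4).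
by move=> t; apply: cvgM; [exact: cvg_cst|exact: c].
Qed.

Lemma Rintegral_weight : Rintegral mu `[0, 1] (fun t => 2 * w (4 * t * (1 - t))) = Crq r q.
Proof.
pose F (t : R) : R := 2 * t - 1.
have iF (t : R) : is_derive t (1 : R) F 2.
  have -> : F = (2 *: id - cst 1)%R by [].
  by apply: is_derive_eq; rewrite subr0 scaler1.
have dF : derive1 F = cst 2 by apply/funext => t; rewrite derive1E; apply: derive_val.
have cF : continuous F.
  by move=> t; apply/differentiable_continuous/derivable1_diffP.
have := @integration_by_substitution_increasing R F G 0 1 ler01.
have F0 : F 0 = -1 by rewrite /F mulr0 sub0r.
have F1 : F 1 = 1 by rewrite /F; ring.
rewrite F0 F1 dF /Crq /Rintegral => ->.
- congr fine; apply: eq_integral => t _; congr EFin.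
  by rewrite -[RHS]/(w (1 - (2 * t - 1) ^+ 2) * 2) sub mulrC.
- by move=> x y _ _ xy; rewrite /F; lra.
- by move=> x _; exact: cst_continuous.
- exact: is_cvg_cst.
- exact: is_cvg_cst.
- by split=> [x _||] //; [apply: cvg_at_right_filter|apply: cvg_at_left_filter]; exact: cF.
- by apply: continuous_subspaceT; exact: cG.
Qed.

Lemma Crq_gt0 : 0 < Crq r q.
Proof.
(* A lower bound for the integrand on [[-1/2, 1/2]], an interval of length 1: there [1 - u^2] lies
   between 3/4 and 1, so its power [-r] is at least 1. *)
set m := expR (- ((3 / 4) `^ (- q^-1))).
have m0 : 0 < m by exact: expR_gt0.
have iG : mu.-integrable `[-1, 1] (fun u => (G u)%:E).
  apply: continuous_compact_integrable; first exact: segment_compact.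
  by apply: continuous_subspaceT; exact: cG.
pose D : set (measurableTypeR R) := `[- (1 / 2), 1 / 2]%classic.
have mD : measurable D by exact: measurable_itv.
have sub' : D `<=` `[-1, 1]%classic.
  rewrite /D => /= u /=; rewrite !in_itv /= => /andP[u1 u2]; move: (u : R) u1 u2 => v v1 v2.
  by apply/andP; split; lra.
rewrite /Crq /Rintegral fine_gt0//; apply/andP; split; last first.
  have [_] := integrableP _ _ _ iG.
  rewrite (_ : (fun u => `|(G u)%:E|%E) = fun u => (w (1 - u ^+ 2))%:E)//.
  by apply/funext => u; rewrite /= ger0_norm ?weight_ge0.
apply: (@lt_le_trans _ _ (\int[mu]_(u in D) m%:E)%E).
  have muD : mu `[- (1 / 2) : R, 1 / 2]%classic = 1%E.
    by rewrite lebesgue_measure_itv /= lte_fin ifT; [congr EFin; field|lra].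
  have -> : (\int[mu]_(u in D) m%:E = m%:E * mu D)%E by exact: integral_cst.
  by rewrite [X in (_ < _ * X)%E]muD mule1 lte_fin.
apply: (@le_trans _ _ (\int[mu]_(u in D) (G u)%:E)%E).
  apply: ge0_le_integral => //.
  - by move=> x _; rewrite lee_fin ltW.
  - by apply: measurable_funTS; apply/measurable_EFinP; exact: continuous_measurable_fun.
  - rewrite /D => /= u /=; rewrite in_itv /= => /andP[]; move: (u : R) => {}u u1 u2.
    rewrite lee_fin /G /weight.
    have u3 : 3 / 4 <= 1 - u ^+ 2 by nra.
    have u4 : 1 - u ^+ 2 <= 1 by nra.
    have u0 : 0 < 1 - u ^+ 2 by lra.
    rewrite u0 -[leLHS]mul1r; apply: ler_pM; [exact: ler01|exact: expR_ge0| |].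
      by rewrite -[leLHS](powRr0 (1 - u ^+ 2)) ger_powR ?u0// oppr_le0.
    rewrite ler_expR lerN2; apply: ler_powRN; [by rewrite invr_ge0 ltW| |exact: u3].
    by rewrite divr_gt0.
apply: ge0_subset_integral => //.
  by apply: measurable_funTS; apply/measurable_EFinP; exact: continuous_measurable_fun.
by move=> x _; rewrite lee_fin weight_ge0.
Qed.

End weight.

(** * Finite trace of the weight from the decay of the singular values *)

Section trace_weight.
Context {R : realType} {H : completeNormedModType R[i]}.
Variable ip : {dot H for Num.conj}.
Hypothesis ip_norm : forall x : H, `|x| ^+ 2 = ip x x.
Local Notation "<< x , y >>" := (dr ip x y) (at level 2, format "<< x ,  y >>").
Local Notation sym := (sym ip).
Local Notation psd := (psd ip).
Local Notation proj := (proj ip).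
Variables (N : set (H -> H)) (tau : (H -> H) -> \bar R).
Hypothesis vN : von_neumann_algebra ip N.
Hypothesis tau_fns : fns_trace ip N tau.

(** The infimum in [sing_value] need not be attained, so the asymptotic estimate is used with
    [e / 2]; the gap to [e] leaves room to pick a projection. *)
Lemma Li0_proj (T : bop H) (q e : R) : 0 < e -> Li0 ip N tau q T ->
  exists2 s0, 1 < s0 & forall s, s0 <= s -> exists F : bop H,
  [/\ N F, proj F, (tau (1 - F : bop H)%R <= s%:E)%E &
      forall v, nr (T (F v)) <= e * (ln s) `^ (- q) * nr v].
Proof.
move=> e0 [NT /eqoP h].
have e2 : 0 < e / 2 by rewrite divr_gt0.
have [s1 [_ hs1]] := h _ e2.
(* [s1 + 1] puts [s] strictly beyond [s1], and 2 makes [ln s] positive. *)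
exists (Num.max (s1 + 1) 2); first by rewrite lt_max ltr1n orbT.
move=> s; rewrite ge_max => /andP[ss1 s2].
have ls : 0 < ln s by rewrite ln_gt0//; lra.
have ps : 0 < ln s `^ (- q) by rewrite powR_gt0.
have : `|sing_value ip N tau s T| <= e / 2 * `|(ln s)^-1 `^ q|.
  by apply: hs1; lra.
have -> : (ln s)^-1 `^ q = ln s `^ (- q).
  by rewrite -powR_inv1 ?(ltW ls)// -powRrM mulN1r.
rewrite (gtr0_norm ps) => /(le_trans (ler_norm _)) hs.
have {}hs : sing_value ip N tau s T < e * ln s `^ (- q).
  by rewrite (le_lt_trans hs)// ltr_pM2r//; lra.
have S0 : [set opnorm (T \o E) | E in
    [set E | [/\ N E, projection ip E & (tau (idfun - E)%R <= s%:E)%E]]] !=set0.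
  exists (opnorm (T \o (1 : bop H))); exists (1 : bop H) => //; split.
  - exact: (N1 vN).
  - by apply/proj_projection; split; [exact: sym1|rewrite mulr1].
  - have -> : idfun - (1 : bop H) = (0 : bop H) :> (H -> H).
      by apply/funext => x; exact: subrr.
    by rewrite (tau0 vN tau_fns) lee_fin; lra.
have [_ [E [NE pE Es] <-] hE] := inf_lt S0 hs.
have [F FE] := N_bop vN NE; rewrite -{}FE in NE pE Es hE.
exists F; split => //; first exact/proj_projection.
move=> v; rewrite -bopM_E (le_trans (opnorm_bound _ _))// ler_wpM2r ?nr_ge0//.
exact: ltW.
Qed.

(** With [z = n + n0], slice at [(4 z)^(-q)]. Below this point [l^(-1/q) >= 4 z], so the weight is
    at most [M e^(-2 z)]; above it, the singular values at [e^z] bound the trace of the spectral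
    projection by [2 e^z]. Pairing each slice with the next projection gives the terms
    [2 M e e^(-z)], dominated by a geometric series of ratio 1/2 and sum [4 M e]. As [c <= 1], the
    estimate for [A] serves for its multiple. *)
Lemma tau_weight_lty (r q c : R) (A W : bop H) mu : 0 <= r -> 0 < q ->
  sym A -> Li0 ip N tau q A -> 0 < c -> c <= 1 ->
  spectral_data ip (c%:C *: A) mu -> psd W -> bicomm (c%:C *: A) W ->
  repr_fun ip mu (weight r q) W -> (tau W < +oo)%E.
Proof.
move=> r0 q0 sA LA c0 c1 dmu pW bW wW.
have NA : N A by case: LA.
(* Chosen so that [y0 z^(-q)] is the slice point [(4 z)^(-q)]; [y0 / 2] supplies the factor 1/2
   required by [tau_calculus_lty]. *)
pose y0 : R := 4 `^ (- q).
have y00 : 0 < y0 by rewrite powR_gt0.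
have [|s0 s01 hs0] := @Li0_proj A q (y0 / 2) _ LA; first by rewrite divr_gt0.
(* Ensures [s0 <= e^(z n)] for every [n]. *)
pose n0 := (Num.truncn s0).+1.
have n0s : s0 < n0%:R by exact: truncnS_gt.
pose z (n : nat) : R := (n + n0)%:R.
have z0 n : 0 < z n by rewrite ltr0n addnS.
have zS n : z n.+1 = z n + 1 by rewrite /z addSn -natr1.
have [M M0 hM] := weight_le_expR r0 q0.
have [B B0 hB] := weight_le_cst r0 q0.
have q0' : q != 0 by rewrite gt_eqF.
have scA : sym (c%:C *: A) by exact: symZ.
have NcA : N (c%:C *: A : bop H) by exact: (NZ vN).
apply: (tau_calculus_lty ip_norm vN tau_fns scA NcA dmu _ _ _ _ pW bW wW
   (x := fun n => (4 * z n) `^ (- q)) (c := fun n => M * expR (- (2 * z n)))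
   (t := fun n => expR (z n)) (B := B) (C := 4 * M * expR 1)) => //.
- exact: measurable_weight.
- by move=> l; exact: weight_ge0.
- by move=> l; exact: weight_npos.
- by move=> n; rewrite powR_gt0// mulr_gt0.
- by move=> n; have zn := z0 n; apply: ler_powRN; [exact: ltW|lra|rewrite zS; lra].
- apply/cvgrPdist_lt => e e0; exists (Num.truncn (e `^ (- q^-1))).+1 => // n /= hn.
  have zn : e `^ (- q^-1) < 4 * z n.
    rewrite (lt_le_trans (truncnS_gt _))// (@le_trans _ _ n%:R) ?ler_nat//.
    have : n%:R <= z n by rewrite ler_nat leq_addr.
    by have : 0 <= n%:R :> R by []; lra.
  rewrite sub0r normrN ger0_norm ?powR_ge0//.
  have -> : e = (e `^ (- q^-1)) `^ (- q).
    by rewrite -powRrM mulrNN mulVf// powRr1// ltW.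
  by apply: ltr_powRN => //; rewrite powR_gt0.
- by move=> n; rewrite mulr_ge0 ?expR_ge0// ltW.
- move=> n l l1 l2; have l0 : 0 < l by rewrite (le_lt_trans _ l1)// powR_ge0.
  rewrite (le_trans (hM l l0))// ler_pM2l// ler_expR lerN2 ler_pdivlMr//.
  have -> : 2 * z n * 2 = ((4 * z n) `^ (- q)) `^ (- q^-1).
    rewrite -powRrM mulrNN mulfV// powRr1; first by ring.
    by rewrite mulr_ge0// ltW.
  by apply: ler_powRN => //; rewrite invr_ge0 ltW.
- move=> n; have [|F [NF pF tF bF]] := hs0 (expR (z n)).
    rewrite (le_trans (ltW n0s))// (le_trans _ (expR_ge1Dx _))//.
    have : n0%:R <= z n by rewrite ler_nat leq_addl.
    lra.
  exists F; split=> // v; rewrite bopZ_E nrZ gtr0_norm//.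
  rewrite (@le_trans _ _ (nr (A (F v))))//.
    by rewrite -[leRHS]mul1r ler_wpM2r ?nr_ge0.
  rewrite (le_trans (bF v))// expRK /y0 powRM ?(ltW (z0 n))//.
  by rewrite [_ / 2 * _]mulrAC.
- move=> n.
  have le_n k : M * expR (- (2 * z k)) * (2 * expR (z k.+1)) <= 2 * M * expR 1 * 2^-1 ^+ k.
    have -> : M * expR (- (2 * z k)) * (2 * expR (z k.+1)) = 2 * M * expR 1 * expR (- z k).
      rewrite zS expRD.
      have -> : expR (- (2 * z k)) = expR (- z k) * expR (- z k).
        by rewrite -expRD; congr expR; ring.
      have : expR (- z k) * expR (z k) = 1 by rewrite -expRD addNr expR0.
      move: (expR (- z k)) (expR (z k)) (expR 1) => a b d ab.
      by rewrite -[RHS]mulr1 -ab; ring.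
    rewrite ler_wpM2l ?mulr_ge0 ?expR_ge0 ?(ltW M0)//.
    rewrite expRN exprVn lef_pV2 ?posrE ?expR_gt0 ?exprn_gt0//.
    rewrite (@le_trans _ _ (expR k%:R))//; last by rewrite ler_expR ler_nat leq_addr.
    rewrite -[k%:R]mulr1 expRM_natl lerXn2r ?nnegrE ?expR_ge0//.
    by have := expR_ge1Dx (1 : R); lra.
  rewrite (le_trans (ler_sum _ (fun (k : 'I_n) _ => le_n k)))// -mulr_sumr.
  have -> : 4 * M * expR 1 = 2 * M * expR 1 * 2 by ring.
  rewrite ler_wpM2l ?mulr_ge0 ?expR_ge0 ?(ltW M0)//.
  have : \sum_(k < n) 2^-1 ^+ k = 2 - 2 * 2^-1 ^+ n :> R.
    elim: n => [|m ih]; first by rewrite big_ord0 expr0; ring.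
    by rewrite big_ord_recr /= ih exprS; field.
  by move=> ->; rewrite gerBl mulr_ge0// exprn_ge0// invr_ge0.
Qed.

End trace_weight.

(** * Sign and absolute value *)

Section sign.
Context {R : realType} {H : completeNormedModType R[i]}.
Variable ip : {dot H for Num.conj}.
Hypothesis ip_norm : forall x : H, `|x| ^+ 2 = ip x x.
Implicit Types T E : bop H.
Local Notation "<< x , y >>" := (dr ip x y) (at level 2, format "<< x ,  y >>").
Local Notation sym := (sym ip).
Local Notation psd := (psd ip).
Local Notation proj := (proj ip).

Lemma repr_fun_eigen T mu (f : R -> R) S x l : spectral_data ip T mu ->
  measurable_fun setT (f : measurableTypeR R -> R) -> (forall a, 0 <= f a) ->
  repr_fun ip mu f S -> T x = l%:C *: x -> <<S x, x>> = f l * <<x, x>>.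
Proof.
move=> [muT _ _ eig] mf f0 fS Tx.
have ml : measurable ([set l] : set (measurableTypeR R)) by exact: measurable_set1.
have /andP[] := concentrated_bounds ml (eig _ _ Tx) (muT x) mf f0 (f0 l) (f0 l)
  (fun a (h : [set l] a) => ltac:(by rewrite h lexx)).
by rewrite fS !lee_fin => h1 h2; apply/eqP; rewrite eq_le h1 h2.
Qed.

(** The half-line is closed at 0, so eigenvectors for 0 go to the range; this decides what happens
    at [t = 1/2] on the path. *)
Lemma nonneg_spectral_projE T : sym T -> exists E, [/\ nonneg_spectral_proj ip T = E,
  proj E /\ bicomm T E, forall x, 0 <= <<T (E x), E x>>,
  forall x, <<T (x - E x), x - E x>> <= 0 &
  forall x l, T x = l%:C *: x -> E x = if 0 <= l then x else 0].
Proof.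
move=> sT; have [mu dmu] := spectral_data_ex ip_norm sT.
have [muT mu1 rep eig] := dmu.
pose B : set (measurableTypeR R) := `[0, +oo[%classic.
have mB : measurable B by exact: measurable_itv.
have [E [pE bE BE]] := rep B mB.
have fE : repr_fun ip mu (\1_B) E by move=> x; rewrite integral_indic// setIT BE.
exists E; split.
- exact: (borel_calculusE ip_norm sT dmu pE.1 fE).
- by [].
- move=> x; rewrite -[leLHS](mul0r <<E x, E x>>).
  apply: (conc_first_moment_ge muT mu1 mB).
    by apply: (repr_set_conc muT mB BE); rewrite (proj_idem _ pE).
  by move=> l; rewrite /B /= in_itv /= andbT.
- move=> x; rewrite -[leRHS](mul0r <<x - E x, x - E x>>).
  have mB' : measurable (~` B) by exact: measurableC.
  apply: (conc_first_moment_le muT mu1 mB').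
    rewrite setCK BE; apply/eqP; rewrite eqe; apply/eqP.
    by rewrite bop_add bop_opp (proj_idem _ pE) subrr dr0l.
  by move=> l; rewrite /B /= in_itv /= andbT => /negP; rewrite -ltNge => /ltW.
- move=> x l Tx; have e := eig x l Tx.
  have ml : measurable ([set l] : set (measurableTypeR R)) by exact: measurable_set1.
  have nB (D : set (measurableTypeR R)) : measurable D -> D `<=` ~` [set l] -> mu x D = 0%E.
    by move=> mD Dl; apply: (subset_measure0 mD _ Dl e); exact: measurableC.
  case: ifPn => l0.
    apply: (proj_form_eq pE); apply: EFin_inj; rewrite -BE -muT.
    rewrite -(setUv B) measureU//; last 2 first.
      exact: measurableC.
      exact: setICr.
    have BC0 : mu x (~` B) = 0%E.
      apply: nB; first exact: measurableC.
      by apply: subsetC => _ ->; rewrite /B /= in_itv /= l0.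
    by rewrite [X in (_ + X)%E]BC0 adde0.
  apply: (proj_form_eq0 pE); apply: EFin_inj; rewrite -BE; apply: nB => //.
  move=> a; rewrite /B /= in_itv /= andbT => a0 al.
  by move: l0; rewrite -al a0.
Qed.

Section sign_operator.
Variables T E : bop H.
Hypotheses (sT : sym T) (pE : proj E) (bE : bicomm T E).
Hypothesis T_pos : forall x, 0 <= <<T (E x), E x>>.
Hypothesis T_neg : forall x, <<T (x - E x), x - E x>> <= 0.

Definition sgn_op := E + E - 1.
(** This is [|T|]: positive by [psd_abs_op], with square [T * T]. *)
Definition abs_op := sgn_op * T.

Lemma sgn_op_sqr : sgn_op * sgn_op = 1.
Proof.
apply: bop_ext => x; apply: (@dr_ext _ _ ip) => y.
rewrite /sgn_op !(bopM_E, bopD_E, bopN_E, bop1_E, bop_add, bop_opp).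
by rewrite !(proj_idem _ pE) !drE; ring.
Qed.

Lemma sgn_op_comm : T * sgn_op = sgn_op * T.
Proof.
have ET : T * E = E * T by exact: bE.
by rewrite /sgn_op !mulrBr !mulrBl !mulrDr !mulrDl ET mulr1 mul1r.
Qed.

Lemma sym_sgn_op : sym sgn_op.
Proof. by apply: symB; [apply: symD; exact: pE.1|exact: sym1]. Qed.

Lemma abs_op_sqr : abs_op * abs_op = T * T.
Proof.
rewrite /abs_op -mulrA [T * _]mulrA sgn_op_comm -!mulrA.
by rewrite [_ * (_ * (T * T))]mulrA sgn_op_sqr mul1r.
Qed.

Lemma psd_abs_op : psd abs_op.
Proof.
split=> [x y|x].
  by rewrite !bopM_E sym_sgn_op sT -bopM_E sgn_op_comm.
have ET y : T (E y) = E (T y) by rewrite -!bopM_E (bE (erefl (T * T))).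
have e1 : <<E (T x), x>> = <<T (E x), E x>>.
  by rewrite ET -(proj_idem (T x) pE) pE.1 (proj_idem _ pE).
have e2 : <<T x, x>> - <<E (T x), x>> = <<T (x - E x), x - E x>>.
  rewrite bop_add bop_opp ET !drE -![<<_, E x>>]pE.1 (proj_idem _ pE); ring.
rewrite bopM_E /sgn_op !(bopD_E, bopN_E, bop1_E) !drE.
have := T_pos x; rewrite -e1; have := T_neg x; rewrite -e2; lra.
Qed.

(** The square of the path is affine in [A], so its moduli commute with [p] and [q] although the
    path itself need not. *)
Lemma bicomm_abs_op : bicomm (T * T) abs_op.
Proof. by rewrite -abs_op_sqr; exact: (psd_sqr_bicomm ip_norm psd_abs_op). Qed.

Lemma abs_op_ran x : E x = x -> abs_op x = T x.
Proof.
by move=> Ex; rewrite /abs_op -sgn_op_comm bopM_E /sgn_op !bopE Ex addrK.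
Qed.

Lemma abs_op_ker x : E x = 0 -> abs_op x = - T x.
Proof.
by move=> Ex; rewrite /abs_op -sgn_op_comm bopM_E /sgn_op !bopE Ex add0r sub0r bop_opp.
Qed.

Variables (N : set (H -> H)) (tau : (H -> H) -> \bar R).
Hypothesis vN : von_neumann_algebra ip N.
Local Notation K := (compact_ideal ip N tau).

(* X = 1 - |T| satisfies X (2 - X) = 1 - T^2 and sgn(T) - T = sgn(T) X. *)
Lemma sgn_op_compact : N T -> psd (1 - T * T) -> K (1 - T * T : bop H) -> K (sgn_op - T : bop H).
Proof.
move=> NT pX KX; have pA := psd_abs_op.
have NE : N E by exact: (N_bicomm vN NT bE).
have Ns : N sgn_op by apply: (NB vN); [exact: (ND vN)|exact: (N1 vN)].
have NA : N abs_op by exact: (NM vN).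
have A1 x : <<abs_op x, x>> <= <<x, x>>.
  have h y : <<abs_op y, abs_op y>> <= <<y, y>>.
    by have := pX.2 y; rewrite -abs_op_sqr bopD_E bopN_E bop1_E drDl drNl bopM_E pA.1 subr_ge0.
  (* From [0 <= <<x - y, x - y>>]; used at [y = |T| x]. *)
  have gen (y : H) : <<y, y>> <= <<x, x>> -> <<y, x>> <= <<x, x>>.
    by have := dr_ge0 ip (x - y); rewrite !drE (drC ip x y); lra.
  exact/gen/h.
have e : sgn_op - T = sgn_op * (1 - abs_op).
  by rewrite mulrBr mulr1 /abs_op mulrA sgn_op_sqr mul1r.
rewrite e; refine (KMl Ns _).
refine (K_half ip_norm vN _ _ _ _).
- by apply: (NB vN) => //; exact: (N1 vN).
- split=> [|x]; first by apply: symB; [exact: sym1|exact: pA.1].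
  by rewrite bopD_E bopN_E bop1_E drDl drNl subr_ge0.
- by move=> x; rewrite bopD_E bopN_E bop1_E drDl drNl gerBl; exact: pA.2.
- have -> // : (1 - abs_op) * (2%:R - (1 - abs_op)) = 1 - T * T.
  rewrite -abs_op_sqr; have -> : 2%:R - (1 - abs_op) = 1 + abs_op :> bop H.
    by apply/eqP; rewrite subr_eq addrACA subrr addr0.
  by rewrite mulrDr mulr1 mulrBl mul1r addrA subrK.
Qed.

End sign_operator.
End sign.

(** * The straight line between two symmetries *)

Section path.
Context {R : realType} {H : completeNormedModType R[i]}.
Variable ip : {dot H for Num.conj}.
Hypothesis ip_norm : forall x : H, `|x| ^+ 2 = ip x x.
Implicit Types T S E X : bop H.
Local Notation "<< x , y >>" := (dr ip x y) (at level 2, format "<< x ,  y >>").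
Local Notation sym := (sym ip).
Local Notation psd := (psd ip).
Local Notation proj := (proj ip).

(** Settles the choice in [proj_onto]: projections with the same range absorb each other, [E S = S]
    and [S E = E], so their forms agree. *)
Lemma proj_ontoE (V : set H) E : proj E -> (forall x, V x <-> E x = x) -> proj_onto ip V = E.
Proof.
move=> pE VE; apply: xget_unique.
  split; first exact/proj_projection.
  apply/seteqP; split=> [_ [x _ <-]|x /VE Ex]; last by exists x.
  by apply/VE; rewrite (proj_idem _ pE).
move=> F [pF rF]; have [S SF] := bop_of pF.1.1; move: pF rF; rewrite -SF => /proj_projection pS rS.
congr bop_fun.
have ES : E * S = S.
  apply: bop_ext => x; rewrite bopM_E; apply/VE; rewrite -rS; by exists x.
have SE : S * E = E.
  apply: bop_ext => x; rewrite bopM_E.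
  have : range S (E x) by rewrite rS; apply/VE; rewrite (proj_idem _ pE).
  by move=> [y _ <-]; rewrite (proj_idem _ pS).
apply: (sym_ext (ip := ip)); [exact: pS.1|exact: pE.1|move=> x].
by rewrite -[in LHS]ES bopM_E pE.1 pS.1 -(bopM_E S E) SE drC.
Qed.

Variables p q : bop H.
Hypotheses (pp : proj p) (pq : proj q).
Local Notation A := (diff2 p q).

Definition path (t : R) : bop H :=
  (2%:C *: p - 1) + t%:C *: ((2%:C *: q - 1) - (2%:C *: p - 1)).

Lemma pathE t x : path t x =
  2%:C *: p x - x + t%:C *: ((2%:C *: q x - x) - (2%:C *: p x - x)).
Proof. by []. Qed.

Lemma path_sqr t : path t * path t = 1 - (4 * t * (1 - t))%:C *: A.
Proof.
apply: bop_ext => x; apply: (@dr_ext _ _ ip) => y.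
rewrite (diff2E pp pq) bopM_E !pathE !(bopM_E, bopD_E, bopN_E, bop1_E, bopZ_E).
rewrite !(bop_add, bop_opp, bop_scale) !(proj_idem _ pp) !(proj_idem _ pq) !drE.
by ring.
Qed.

(** For [t != u] the scalar is nonzero: if two operators of the path commute on a vector, [p] and
    [q] do as well. *)
Lemma path_commutator t u :
  path t * path u - path u * path t = (4 * (u - t))%:C *: (p * q - q * p).
Proof.
apply: bop_ext => x; apply: (@dr_ext _ _ ip) => y.
rewrite bopD_E bopN_E !bopM_E !pathE.
have -> : ((4 * (u - t))%:C *: (p * q - q * p)) x =
  (4 * (u - t))%:C *: (p (q x) - q (p x)) by [].
rewrite !(bop_add, bop_opp, bop_scale) !(proj_idem _ pp) !(proj_idem _ pq) !drE.
by ring.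
Qed.

Lemma sym_path t : sym (path t).
Proof.
have s2 r : proj r -> sym (2%:C *: r - 1).
  by move=> pr; apply: symB; [apply: symZ; exact: pr.1|exact: sym1].
by apply: symD; [exact: s2|apply: symZ; apply: symB; exact: s2].
Qed.

Lemma path_comm X t : p * X = X * p -> q * X = X * q -> path t * X = X * path t.
Proof.
move=> pX qX; have e y : p (X y) = X (p y) /\ q (X y) = X (q y).
  by rewrite -!bopM_E pX qX.
apply: bop_ext => x; rewrite !bopM_E !pathE !(bop_add, bop_opp, bop_scale).
by have [-> ->] := e x.
Qed.

Lemma diff2_fix x : A x = x -> q x = x - p x.
Proof.
move=> Ax; have sB : sym (1 - p - q).
  by apply: symB; [apply: symB; [exact: sym1|exact: pp.1]|exact: pq.1].
have : (1 - p - q) x = 0.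
  apply: (sqr_ker sB); rewrite -bopM_E -(diff2_sqr pp pq).
  by rewrite bopD_E bopN_E bop1_E Ax subrr.
by move=> /eqP; rewrite 2!bopD_E 2!bopN_E bop1_E subr_eq0 => /eqP.
Qed.

Lemma path_fix t x : A x = x ->
  path t (p x) = (1 - 2 * t)%:C *: p x /\ path t (q x) = (- (1 - 2 * t))%:C *: q x.
Proof.
move=> Ax; have qx := diff2_fix Ax.
have Apx : A (p x) = p x by rewrite -bopM_E (diff2_comml pp pq) bopM_E Ax.
have qpx : q (p x) = 0 by rewrite (diff2_fix Apx) (proj_idem _ pp) subrr.
have pqx : p (q x) = 0 by rewrite qx bop_add bop_opp (proj_idem _ pp) subrr.
split; apply: (@dr_ext _ _ ip) => y; rewrite pathE.
  by rewrite (proj_idem _ pp) qpx scaler0 !drE; ring.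
by rewrite (proj_idem _ pq) pqx scaler0 !drE; ring.
Qed.

(* If x is in the range of one of the two spectral projections and in the kernel of
   the other, path t and path u commute on x, hence so do p and q, so that
   A (x - A x) = 0; on ker A the path is constant, which forces x = A x. *)
Lemma diff2_fix_opposite t u (s : R) X Y x : t != u -> s != 0 ->
  psd X -> psd Y -> X * Y = Y * X ->
  p * X = X * p -> q * X = X * q -> p * Y = Y * p -> q * Y = Y * q ->
  path t x = s%:C *: X x -> path u x = - (s%:C *: Y x) -> A x = x.
Proof.
move=> tu s0 pX pY XY pX' qX pY' qY tx ux.
have tX := path_comm t pX' qX; have tY := path_comm t pY' qY.
have uX := path_comm u pX' qX; have uY := path_comm u pY' qY.
have c0 : (path t * path u - path u * path t) x = 0.
  rewrite bopD_E bopN_E !bopM_E ux tx bop_opp !bop_scale -!bopM_E tY uX !bopM_E ux tx.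
  by rewrite bop_opp !bop_scale -!bopM_E XY scalerN opprK addNr.
have e1 : p (q x) = q (p x).
  apply/subr0_eq; move: c0; rewrite path_commutator bopZ_E => /eqP; rewrite scaler_eq0.
  move=> /orP[|/eqP//]; rewrite -[0]/(0%:C) => /eqP/complexI/eqP.
  by rewrite mulf_eq0 subr_eq0 [u == t]eq_sym (negPf tu) orbF pnatr_eq0.
have e3 : p (q (p x)) = q (p x) by rewrite -e1 (proj_idem _ pp).
have AAx : A (A x) = A x.
  apply: (@dr_ext _ _ ip) => y; rewrite (diff2E pp pq).
  rewrite !(bopD_E, bopN_E, bopM_E) !(bop_add, bop_opp).
  rewrite !(proj_idem _ pp) !(proj_idem _ pq) !e1 !(proj_idem _ pq) !e3 !(proj_idem _ pq) !drE.
  by ring.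
pose z := x - A x.
have Az : A z = 0 by rewrite /z bop_add bop_opp AAx subrr.
have sD : sym (q - p) by apply: symB; [exact: pq.1|exact: pp.1].
have qz : q z = p z.
  apply/subr0_eq; rewrite -[LHS]/((q - p) z); apply: (sqr_ker sD).
  by rewrite -bopM_E.
have fz r : path r z = 2%:C *: p z - z by rewrite pathE qz subrr scaler0 addr0.
have pA : p * A = A * p by rewrite (diff2_comml pp pq).
have qA : q * A = A * q by rewrite (diff2_commr pp pq).
have comA S w : p * S = S * p -> q * S = S * q -> S (w - A w) = S w - A (S w).
  move=> pS qS; rewrite bop_add bop_opp -!bopM_E.
  suff -> : S * A = A * S by [].
  by rewrite /diff2 mulrBr !mulrBl !mulrBr !mulrA -pS -qS -!mulrA -pS -qS !mulrA.
have tz : path t z = s%:C *: X z.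
  have e : path t * A = A * path t by exact: path_comm.
  rewrite /z bop_add bop_opp -(bopM_E (path t)) e bopM_E tx bop_scale -scalerBr.
  by rewrite comA.
have uz : path u z = - (s%:C *: Y z).
  have e : path u * A = A * path u by exact: path_comm.
  rewrite /z bop_add bop_opp -(bopM_E (path u)) e bopM_E ux bop_opp bop_scale -opprD -scalerBr.
  by rewrite comA.
(* Both sides are the form of [2 p - 1] at [z], as [q z = p z]. Positivity of [X] and [Y] then gives
   [X z = 0], so [2 p z = z], which a projection only allows for [z = 0]. *)
have h : s * <<X z, z>> = - (s * <<Y z, z>>).
  by rewrite -drZl -tz -drZl -drNl -uz !fz.
have Xz : X z = 0.
  apply: (psd_ker pX); have := pX.2 z; have := pY.2 z.
  have : <<X z, z>> = - <<Y z, z>> by apply: (mulfI s0); rewrite h mulrN.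
  by lra.
have F0z : 2%:C *: p z = z by apply/subr0_eq; rewrite -(fz t) tz Xz scaler0.
have pz : p z = 0.
  have h2 := congr1 p F0z; rewrite bop_scale (proj_idem _ pp) in h2.
  apply: (@dr_ext _ _ ip) => y; have := congr1 (fun v => <<v, y>>) h2.
  by rewrite drZl dr0l; lra.
by apply/esym/subr0_eq; rewrite -/z -F0z pz scaler0.
Qed.

Lemma diff2_meet x : q x = x -> p x = 0 -> A x = x.
Proof.
move=> qx px; rewrite (diff2E pp pq).
have -> : (q + p - q * p - p * q) x = q x + p x - q (p x) - p (q x) by [].
by rewrite qx px bop_zero !subr0 addr0.
Qed.

Lemma diff2_meet' x : p x = x -> q x = 0 -> A x = x.
Proof.
move=> px qx; rewrite (diff2E pp pq).
have -> : (q + p - q * p - p * q) x = q x + p x - q (p x) - p (q x) by [].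
by rewrite px qx bop_zero !subr0 add0r.
Qed.

Section spectral_projections.
Variable E : R -> bop H.
Hypothesis pE : forall t, proj (E t).
Hypothesis bE : forall t, bicomm (path t) (E t).
Hypothesis E_pos : forall t x, 0 <= <<path t (E t x), E t x>>.
Hypothesis E_neg : forall t x, <<path t (x - E t x), x - E t x>> <= 0.
Hypothesis E_eig : forall t x l, path t x = l%:C *: x -> E t x = if 0 <= l then x else 0.

(** [diff2_fix_opposite] for the moduli [X] at [u] and [Y] at [t], with [s = 1]: on [x] the path at
    [u] agrees with its modulus and the path at [t] with minus its modulus. *)
Lemma path_opposite t u x : t != u -> E u x = x -> E t x = 0 -> A x = x.
Proof.
move=> tu ux tx.
pose X r := abs_op (path r) (E r).
have pX r : psd (X r).
  exact: (psd_abs_op (sym_path r) (pE r) (bE (t := r)) (E_pos r) (E_neg r)).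
have pA : p * A = A * p by rewrite (diff2_comml pp pq).
have qA : q * A = A * q by rewrite (diff2_commr pp pq).
have cmp S r : S * A = A * S -> S * (path r * path r) = path r * path r * S.
  by move=> SA; rewrite path_sqr mulrBr mulrBl mulr1 mul1r -bop_scaleAl -bop_scaleAr SA.
have bX' r S : S * A = A * S -> S * X r = X r * S.
  move=> SA; apply: (bicomm_abs_op ip_norm (sym_path r) (pE r) (bE (t := r)) (E_pos r) (E_neg r)).
  exact: cmp.
have AX r : X r * A = A * X r by apply/esym; exact: bX'.
apply: (@diff2_fix_opposite u t 1 (X u) (X t)) => //.
- by rewrite eq_sym.
- exact: (bX' t _ (AX u)).
- exact: bX'.
- exact: bX'.
- exact: bX'.
- exact: bX'.
- by rewrite scale1r (abs_op_ran (bE (t := u))).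
- by rewrite scale1r (abs_op_ker (bE (t := t)) tx) opprK.
Qed.

(** Here [x = p x + q x], and the two summands are eigenvectors for [1 - 2 t] and its opposite. At
    [t = 1/2] both eigenvalues are 0, so all of [x] is kept. *)
Lemma nonneg_proj_fix t x : A x = x ->
  E t x = if t < 1/2 then p x else if t == 1/2 then x else q x.
Proof.
move=> Ax; have [tp tq] := path_fix t Ax; have qx := diff2_fix Ax.
have {1}-> : x = p x + q x by rewrite qx addrCA subrr addr0.
rewrite bop_add (E_eig tp) (E_eig tq).
have [t2|t2|t2] := ltgtP t (1/2).
- by rewrite ifT ?ifF ?addr0//; lra.
- by rewrite ifF ?ifT ?add0r//; lra.
- by rewrite !ifT ?qx ?subrKC//; lra.
Qed.

(** On [ker (1 - A)] the projection is [p] before time 1/2, the identity at 1/2 and [q] afterwards.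
    So [ran q] meet [ker p] is gained on reaching 1/2, and [ran p] meet [ker q] is lost only on
    leaving it; hence the different strictness in [proj_index_sets']. *)
Lemma proj_index_sets t u x : t < u ->
  (range (E u) `&` [set x | E t x = 0]) x <->
    (if (t < 1/2) && (1/2 <= u) then q x = x /\ p x = 0 else x = 0).
Proof.
move=> tu; have tu' : t != u by rewrite lt_eqF.
have ran r y : range (E r) y <-> E r y = y.
  by split=> [[z _ <-]|<-]; [rewrite (proj_idem _ (pE r))|exists y].
split=> [[/ran ux tx]|].
  have Ax := path_opposite tu' ux tx; have qx := diff2_fix Ax.
  move: ux tx; rewrite /= !(nonneg_proj_fix _ Ax).
  have [t2|t2|t2] := ltgtP t (1/2); have [u2|u2|u2] := ltgtP u (1/2) => /=; try by exfalso; lra.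
  - by move=> -> ->.
  - by move=> -> ->.
  - by move=> _ px; rewrite qx px subr0.
  - by move=> -> ->.
  - by move=> _ ->.
case: ifP => [/andP[t2 u2] [qx px]|_ ->]; last first.
  by split; [exists 0 => //|]; exact: bop_zero.
have Ax := diff2_meet qx px.
split; [apply/ran|]; rewrite /= (nonneg_proj_fix _ Ax).
  by rewrite ltNge u2 /= qx; case: ifP.
by rewrite t2.
Qed.

Lemma proj_index_sets' t u x : t < u ->
  ([set x | E u x = 0] `&` range (E t)) x <->
    (if (t <= 1/2) && (1/2 < u) then p x = x /\ q x = 0 else x = 0).
Proof.
move=> tu; have ut' : u != t by rewrite gt_eqF.
have ran r y : range (E r) y <-> E r y = y.
  by split=> [[z _ <-]|<-]; [rewrite (proj_idem _ (pE r))|exists y].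
split=> [[ux /ran tx]|].
  have Ax := path_opposite ut' tx ux; have qx := diff2_fix Ax.
  move: ux tx; rewrite /= !(nonneg_proj_fix _ Ax).
  have [t2|t2|t2] := ltgtP t (1/2); have [u2|u2|u2] := ltgtP u (1/2) => /=; try by exfalso; lra.
  - by move=> -> ->.
  - by move=> -> ->.
  - by move=> -> _.
  - by move=> -> ->.
  - by move=> qx0 _; split=> //; apply/esym/subr0_eq; rewrite -qx.
case: ifP => [/andP[t2 u2] [px qx]|_ ->]; last first.
  by split; [|exists 0 => //]; exact: bop_zero.
have Ax := diff2_meet' px qx.
split; [|apply/ran]; rewrite /= (nonneg_proj_fix _ Ax).
  by rewrite ltNge ltW//= gt_eqF.
by move: t2; rewrite le_eqVlt => /predU1P[->|->]; rewrite ?ltxx ?eqxx.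
Qed.

Variables (tau : (H -> H) -> \bar R) (V V' : bop H).
Hypotheses (hV : meet_proj ip p q V) (hV' : meet_proj ip q p V').
Hypothesis tau0 : tau (0 : bop H) = 0%E.
Hypotheses (fV : tau V \is a fin_num) (fV' : tau V' \is a fin_num).

(** A potential for the index ([proj_index_path]), so that sums over partitions telescope. The
    separate value at 1/2 allows a partition to contain that point, which splits the crossing into
    two jumps. *)
Definition phase (t : R) : R := if t < 1/2 then 0 else
  if t == 1/2 then fine (tau V) else fine (tau V) - fine (tau V').

Lemma proj_index_path t u : t < u ->
  proj_index ip tau (E t) (E u) = (phase u - phase t)%:E.
Proof.
move=> tu; have [pV _ VE _] := hV; have [pV' _ VE' _] := hV'.
have p0 : proj (0 : bop H) by split; [exact: sym0|rewrite mul0r].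
have E0 x : x = 0 <-> (0 : bop H) x = x by rewrite bop0_E; split=> ->.
rewrite /proj_index.
have -> : proj_onto ip (range (E u) `&` [set x | E t x = 0]) =
    (if (t < 1/2) && (1/2 <= u) then V else 0 : bop H).
  apply: proj_ontoE => [|x]; first by case: ifP.
  by apply: (iff_trans (proj_index_sets x tu)); case: ifP => _; [apply: iff_sym|].
have -> : proj_onto ip ([set x | E u x = 0] `&` range (E t)) =
    (if (t <= 1/2) && (1/2 < u) then V' else 0 : bop H).
  apply: proj_ontoE => [|x]; first by case: ifP.
  by apply: (iff_trans (proj_index_sets' x tu)); case: ifP => _; [apply: iff_sym|].
rewrite /phase -[in tau V](fineK fV) -[in tau V'](fineK fV').
have [t2|t2|t2] := ltgtP t (1/2); have [u2|u2|u2] := ltgtP u (1/2) => /=; try by exfalso; lra.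
- by rewrite tau0 subrr sube0.
- by rewrite -{1}(fineK fV) -{1}(fineK fV') subr0 EFinB.
- by rewrite tau0 sube0 subr0 -{1}(fineK fV).
- by rewrite tau0 subrr sube0.
- by rewrite tau0 sub0e -{1}(fineK fV') -EFinN; congr EFin; ring.
Qed.

Lemma sum_proj_index_path (s : seq R) : itv_partition 0 1 s ->
  (\sum_(i < size s) proj_index ip tau (E (nth 1%R (0%R :: s) i)) (E (nth 1%R (0%R :: s) i.+1)) =
   (fine (tau V) - fine (tau V'))%:E)%E.
Proof.
move=> [ps ls].
have -> : fine (tau V) - fine (tau V') = phase 1 - phase 0.
  have h0 : 0 < 1 / 2 :> R by lra.
  have h1 : (1 < 1 / 2 :> R) = false by apply/negbTE; rewrite -leNgt; lra.
  have h2 : (1 == 1 / 2 :> R) = false by rewrite gt_eqF//; lra.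
  by rewrite /phase h0 h1 h2 subr0.
move: ls => /eqP <-; elim: s (0 : R) ps => [a _|b s ih a /= /andP[ab bs]].
  by rewrite big_ord0 /= subrr.
by rewrite big_ord_recl /= (proj_index_path ab) ih// -EFinD; congr EFin; ring.
Qed.

End spectral_projections.
End path.

(** * Spectral flow and trace along the path *)

Section flow.
Context {R : realType} {H : completeNormedModType R[i]}.
Variable ip : {dot H for Num.conj}.
Hypothesis ip_norm : forall x : H, `|x| ^+ 2 = ip x x.
Implicit Types T S E X : bop H.
Local Notation "<< x , y >>" := (dr ip x y) (at level 2, format "<< x ,  y >>").
Local Notation sym := (sym ip).
Local Notation psd := (psd ip).
Local Notation proj := (proj ip).

Section variation.
Variables p q : bop H.
Local Notation path := (path p q).
Local Notation D := (path 1 - path 0).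

Lemma pathB s t : path s - path t = (s - t)%:C *: D.
Proof.
apply: bop_ext => x; apply: (@dr_ext _ _ ip) => y.
have -> : (path s - path t) x = path s x - path t x by [].
have -> : ((s - t)%:C *: D) x = (s - t)%:C *: (path 1 x - path 0 x) by [].
by rewrite !pathE !drE; ring.
Qed.

Lemma norm_continuous_path_path a b : norm_continuous_path a b (fun t => path t : H -> H).
Proof.
move=> t _; apply: cvg_within_filter; apply/cvgrPdist_le => e e0.
have M0 : 0 < opnorm D + 1 by rewrite ltr_wpDl// opnorm_ge0.
near=> s; rewrite sub0r normrN ger0_norm ?opnorm_ge0//.
apply: (@le_trans _ _ (`|t - s| * (opnorm D + 1))).
  apply: opnorm_le => [|x]; first by rewrite mulr_ge0// ltW.
  have h : nr ((path s - path t) x) <= `|t - s| * (opnorm D + 1) * nr x.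
    rewrite pathB bopZ_E nrZ distrC -mulrA ler_wpM2l// (le_trans (opnorm_bound _ _))//.
    by rewrite ler_wpM2r ?nr_ge0// lerDl.
  exact: h.
rewrite -ler_pdivlMr//; near: s.
by apply: (@cvgr_dist_le _ _ _ (nbhs t) _ id); [exact: cvg_id|exact: divr_gt0].
Unshelve. all: by end_near. Qed.

(** The difference quotient equals [D] for every nonzero [h], so any other candidate is at operator
    norm distance 0 from [D]. *)
Lemma norm_derive_path t : norm_derive (fun t => path t : H -> H) t = D.
Proof.
have quot (h : R) (S : H -> H) : h != 0 ->
    (h^-1)%:C *: ((path (t + h) : H -> H) - path t) - S = (D : H -> H) - S.
  move=> h0; congr (_ - S); apply/funext => x.
  have -> : ((h^-1)%:C *: ((path (t + h) : H -> H) - path t)) x =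
    (h^-1)%:C *: ((path (t + h) - path t) x) by [].
  rewrite pathB addrAC subrr add0r bopZ_E scalerA -RcM mulVf// scale1r //.
have eqc (S : H -> H) : opnorm ((h^-1)%:C *: ((path (t + h) : H -> H) - path t) - S)
    @[h --> (0 : R)^'] --> opnorm ((D : H -> H) - S).
  apply: (@cvg_trans _ (opnorm ((D : H -> H) - S) @[h --> (0 : R)^'])); last exact: cvg_cst.
  apply: near_eq_cvg; near=> h; rewrite quot//; near: h; exact: nbhs_dnbhs_neq.
apply: xget_unique.
  split; first exact: bop_bounded.
  suff e0 : opnorm ((D : H -> H) - (D : H -> H)) = 0 by have := eqc D; rewrite e0.
  apply/eqP; rewrite eq_le opnorm_ge0 andbT; apply: opnorm_le => // x.
  by rewrite subrr nr0 mul0r.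
move=> S [bS cS]; have [S' SS] := bop_of bS; rewrite -{}SS in cS *.
have := cvg_unique _ (eqc S') cS => /(_ _) h0.
apply/funext => x; apply/esym/subr0_eq/eqP; rewrite -nr_eq0 eq_le nr_ge0 andbT.
have := opnorm_bound (D - S') x.
by rewrite -[opnorm (D - S')]/(opnorm ((D : H -> H) - S')) h0 // mul0r.
Unshelve. all: by end_near. Qed.

End variation.

Variables (N : set (H -> H)) (tau : (H -> H) -> \bar R).
Hypothesis vN : von_neumann_algebra ip N.
Hypothesis tau_fns : fns_trace ip N tau.
Local Notation K := (compact_ideal ip N tau).

Lemma Li0_small T al e : 0 < al -> 0 < e -> Li0 ip N tau al T -> exists F : bop H,
  [/\ N F, proj F, (tau (1 - F : bop H)%R < +oo)%E & forall v, nr (T (F v)) <= e * nr v].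
Proof.
move=> al0 e0 LT; have [s0 s01 hs] := Li0_proj vN tau_fns e0 LT.
(* From [expR 1] on, the logarithm is at least 1 and its negative power at most 1. *)
have [|F [NF pF tF bF]] := hs (Num.max s0 (expR 1)); first by rewrite le_max lexx.
exists F; split=> //; first exact: le_lt_trans tF (ltry _).
move=> v; rewrite (le_trans (bF v))// ler_wpM2r ?nr_ge0// ger_pMr//.
apply: (@le_trans _ _ (1 `^ (- al))); last by rewrite powR1.
apply: ler_powRN; [exact: ltW|exact: ltr01|].
by rewrite -[leLHS]expRK ler_ln ?posrE ?expR_gt0// ?le_max ?lexx ?orbT// lt_max expR_gt0 orbT.
Qed.

(** [diff2 p q] is the identity on the range of [V], so [tau_proj_bound] applies with [a = 1] and
    [b = 1/2]. *)
Lemma meet_tau_fin_num p q al V : proj p -> proj q -> N q -> 0 < al ->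
  Li0 ip N tau al (diff2 p q) -> meet_proj ip p q V -> tau V \is a fin_num.
Proof.
move=> pp pq Nq al0 LA [pV bV fV _]; have NA : N (diff2 p q) by case: LA.
have h0 : 0 < 1 / 2 :> R by [].
have [F [NF pF fF bF]] := Li0_small al0 h0 LA.
have qA : diff2 p q * q = q * diff2 p q by exact: diff2_commr pp pq.
have NV : N V by apply: (N_bicomm vN _ bV); exact: (NM vN).
rewrite ge0_fin_numE ?(tau_ge0 tau_fns)//; last exact: proj_psd.
apply: (@le_lt_trans _ _ (2%:E * tau (1 - F : bop H)%R)%E).
  apply: (tau_proj_bound ip_norm vN tau_fns (T := diff2 p q) (a := 1) (b := 1 / 2)) => //.
  - exact: (sym_diff2 pp pq).
  - by apply/esym; apply: bV; rewrite mulrA qA mulrA.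
  - by move=> v /fV[qv pv]; rewrite mul1r (diff2_meet pp pq qv pv).
by rewrite lte_mul_pinfty.
Qed.

Variables p q : bop H.
Hypotheses (pp : proj p) (pq : proj q) (Np : N p) (Nq : N q).
Variable al : R.
Hypotheses (al0 : 0 < al).
Local Notation A := (diff2 p q).
Local Notation path := (path p q).
Hypothesis LA : Li0 ip N tau al A.

Let NA : N A. Proof. by case: LA. Qed.

Lemma diff2_compact : K (A : bop H).
Proof. by refine (K_small vN tau_fns NA _) => e e0; exact: (Li0_small al0 e0 LA). Qed.

(** The squared norm of [(q - p) F v] is the form of [A] at [F v]; hence [Li0_small] is called with
    [e^2]. *)
Lemma diff_compact : K (q - p : bop H).
Proof.
have sD : sym (q - p) by apply: symB; [exact: pq.1|exact: pp.1].
have ND : N (q - p : bop H) by exact: (NB vN).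
refine (K_small vN tau_fns ND _) => e e0.
have e20 : 0 < e ^+ 2 by rewrite exprn_gt0.
have [F [NF pF fF bF]] := Li0_small al0 e20 LA.
exists F; split=> // v; rewrite (nr_le_dr ip_norm) ?mulr_ge0 ?nr_ge0 ?(ltW e0)//.
rewrite exprMn -sD -[(q - p) ((q - p) (F v))]/(A (F v)).
rewrite (le_trans (ler_norm _))// (le_trans (dr_cs ip_norm _ _))//.
rewrite [nr v ^+ 2]expr2 mulrA ler_pM ?nr_ge0//.
by apply: (@psd_le1_nr _ _ ip ip_norm F v (proj_psd pF)) => x; exact: proj_le1.
Qed.

Lemma N_path t : N (path t).
Proof.
have N2 (r : bop H) : N r -> N (2%:C *: r - 1 : bop H).
  by move=> Nr; apply: (NB vN); [exact: (NZ vN)|exact: (N1 vN)].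
by apply: (ND vN); [exact: N2|apply: (NZ vN); apply: (NB vN); exact: N2].
Qed.

Lemma path_sqr_compl t : 1 - path t * path t = (4 * t * (1 - t))%:C *: A.
Proof. by rewrite (path_sqr pp pq) subKr. Qed.

Lemma path_sqr_compact t : K (1 - path t * path t : bop H).
Proof. by rewrite path_sqr_compl; refine (KZ vN _ _); exact: diff2_compact. Qed.

(** Each operator of the path is its own inverse modulo the ideal. *)
Lemma path_breuer_fredholm t : breuer_fredholm ip N tau (path t).
Proof.
split; first exact: N_path.
have h : K (path t * path t - 1 : bop H).
  by rewrite -opprB; refine (KN vN _); exact: path_sqr_compact.
by exists (path t); split; [exact: N_path| exact: h|exact: h].
Qed.

Lemma fredholm_path_path a b : fredholm_path ip N tau a b (fun t => path t : H -> H).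
Proof.
split; first exact: norm_continuous_path_path.
by move=> t _; split; [apply/sym_selfadjoint; exact: sym_path|exact: path_breuer_fredholm].
Qed.

Lemma path_compact s t : K (path s - path t : bop H).
Proof.
rewrite pathB; refine (KZ vN _ _).
have -> : path 1 - path 0 = 2%:C *: (q - p).
  apply: bop_ext => x; apply: (@dr_ext _ _ ip) => y.
  have -> : (path 1 - path 0) x = path 1 x - path 0 x by [].
  have -> : (2%:C *: (q - p)) x = 2%:C *: (q x - p x) by [].
  by rewrite !pathE !drE; ring.
by refine (KZ vN _ _); exact: diff_compact.
Qed.

(** At the endpoints [c = 0] and [tau_weight_lty] does not apply; there [c A = 0], every vector is
    an eigenvector for 0, and the value 0 of the weight at 0 makes [W = 0]. *)
Lemma calculus_path_tau r t W mu : 0 <= r -> 0 <= t <= 1 ->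
  spectral_data ip ((4 * t * (1 - t))%:C *: A) mu -> psd W ->
  bicomm ((4 * t * (1 - t))%:C *: A) W -> repr_fun ip mu (weight r al) W ->
  (tau W < +oo)%E.
Proof.
move=> r0 /andP[t0 t1]; set c := 4 * t * (1 - t) => dmu pW bW wW.
have sA : sym A := sym_diff2 pp pq.
have c1 : c <= 1 by rewrite /c; have := sqr_ge0 (2 * t - 1); rewrite expr2; lra.
have : 0 <= c by rewrite /c !mulr_ge0// subr_ge0.
rewrite le_eqVlt => /predU1P[c0|c0]; last first.
  exact: (tau_weight_lty ip_norm vN tau_fns r0 al0 sA LA c0 c1 dmu pW bW wW).
have -> : W = 0.
  apply: (sym_ext (ip := ip)); [exact: pW.1|exact: sym0|move=> x].
  have e : (c%:C *: A) x = c%:C *: x by rewrite -c0 bopZ_E !scale0r.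
  rewrite (repr_fun_eigen dmu (measurable_weight r0 al0) _ wW e) => [|a]; last exact: weight_ge0.
  by rewrite -c0 weight_npos// mul0r bop0_E dr0l.
by rewrite (tau0 vN tau_fns).
Qed.

(** The derivative is [2 (q - p)] and [W] commutes with [p] and [q], so [G] is [2 W q - 2 W p], a
    difference of positive elements of finite trace, as [trace_ext_diff] requires. [trace_meet_diff]
    applies because [c A] acts as [c] on the vectors fixed by [A]. *)
Lemma trace_path r t V V' : 0 <= r -> 0 <= t <= 1 ->
  meet_proj ip p q V -> meet_proj ip q p V' ->
  let G := norm_derive (fun t => path t : H -> H) t \o
    borel_calculus ip (weight r al) (idfun - (path t \o path t)) in
  finite_trace ip N tau G /\ trace_ext ip N tau G =
    (2 * weight r al (4 * t * (1 - t)) * (fine (tau V) - fine (tau V')))%:C.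
Proof.
move=> r0 t01 hV hV' G; pose c := 4 * t * (1 - t).
have scA : sym (c%:C *: A) by apply: symZ; exact: sym_diff2.
have [mu dmu] := spectral_data_ex ip_norm scA.
have [B B0 hB] := weight_le_cst r0 al0.
have [W [pW bW wW]] := calculus_ex ip_norm dmu (measurable_weight r0 al0) (@weight_ge0 _ r al) hB.
have fW := calculus_path_tau r0 t01 dmu pW bW wW.
have bAW : bicomm A W.
  by move=> S SA; apply: bW; rewrite -bop_scaleAl -bop_scaleAr SA.
have NW : N W := N_bicomm vN NA bAW.
have qW : q * W = W * q by apply: bAW; rewrite (diff2_commr pp pq).
have pWc : p * W = W * p by apply: bAW; rewrite (diff2_comml pp pq).
have GE : G = (2%:C *: (W * q) - 2%:C *: (W * p) : bop H) :> (H -> H).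
  rewrite /G norm_derive_path.
  have -> : idfun - (path t \o path t) = (c%:C *: A : bop H) :> (H -> H).
    by rewrite -path_sqr_compl.
  rewrite (borel_calculusE ip_norm scA dmu pW.1 wW).
  have e : path 1 - path 0 = 2%:C *: (q - p).
    apply: bop_ext => x; apply: (@dr_ext _ _ ip) => y.
    have -> : (path 1 - path 0) x = path 1 x - path 0 x by [].
    have -> : (2%:C *: (q - p)) x = 2%:C *: (q x - p x) by [].
    by rewrite !pathE !drE; ring.
  rewrite -[LHS]/(bop_fun ((path 1 - path 0) * W)) e.
  by congr bop_fun; rewrite -bop_scaleAl mulrBl qW pWc scalerBr.
have le1 z : proj z -> forall x, <<z x, x>> <= <<x, x>> by move=> pz x; exact: proj_le1.
have [NWq pWq fWq] := trace_psdM_lty ip_norm vN tau_fns NW pW fW Nq (proj_psd pq) (le1 q pq) qW.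
have [NWp pWp fWp] := trace_psdM_lty ip_norm vN tau_fns NW pW fW Np (proj_psd pp) (le1 p pp) pWc.
have h2 : 0 <= 2 :> R by [].
have fin2 X : N X -> psd X -> tau X \is a fin_num -> (tau (2%:C *: X : bop H) < +oo)%E.
  move=> NX pX fX; rewrite (tauZ tau_fns)// lte_mul_pinfty//.
  by rewrite -ge0_fin_numE ?(tau_ge0 tau_fns).
rewrite GE; have [fG ->] := trace_ext_diff vN tau_fns
  (NZ vN _ NWq) (psdZ h2 pWq) (fin2 _ NWq pWq fWq)
   (NZ vN _ NWp) (psdZ h2 pWp) (fin2 _ NWp pWp fWp).
split=> //; congr (_%:C).
rewrite !(tauZ tau_fns)// !fineZ -mulrBr.
rewrite (trace_meet_diff ip_norm vN tau_fns (lam := weight r al c)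
  pp pq Np Nq pW bAW fW hV hV') ?mulrA//.
move=> x Ax; apply: (repr_fun_eigen dmu (measurable_weight r0 al0) _ wW); first exact: weight_ge0.
by rewrite bopZ_E Ax.
Qed.

Section spectral_projections.
Variable E : R -> bop H.
Hypothesis pE : forall t, proj (E t).
Hypothesis bE : forall t, bicomm (path t) (E t).
Hypothesis E_pos : forall t x, 0 <= <<path t (E t x), E t x>>.
Hypothesis E_neg : forall t x, <<path t (x - E t x), x - E t x>> <= 0.

Lemma nonneg_proj_compact t u : 0 <= t <= 1 -> 0 <= u <= 1 -> K (E t - E u : bop H).
Proof.
have sgnK r : 0 <= r <= 1 -> K (sgn_op (E r) - path r : bop H).
  move=> /andP[r0 r1].
  refine (sgn_op_compact ip_norm (sym_path pp pq r) (pE r) (bE (t := r)) (E_pos r) (E_neg r)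
    vN (N_path r) _ (path_sqr_compact r)).
  rewrite path_sqr_compl; apply: psdZ; last exact: psd_diff2.
  by rewrite !mulr_ge0// subr_ge0.
move=> t01 u01.
have -> : E t - E u = (2^-1)%:C *: ((sgn_op (E t) - path t) + (path t - path u)
   - (sgn_op (E u) - path u)).
  rewrite addrA subrK /sgn_op opprB addrA subrK.
  apply: bop_ext => x; apply: (@dr_ext _ _ ip) => y.
  have -> : (E t - E u) x = E t x - E u x by [].
  have -> : ((2^-1)%:C *: (E t + E t - 1 - (E u + E u - 1))) x =
    (2^-1)%:C *: (E t x + E t x - x - (E u x + E u x - x)) by [].
  by rewrite !drE; field.
refine (KZ vN _ _); refine (KB vN _ _); last exact: sgnK.
by refine (KD _ _); [exact: sgnK|exact: path_compact].
Qed.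

End spectral_projections.

Lemma spectral_flow_path V V' : meet_proj ip p q V -> meet_proj ip q p V' ->
  is_spectral_flow ip N tau 0 1 (fun t => path t : H -> H) (fine (tau V) - fine (tau V')).
Proof.
move=> hV hV'; split; first exact: fredholm_path_path.
have /choice[E hE] := fun t => nonneg_spectral_projE ip_norm (sym_path pp pq t).
have PE t : nonneg_spectral_proj ip (path t) = E t by have [] := hE t.
have pE t : proj (E t) by have [_ []] := hE t.
have bE t : bicomm (path t) (E t) by have [_ []] := hE t.
have E_pos t x : 0 <= <<path t (E t x), E t x>> by have [_ _ h _ _] := hE t; exact: h.
have E_neg t x : <<path t (x - E t x), x - E t x>> <= 0 by have [_ _ _ h _] := hE t; exact: h.
have E_eig t x l : path t x = l%:C *: x -> E t x = if 0 <= l then x else 0.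
  by have [_ _ _ _ h] := hE t; exact: h.
(* Any mesh bound would do: all differences of the spectral projections are compact, and the indices
   telescope over every partition. *)
exists 1 => // s hs pt _; split=> [i si t u|]; last first.
  have fV := meet_tau_fin_num pp pq Nq al0 LA hV.
  have fV' : tau V' \is a fin_num.
    by apply: (meet_tau_fin_num pq pp Np al0 _ hV'); rewrite diff2C.
  rewrite -(sum_proj_index_path ip_norm pp pq pE bE E_pos E_neg E_eig hV hV'
    (tau0 vN tau_fns) fV fV' hs).
  by apply: eq_bigr => i _; rewrite !PE.
have itvE a : a \in `[pt i, pt i.+1] -> pt i <= a /\ a <= pt i.+1.
  by rewrite in_itv /= => /andP.
move=> /itvE[t1 t2] /itvE[u1 u2].
have i0 : 0 <= pt i by apply: (itv_partition_nth_ge _ hs); rewrite ltnS ltnW.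
have i1 : pt i.+1 <= 1 by apply: (itv_partition_nth_le _ hs); rewrite ltnS.
rewrite !PE; apply: quot_opnorm_lt1.
by refine (nonneg_proj_compact pE bE E_pos E_neg _ _); apply/andP; split; lra.
Qed.

End flow.

Theorem theorem4p1 (R : realType) (H : completeNormedModType R[i])
    (ip : {dot H for Num.conj}) (ip_norm : forall x : H, `|x| ^+ 2 = ip x x)
    (N : set (H -> H)) (tau : (H -> H) -> \bar R)
    (N_factor : vn_factor ip N) (N_sep : separable_predual ip N)
    (tau_fns : fns_trace ip N tau)
    (P Q : H -> H)
    (NP : N P) (P_proj : projection ip P)
    (NQ : N Q) (Q_proj : projection ip Q)
    (P_inf : infinite_proj ip N P) (P_coinf : infinite_proj ip N (idfun - P))
    (Q_inf : infinite_proj ip N Q) (Q_coinf : infinite_proj ip N (idfun - Q))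
    (q : R) (q_gt0 : 0 < q) (q_le1 : q <= 1)
    (PQ_Li : Li0 ip N tau q ((P - Q) \o (P - Q))) :
  let F0 : H -> H := 2 *: P - idfun in
  let F1 : H -> H := 2 *: Q - idfun in
  let F (t : R) : H -> H := F0 + t%:C *: (F1 - F0) in
  [/\ selfadjoint ip F0 /\ breuer_fredholm ip N tau F0,
      selfadjoint ip F1 /\ breuer_fredholm ip N tau F1,
      (forall t, t \in `[0, 1] ->
         selfadjoint ip (F t) /\ breuer_fredholm ip N tau (F t)) &
      forall r : R, 0 <= r ->
        let G (t : R) : H -> H := norm_derive F t \o
          borel_calculus ip (weight r q) (idfun - (F t \o F t)) in
        [/\ forall t, t \in `[0, 1] -> finite_trace ip N tau (G t),
            complex_integrable `[0, 1] (fun t => trace_ext ip N tau (G t)) &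
            exists2 sf : R, is_spectral_flow ip N tau 0 1 F sf &
              sf%:C = (Crq r q)^-1%:C *
                complex_integral `[0, 1] (fun t => trace_ext ip N tau (G t))]].
Proof.
have vN := N_factor.1.
have [p eP] := N_bop vN NP; have [q' eQ] := N_bop vN NQ.
move: NP P_proj NQ Q_proj PQ_Li; rewrite -{}eP -{}eQ.
move=> Np /proj_projection pp Nq /proj_projection pq LA F0 F1 F.
clear P Q P_inf P_coinf Q_inf Q_coinf.
have {}LA : Li0 ip N tau q (diff2 p q').
  have -> // : diff2 p q' = (p - q') \o (p - q') :> (H -> H).
  by rewrite -diff2C.
have two : 2 = 2%:C :> R[i] by rewrite rmorph_nat.
have F0E : F0 = path p q' 0.
  by apply/funext => x; rewrite pathE scale0r addr0 -two.
have F1E : F1 = path p q' 1.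
  by apply/funext => x; rewrite pathE scale1r addrC subrK -two.
have FE : F = fun t => path p q' t.
  by apply/funext => t; apply/funext => x; rewrite pathE -two.
have pathF t : selfadjoint ip (path p q' t) /\ breuer_fredholm ip N tau (path p q' t).
  split; first by apply/sym_selfadjoint; exact: sym_path.
  exact: (path_breuer_fredholm vN tau_fns pp pq Np Nq q_gt0 LA).
rewrite F0E F1E FE; split=> // r r0 G.
have [V hV] := meet_proj_ex ip_norm pp pq.
have [V' hV'] := meet_proj_ex ip_norm pq pp.
(* The value of the flow; the integrand is the scalar function of [Rintegral_weight] times [n]. *)
pose n := fine (tau V) - fine (tau V').
have hG t : t \in `[0, 1] -> finite_trace ip N tau (G t) /\
    trace_ext ip N tau (G t) = (2 * weight r q (4 * t * (1 - t)) * n)%:C.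
  move=> tI; have t01 : 0 <= t <= 1 by move: tI; rewrite in_itv.
  exact: (trace_path ip_norm vN tau_fns pp pq Np Nq q_gt0 LA r0 t01 hV hV').
have iw := integrable_weight r0 q_gt0.
have mI : measurable (`[0, 1]%classic : set (measurableTypeR R)) by exact: measurable_itv.
have ReG t : `[0, 1]%classic t ->
    complex.Re (trace_ext ip N tau (G t)) = 2 * weight r q (4 * t * (1 - t)) * n.
  by move=> /= tI; have [_ ->] := hG t tI.
have ImG t : `[0, 1]%classic t -> complex.Im (trace_ext ip N tau (G t)) = 0.
  by move=> /= tI; have [_ ->] := hG t tI.
split.
- by move=> t /hG[].
- split.
    apply: (eq_integrable mI (fun t => (2 * weight r q (4 * t * (1 - t)))%:E * n%:E)%E).
      by move=> t /set_mem tI; rewrite ReG// EFinM.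
    exact: integrableZr.
  apply: (eq_integrable mI (cst 0%E)); last exact: integrable0.
  by move=> t /set_mem tI; rewrite ImG.
exists n; first exact: (spectral_flow_path ip_norm vN tau_fns pp pq Np Nq q_gt0 LA hV hV').
rewrite /complex_integral.
have -> : Rintegral lebesgue_measure `[0, 1] (fun t => complex.Re (trace_ext ip N tau (G t))) =
    Crq r q * n.
  rewrite -(Rintegral_weight r0 q_gt0) -RintegralZr//.
  by apply: eq_Rintegral => t /set_mem tI; rewrite ReG.
have -> : Rintegral lebesgue_measure `[0, 1] (fun t => complex.Im (trace_ext ip N tau (G t))) = 0.
  transitivity (Rintegral (@lebesgue_measure R) `[0, 1] (cst 0)).
    by apply: eq_Rintegral => t /set_mem tI; rewrite ImG.
  by rewrite Rintegral_cst// mul0r.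
rewrite -[_ +i* 0]/((Crq r q * n)%:C) -RcM mulrA mulVf ?mul1r//.
by rewrite gt_eqF// Crq_gt0.
Qed.
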